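(* Let $f:\mathbb{T}^d\times\mathbb{R}^d\to\mathbb{T}^d\times\mathbb{R}^d$ be a symplectic twist map that is strongly positive, has bounded rate and satisfies the analyticity property, and let $G:\mathbb{T}^d\to\mathbb{R}$ be a function that admits a holomorphic extension to $\mathbb{C}^d$. Consider the family of symplectic twist maps $(f_\varepsilon)_{\varepsilon\in\mathbb{R}}$, $f_\varepsilon(q,p):=f(q,p+\varepsilon\nabla G(q))$, and let $(F_\varepsilon)_{\varepsilon\in\mathbb{R}}$ be a continuous family of lifts of the $f_\varepsilon$. Let $(m,n)\in\mathbb{Z}^d\times\mathbb{N}^*$, with $m$ and $n$ coprime, be such that $f_\varepsilon$ admits a Lipschitz Lagrangian $(m,n)$-periodic torus (that is, $F_\varepsilon$ admits a Lipschitz Lagrangian $(m,n)$-periodic graph) for infinitely many values of $\varepsilon\in\mathbb{R}$. Then $G$ must be constant.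
   Context: Here $d\ge1$, $\mathbb{T}^d=\mathbb{R}^d/\mathbb{Z}^d$, $\mathbb{N}^*=\{1,2,\dots\}$; functions on $\mathbb{T}^d$ are identified with $\mathbb{Z}^d$-periodic functions on $\mathbb{R}^d$. For $m=(m_1,\dots,m_d)\in\mathbb{Z}^d$ and $n\in\mathbb{N}^*$, coprime means $\gcd(m_1,\dots,m_d,n)=1$. Symplectic twist map: a $C^1$ diffeomorphism $f$ of $\mathbb{T}^d\times\mathbb{R}^d$ admitting a lift $F:\mathbb{R}^d\times\mathbb{R}^d\to\mathbb{R}^d\times\mathbb{R}^d$, $F(q,p)=(Q(q,p),P(q,p))$, such that: (1) $F(q+k,p)=F(q,p)+(k,0)$ for all $k\in\mathbb{Z}^d$; (2) $(q,p)\mapsto(q,Q(q,p))$ is a diffeomorphism of $\mathbb{R}^d\times\mathbb{R}^d$; (3) there is a generating function $S:\mathbb{R}^d\times\mathbb{R}^d\to\mathbb{R}$ with $S(q+k,Q+k)=S(q,Q)$ for all $k\in\mathbb{Z}^d$ and $P\,dQ-p\,dq=dS(q,Q)$. The map $f$ is strongly positive if there are $\alpha,\beta>0$ such that $-\beta\|v\|^2\le\partial_q\partial_QS(q,Q)(v,v)\le-\alpha\|v\|^2$ for all $q,Q,v\in\mathbb{R}^d$ (Euclidean norm). It has bounded rate if $\|\partial_q\partial_qS\|_\infty+\|\partial_Q\partial_QS\|_\infty<\infty$. The map $f_\varepsilon$ has generating function $S(q,Q)+\varepsilon G(q)$. Analyticity property of $f$: there is a holomorphic map $\mathcal{F}:\mathbb{C}^d\times\mathbb{C}^d\to\mathbb{C}^d\times\mathbb{C}^d$,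 $\mathcal{F}(q,p)=(Q(q,p),P(q,p))$, such that: $\mathcal{F}$ is a holomorphic diffeomorphism of $\mathbb{C}^d\times\mathbb{C}^d$; $\mathcal{F}|_{\mathbb{R}^d\times\mathbb{R}^d}$ is a lift of $f$; $(q,p)\mapsto(q,Q(q,p))$ is a diffeomorphism of $\mathbb{C}^d\times\mathbb{C}^d$; there is a generating function $S:\mathbb{C}^d\times\mathbb{C}^d\to\mathbb{C}$ with $S(q+k,Q+k)=S(q,Q)$ for $k\in\mathbb{Z}^d$ and $P\,dQ-p\,dq=dS(q,Q)$. Let $\gamma:\mathbb{R}^d\to\mathbb{R}^d$ be continuous and $\mathbb{Z}^d$-periodic and $(m,n)\in\mathbb{Z}^d\times\mathbb{N}^*$ with $m,n$ coprime. $\mathrm{graph}(\gamma)=\{(q,\gamma(q)):q\in\mathbb{R}^d\}$ is an $(m,n)$-periodic graph of a lift $F$ if $F^n(q,\gamma(q))=(q+m,\gamma(q))$ for all $q\in\mathbb{R}^d$; its projection to $\mathbb{T}^d\times\mathbb{R}^d$ is called an $(m,n)$-periodic torus of $f$. It is Lipschitz if $\gamma$ is Lipschitz. For $\gamma$ Lipschitz, $\mathrm{graph}(\gamma)$ is Lagrangian if $\int_{\mathbb{T}}\gamma(\nu(t))\cdot\dot\nu(t)\,dt=0$ for every $C^1$ loop $\nu:\mathbb{T}\to\mathbb{R}^d$. *)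

(* Defs.v *)
From mathcomp Require Import all_boot all_order all_algebra.
From mathcomp Require Import complex.
From mathcomp Require Import all_classical all_reals all_analysis.

Set Implicit Arguments.
Unset Strict Implicit.
Unset Printing Implicit Defensive.

Import Order.TTheory GRing.Theory Num.Theory.
Import numFieldNormedType.Exports.

Local Open Scope classical_set_scope.
Local Open Scope quotient_scope.
Local Open Scope ring_scope.

Definition phase (K : numFieldType) (d : nat) : normedModType K :=
  ('rV[K]_d * 'rV[K]_d)%type.

Definition dot (K : numFieldType) (d : nat) (u v : 'rV[K]_d) : K :=
  \sum_(i < d) u 0 i * v 0 i.

Definition intv (K : numFieldType) (d : nat) (k : 'rV[int]_d) : 'rV[K]_d :=
  map_mx intr k.

(* In finite dimension, pointwise continuity of [x |-> 'd f x] on each vector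
   is the same as its continuity in operator norm. *)
Definition C1 (K : numFieldType) (U V : normedModType K) (f : U -> V) : Prop :=
  (forall x, differentiable f x) /\
  (forall v, continuous (fun x => 'd f x v)).

Definition C1_diffeo (K : numFieldType) (U V : normedModType K)
    (f : U -> V) : Prop :=
  C1 f /\ exists g : V -> U, [/\ cancel f g, cancel g f & C1 g].

(* For [K := R[i]], [differentiable] is complex Frechet differentiability. *)
Definition holomorphic (K : numFieldType) (U V : normedModType K)
    (f : U -> V) : Prop := forall x, differentiable f x.

Definition holomorphic_diffeo (K : numFieldType) (U V : normedModType K)
    (f : U -> V) : Prop :=
  holomorphic f /\ exists g : V -> U, [/\ cancel f g, cancel g f & holomorphic g].

Section Torus.
Variables (R : realType) (d : nat).

Definition torus_eq (x y : 'rV[R]_d) : bool :=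
  [forall i, (x - y) 0 i \is a Num.int].

Lemma torus_eq_refl : reflexive torus_eq.
Proof. by move=> x; apply/forallP => i; rewrite subrr mxE rpred0. Qed.

Lemma torus_eq_sym : symmetric torus_eq.
Proof.
by move=> x y; apply: eq_forallb => i; rewrite -opprB mxE rpredN.
Qed.

Lemma torus_eq_trans : transitive torus_eq.
Proof.
move=> y x z /forallP xy /forallP yz; apply/forallP => i.
have -> : x - z = (x - y) + (y - z) by rewrite addrA subrK.
by rewrite mxE rpredD.
Qed.

Canonical torus_equiv :=
  EquivRel torus_eq torus_eq_refl torus_eq_sym torus_eq_trans.

Definition torus := {eq_quot torus_eq}.

Definition annulus : Type := (torus * 'rV[R]_d)%type.

Definition annulus_pi (x : phase R d) : annulus := (\pi_torus x.1, x.2).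

Definition is_lift (f : annulus -> annulus)
    (F : phase R d -> phase R d) : Prop :=
  continuous F /\ forall x, annulus_pi (F x) = f (annulus_pi x).

(* The plane [phase R d] being the universal cover, [f] is C^1 as a map of
   manifolds iff it has a C^1 lift. *)
Definition annulus_C1 (f : annulus -> annulus) : Prop :=
  exists F, is_lift f F /\ C1 F.

Definition annulus_C1_diffeo (f : annulus -> annulus) : Prop :=
  annulus_C1 f /\
  exists g, [/\ cancel f g, cancel g f & annulus_C1 g].

End Torus.

Section Twist.
Variables (K : numFieldType) (d : nat).
Implicit Types (F : phase K d -> phase K d) (S : phase K d -> K).

Definition twist_chart F : phase K d -> phase K d := fun x => (x.1, (F x).1).

(* The third clause is [P dQ - p dq = d(S(q, Q))], as an identity between
   1-forms in the coordinates (q, p), evaluated at the tangent vector [h]. *)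
Definition generating_function F S : Prop :=
  [/\ forall x, differentiable (S : phase K d -> K^o) x,
      forall (k : 'rV[int]_d) (q Q : 'rV[K]_d),
        S (q + intv K k, Q + intv K k) = S (q, Q)
    & forall x h : phase K d,
        'd (S \o twist_chart F : phase K d -> K^o) x h =
        dot (F x).2 ('d (fun y => (F y).1) x h) - dot x.2 h.1].

End Twist.

Section RealTwist.
Variables (R : realType) (d : nat).
Implicit Types (f : annulus R d -> annulus R d).
Implicit Types (F : phase R d -> phase R d) (S : phase R d -> R).

Definition twist_lift f F S : Prop :=
  [/\ is_lift f F,
      forall (k : 'rV[int]_d) (q p : 'rV[R]_d),
        F (q + intv R k, p) = ((F (q, p)).1 + intv R k, (F (q, p)).2),
      C1_diffeo (twist_chart F)
    & generating_function F S].

Definition symplectic_twist_map f : Prop :=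
  annulus_C1_diffeo f /\ exists F S, twist_lift f F S.

Definition dir_q (u : 'rV[R]_d) : phase R d := (u, 0).
Definition dir_Q (u : 'rV[R]_d) : phase R d := (0, u).

(* When [twist_lift f F S] holds with [f] of class C^1, [S] is of class C^2, so
   these iterated directional derivatives exist.
   [second_diff S a b x] is the matrix of second partial derivatives
   [d/da_i d/db_j S] at [x], with [a] and [b] among [dir_q] and [dir_Q]. *)
Definition second_diff S (a b : 'rV[R]_d -> phase R d) (x : phase R d) :
    'M[R]_d :=
  \matrix_(i, j)
    'D_(a (delta_mx 0 i))
      (fun y => 'D_(b (delta_mx 0 j)) (S : phase R d -> R^o) y : R^o) x.

(* [dot v v] is the squared Euclidean norm; the library norm on ['rV[R]_d] is
   the sup norm. *)
Definition strongly_positive f : Prop :=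
  exists F S, twist_lift f F S /\
  exists alpha beta : R, [/\ 0 < alpha, 0 < beta
    & forall (q Q v : 'rV[R]_d),
        - beta * dot v v <= dot (v *m second_diff S dir_q dir_Q (q, Q)) v
          <= - alpha * dot v v].

(* [`|A x|] is the largest modulus of an entry, equivalent to the operator
   norm; only finiteness of the supremum is used. *)
Definition sup_norm (A : phase R d -> 'M[R]_d) : \bar R :=
  ereal_sup (range (fun x => `|A x|%:E)).

Definition bounded_rate f : Prop :=
  exists F S, twist_lift f F S /\
  (sup_norm (second_diff S dir_q dir_q) +
   sup_norm (second_diff S dir_Q dir_Q) < +oo)%E.

Definition Cfield : numFieldType := (R[i])%C.

Definition complexify (x : 'rV[R]_d) : 'rV[Cfield]_d :=
  map_mx (real_complex R) x.

Definition complexify2 (x : phase R d) : phase Cfield d :=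
  (complexify x.1, complexify x.2).

Definition analyticity_property f : Prop :=
  exists cF : phase Cfield d -> phase Cfield d,
  [/\ holomorphic_diffeo cF,
      exists F : phase R d -> phase R d,
        is_lift f F /\ forall x, cF (complexify2 x) = complexify2 (F x),
      holomorphic_diffeo (twist_chart cF)
    & exists S : phase Cfield d -> Cfield, generating_function cF S].

Definition has_holomorphic_extension (G : torus R d -> R) : Prop :=
  exists g : 'rV[Cfield]_d -> Cfield^o,
    holomorphic g /\
    forall x : 'rV[R]_d, g (complexify x) = real_complex R (G (\pi x)).

(* The choice of [repr q] is immaterial, [G \o \pi] being Z^d-periodic. *)
Definition torus_grad (G : torus R d -> R) (q : torus R d) : 'rV[R]_d :=
  \row_i 'D_(delta_mx 0 i)
    (fun x : 'rV[R]_d => G (\pi_(torus R d) x) : R^o) (repr q).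

Definition perturbed f (G : torus R d -> R) (eps : R) :
    annulus R d -> annulus R d :=
  fun x => f (x.1, x.2 + eps *: torus_grad G x.1).

Definition continuous_family_of_lifts
    (f : R -> annulus R d -> annulus R d)
    (F : R -> phase R d -> phase R d) : Prop :=
  (forall eps, is_lift (f eps) (F eps)) /\
  continuous (fun z : R * phase R d => F z.1 z.2).

Definition coprime_vec (m : 'rV[int]_d) (n : nat) : bool :=
  coprime (\big[gcdn/0]_(i < d) `|m ord0 i|)%N n.

Definition periodic_graph F (m : 'rV[int]_d) (n : nat)
    (gamma : 'rV[R]_d -> 'rV[R]_d) : Prop :=
  [/\ continuous gamma,
      forall (k : 'rV[int]_d) q, gamma (q + intv R k) = gamma q
    & forall q, iter n F (q, gamma q) = (q + intv R m, gamma q)].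

Definition lagrangian (gamma : 'rV[R]_d -> 'rV[R]_d) : Prop :=
  forall nu : R^o -> 'rV[R]_d, C1 nu -> (forall t, nu (t + 1) = nu t) ->
  \int[lebesgue_measure]_(t in `[0, 1]) dot (gamma (nu t)) ('D_1 nu t) = 0.

Definition lipschitz_lagrangian_periodic_graph F (m : 'rV[int]_d) (n : nat)
    (gamma : 'rV[R]_d -> 'rV[R]_d) : Prop :=
  [/\ periodic_graph F m n gamma, lipschitz gamma & lagrangian gamma].

End RealTwist.

(* Main.v *)
(* Along an orbit segment [x_0, ..., x_n] of [f_e] the action is the sum of
   [S(x_i, x_(i+1)) + e G(x_i)]. A Lipschitz Lagrangian graph is the graph of some [dU]. When it is
   (m, n)-periodic for [f_e], minimizing the action corrected by the boundary term [U(x_0) - U(x_n)]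
   shows that its orbits minimize the action among the configurations with [x_n = x_0 + m], and that
   this remains true for configurations of length [2n] from [x_0] to [x_0 + 2m]; say that [e] is
   calibrated if there are such minimizers through every point. There are three consequences.

   - Moving the middle point of a minimizer of length [2n] by an integer vector [k] gives
     [|e| |dG(q).k| <= C |k|^2] with [C] independent of [e]. So [dG = 0] as soon as the calibrated
     parameters are unbounded, and it suffices to show that the good parameters, i.e. those with an
     invariant torus, are unbounded.

   - The action grows quadratically away from the minimizers. Hence the differential of
     [p |-> pi_1 F_e^n(q, p)] at the momentum of a minimizer is injective, also over the complex
     numbers, and the holomorphic implicit function theorem applies.

   - Calibration is a closed condition on [e]. So near an accumulation point [e_0] of good parameters
     the momenta of the tori extend to a holomorphic function of [e], on a disc independent of [q].
     Interpolating at good parameters near [e_0] expresses its values at real [e] as uniform limits of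
     real combinations of gradients, which are gradients, and the periodicity of the orbits persists by
     the same interpolation. Thus all [e] close to [e_0] are good.

   If the good parameters are bounded, the last point contradicts the existence of the supremum of an
   interval of good parameters. *)

From HB Require Import structures.
Require Import Defs.
From mathcomp Require Import all_boot all_order all_algebra.
From mathcomp Require Import complex.
From mathcomp Require Import all_classical all_reals all_analysis.
From mathcomp Require Import ring lra.
Set Implicit Arguments.
Unset Strict Implicit.
Unset Printing Implicit Defensive.
Import Order.TTheory GRing.Theory Num.Theory.
Import numFieldNormedType.Exports.
Local Open Scope classical_set_scope.
Local Open Scope ring_scope.

(** * Primitives on the real line *)

Section RealLine.
Context {R : realType}.
Implicit Types (phi Phi : R -> R).

(** Length 2n is used because a minimizer with fixed ends says nothing about its end points:
    followed by a translated copy, its last point becomes interior, which forces the momenta to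
    match there and gives a quadratic lower bound when it is moved. Nondegeneracy is wanted at an
    accumulation point, not known to carry a torus; calibration is the trace of the tori that
    survives the limit.

    The complex analysis rests on one estimate, the error of Newton interpolation of a bounded
    holomorphic function at real nodes. With one or two nodes it gives Lipschitz bounds, strict
    differentiability and holomorphic partial derivatives; with many nodes it continues the tori.
    Its coefficients are real and act on values at parameters where the graph is a gradient, which a
    power series would not offer.

    Each hypothesis on the map brings its own lift and generating function. Lifts differ by integer
    translations, and the record [twist_system] collects the data on a single lift, with positivity
    and bounded rate in integrated form: monotonicity and Lipschitz bounds on momenta. *)

Definition primitive phi Phi := forall x : R, is_derive x 1 Phi (phi x).

Lemma is_derive_continuous (f : R -> R) (x d : R) : is_derive x 1 f d -> {for x, continuous f}.
Proof. by move=> h; apply/differentiable_continuous/derivable1_diffP. Qed.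

Lemma primitive_continuous phi Phi : primitive phi Phi -> continuous Phi.
Proof. by move=> h x; apply: is_derive_continuous (h x). Qed.

Lemma mean_value (f df : R -> R) (a b : R) :
  (forall x : R, is_derive x 1 f (df x)) ->
  exists2 c, Num.min a b <= c <= Num.max a b & f b - f a = df c * (b - a).
Proof.
move=> fd; wlog ab : a b / a <= b.
  move=> H; have [ab|/ltW ba] := leP a b.
    by have := H a b ab; rewrite (min_idPl ab) (max_idPr ab).
  have [c] := H b a ba; rewrite (min_idPl ba) (max_idPr ba) => cI fE.
  by exists c => //; rewrite -opprB fE; ring.
rewrite (min_idPl ab) (max_idPr ab).
have cf : {within `[a, b], continuous f}.
  by apply: continuous_subspaceT; apply: primitive_continuous fd.
have [c] := MVT_segment ab (fun x _ => fd x) cf.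
by rewrite in_itv /= => cI fE; exists c.
Qed.

Lemma primitive_unique phi Phi Psi a b : primitive phi Phi -> primitive phi Psi ->
  Phi b - Phi a = Psi b - Psi a.
Proof.
move=> h1 h2; have h (x : R) : is_derive x 1 (Phi - Psi) (0 : R).
  have := h1 x; have := h2 x => *.
  by apply: is_derive_eq (subrr (phi x)).
have [c _] := mean_value a b h; rewrite mul0r /= => /eqP.
by rewrite -[_ b]/(Phi b - Psi b) -[_ a]/(Phi a - Psi a); move/eqP; lra.
Qed.

(** The integral from [a] has derivative [phi] to the right of [a], by the fundamental theorem of
    calculus; [primitive_exists] glues such functions. *)
Lemma primitive_gt phi a : continuous phi ->
  exists Phi : R -> R, forall x : R, a < x -> is_derive x 1 Phi (phi x).
Proof.
move=> cphi.
exists (fun x => (\int[lebesgue_measure]_(t in [set` `[a, x]]) phi t)%R) => x ax.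
have xx : x < x + 1 by rewrite ltrDl.
have int : lebesgue_measure.-integrable `[a, x + 1] (EFin \o phi).
  apply: continuous_compact_integrable; first exact: segment_compact.
  exact: continuous_subspaceT.
have [d1 d2] := continuous_FTC1_closed xx int ax (cphi x).
by rewrite derive1E in d2; exact: (DeriveDef d1 d2).
Qed.

(** Primitives on the half-lines [x > - N.+1], normalized to vanish at 0, agree where both are
    valid, since their difference has zero derivative. At [x] the index is the integer part of
    [|x|]. *)
Lemma primitive_exists phi : continuous phi -> exists Phi, primitive phi Phi.
Proof.
move=> cphi.
have /choice[P PP] : forall N : nat, exists Phi : R -> R, Phi 0 = 0 /\
    forall x : R, - N.+1%:R < x -> is_derive x 1 Phi (phi x).
  move=> N; have [Phi h] := primitive_gt (- N.+1%:R) cphi.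
  exists (fun x => Phi x - Phi 0); split; first by rewrite subrr.
  by move=> x /h hx; apply: is_derive_eq (subr0 _).
have PE N M x : - N.+1%:R < x -> - M.+1%:R < x -> P N x = P M x.
  move=> hN hM.
  have [PN0 PN] := PP N; have [PM0 PM] := PP M.
  pose f y := P N y - P M y.
  have h (y : R) : Num.min 0 x <= y -> is_derive y 1 f (0 : R).
    move=> xy.
    have [yN yM] : - N.+1%:R < y /\ - M.+1%:R < y.
      by split; apply: lt_le_trans xy; rewrite lt_min oppr_lt0 ltr0n.
    have := PN y yN; have := PM y yM => *.
    by apply: is_derive_eq (subrr (phi y)).
  suff : f x - f 0 = 0.
    by rewrite /f PN0 PM0; lra.
  have [x0|/ltW x0] := leP 0 x.
  - have [||c _ ->] := @MVT_segment R f (fun=> 0) 0 x x0; last by rewrite mul0r.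
      by move=> y; rewrite in_itv /= => /andP[/ltW y0 _]; apply: h; rewrite (min_idPl x0).
    apply: derivable_within_continuous => y; rewrite in_itv /= => /andP[y0 _].
    by have /h[] : Num.min 0 x <= y by rewrite (min_idPl x0).
  - apply/eqP; rewrite -oppr_eq0 opprB; apply/eqP.
    have d y : y \in `]x, 0[%R -> is_derive y 1 f (0 : R).
      by rewrite in_itv /= => /andP[/ltW y0 _]; apply: h; rewrite (min_idPr x0).
    have cf : {within `[x, 0], continuous f}.
      apply: derivable_within_continuous => y; rewrite in_itv /= => /andP[y0 _].
      by have /h[] : Num.min 0 x <= y by rewrite (min_idPr x0).
    by have [c _ ->] := MVT_segment x0 d cf; rewrite mul0r.
pose idx (x : R) := Num.truncn `|x|.
have idxP x : `|x| < (idx x).+1%:R by exact: truncnS_gt.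
exists (fun x => P (idx x) x) => x.
(* The index jumps as [y] varies; the single index [(idx x).+1] serves for all [y] near [x]. *)
have near_x : \forall y \near x, P (idx x).+1 y = P (idx y) y.
  near=> y; apply: PE.
    have yx : `|x - y| < 1 by near: y; apply: cvgr_dist_lt => //.
    have := idxP x; rewrite -[(idx x).+2%:R]natr1.
    by move: yx; rewrite !ltr_norml => /andP[? ?] /andP[? ?]; lra.
  by have := idxP y; rewrite ltr_norml => /andP[].
apply: near_eq_is_derive near_x _.
apply: (PP _).2; have := idxP x; rewrite -[(idx x).+2%:R]natr1.
by rewrite ltr_norml => /andP[? ?]; lra.
Unshelve. all: by end_near.
Qed.

(** As the increment of a chosen primitive, the integral is oriented and additive for end points in
    any order. In return, its rules ask the integrand to be continuous on the whole line. The value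
    is 0 when there is no primitive. *)
Definition integ phi (a b : R) : R :=
  let Phi := xget (fun=> 0) [set Phi | primitive phi Phi] in Phi b - Phi a.

Lemma integP phi Phi a b : primitive phi Phi -> integ phi a b = Phi b - Phi a.
Proof.
rewrite /integ => h; apply: (@primitive_unique phi) => //.
by case: xgetP => [_ -> //|]; move/(_ _ h).
Qed.

Lemma integ_cat phi a b c : integ phi a b + integ phi b c = integ phi a c.
Proof. by rewrite /integ; lra. Qed.

Lemma integD phi psi a b : continuous phi -> continuous psi ->
  integ (fun x => phi x + psi x) a b = integ phi a b + integ psi a b.
Proof.
move=> /primitive_exists[F hF] /primitive_exists[G hG].
rewrite (integP a b hF) (integP a b hG) (@integP _ (fun x => F x + G x)); first by lra.
by move=> x; have := hF x; have := hG x => *; apply: is_derive_eq.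
Qed.

Lemma integZ k phi a b : continuous phi ->
  integ (fun x => k * phi x) a b = k * integ phi a b.
Proof.
move=> /primitive_exists[F hF].
rewrite (integP a b hF) (@integP _ (fun x => k * F x)); first by lra.
by move=> x; have := hF x => ?; apply: is_derive_eq; rewrite /GRing.scale /=; ring.
Qed.

Lemma integ_affine (u v a b : R) :
  integ (fun x => u + v * x) a b = u * (b - a) + v * (b ^+ 2 - a ^+ 2) / 2.
Proof.
rewrite (@integP _ (fun x => u * x + v * x ^+ 2 / 2)); first by field.
move=> x; apply: is_derive_eq; rewrite /GRing.scale /=; by field.
Qed.

Lemma integ_bound phi a b M : continuous phi ->
  (forall x, Num.min a b <= x <= Num.max a b -> `|phi x| <= M) ->
  `|integ phi a b| <= M * `|b - a|.
Proof.
move=> /primitive_exists[F hF] hM; rewrite (integP a b hF).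
by have [c /hM cM ->] := mean_value a b hF; rewrite normrM ler_wpM2r.
Qed.

Lemma integ_gt0 phi a b : continuous phi -> a < b ->
  (forall x, a <= x <= b -> 0 < phi x) -> 0 < integ phi a b.
Proof.
move=> /primitive_exists[F hF] ab h; rewrite (integP a b hF).
have [c] := mean_value a b hF; rewrite (min_idPl (ltW ab)) (max_idPr (ltW ab)).
by move=> /h cp ->; rewrite mulr_gt0 ?subr_gt0.
Qed.

End RealLine.

(** * Complex numbers and real-valued norms *)

Section ComplexBasics.
Context {R : realType}.
Local Notation C := (Cfield R).

Definition cx (x y : R) : C := Complex x y.
Definition cre (z : C) : R := complex.Re z.
Definition cim (z : C) : R := complex.Im z.
Definition rc (x : R) : C := cx x 0.

Lemma cxE z : z = cx (cre z) (cim z). Proof. by case: z. Qed.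
Lemma cre_cx x y : cre (cx x y) = x. Proof. by []. Qed.
Lemma cim_cx x y : cim (cx x y) = y. Proof. by []. Qed.
Lemma ceqP (z w : C) : cre z = cre w -> cim z = cim w -> z = w.
Proof. by case: z w => [a b] [c d]; rewrite /cre /cim /= => -> ->. Qed.
Lemma cre0 : cre 0 = 0. Proof. by []. Qed.
Lemma cim0 : cim 0 = 0. Proof. by []. Qed.
Lemma cre1 : cre 1 = 1. Proof. by []. Qed.
Lemma cim1 : cim 1 = 0. Proof. by []. Qed.
Lemma creD (z w : C) : cre (z + w) = cre z + cre w. Proof. by case: z w => [a b] []. Qed.
Lemma cimD (z w : C) : cim (z + w) = cim z + cim w. Proof. by case: z w => [a b] []. Qed.
Lemma creN (z : C) : cre (- z) = - cre z. Proof. by case: z. Qed.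
Lemma cimN (z : C) : cim (- z) = - cim z. Proof. by case: z. Qed.
Lemma creB (z w : C) : cre (z - w) = cre z - cre w. Proof. by rewrite creD creN. Qed.
Lemma cimB (z w : C) : cim (z - w) = cim z - cim w. Proof. by rewrite cimD cimN. Qed.
Lemma creM (z w : C) : cre (z * w) = cre z * cre w - cim z * cim w.
Proof. by case: z w => [a b] []. Qed.
Lemma cimM (z w : C) : cim (z * w) = cre z * cim w + cim z * cre w.
Proof. by case: z w => [a b] []. Qed.
Definition creimE := (cre_cx, cim_cx, cre0, cim0, cre1, cim1, creB, cimB, creD, cimD, creN, cimN, creM, cimM).

Lemma rcD x y : rc (x + y) = rc x + rc y. Proof. by apply: ceqP; rewrite !creimE ?addr0. Qed.
Lemma rcN x : rc (- x) = - rc x. Proof. by apply: ceqP; rewrite !creimE ?oppr0. Qed.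
Lemma rcB x y : rc (x - y) = rc x - rc y. Proof. by rewrite rcD rcN. Qed.
Lemma rcM x y : rc (x * y) = rc x * rc y. Proof. by apply: ceqP; rewrite !creimE; ring. Qed.
Lemma rc0 : rc 0 = 0. Proof. by []. Qed.
Lemma rc1 : rc 1 = 1. Proof. by []. Qed.
Lemma rcI : injective rc. Proof. by move=> x y []. Qed.
Lemma rc_eq0 x : (rc x == 0) = (x == 0).
Proof. by apply/eqP/eqP => [|->//]; rewrite -rc0 => /rcI. Qed.
Lemma rcV x : rc x^-1 = (rc x)^-1.
Proof.
have [->|x0] := eqVneq x 0; first by rewrite invr0 rc0 invr0.
by apply: (@mulIf _ (rc x)); rewrite ?rc_eq0// -rcM mulVf// mulVf ?rc_eq0.
Qed.

(** The norm of a space over [C] takes its values in [C]; [nr] is the same norm as a real number, so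
    that estimates are inequalities in [R]. *)
Definition nr {V : normedModType C} (v : V) : R := cre `|v|.

Lemma nrE (V : normedModType C) (v : V) : `|v| = rc (nr v).
Proof.
apply: ceqP => //; rewrite cim_cx; have : 0 <= `|v| by [].
by move/(@ger0_Im R).
Qed.

Lemma le_rc x y : (rc x <= rc y) = (x <= y). Proof. exact: lecR. Qed.
Lemma lt_rc x y : (rc x < rc y) = (x < y). Proof. exact: ltcR. Qed.

Section Norm.
Context {V : normedModType C}.
Implicit Types v w : V.
Lemma nr_ge0 v : 0 <= nr v. Proof. by have : rc 0 <= `|v| := normr_ge0 v; rewrite nrE le_rc. Qed.
Lemma nr0 : nr (0 : V) = 0. Proof. by rewrite /nr normr0. Qed.
Lemma nr_eq0 v : (nr v == 0) = (v == 0).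
Proof. by rewrite -[RHS]normr_eq0 nrE rc_eq0. Qed.
Lemma nr_gt0 v : (0 < nr v) = (v != 0).
Proof. by rewrite lt_def nr_eq0 nr_ge0 andbT. Qed.
Lemma nrN v : nr (- v) = nr v. Proof. by rewrite /nr normrN. Qed.
Lemma nrD v w : nr (v + w) <= nr v + nr w.
Proof. by rewrite -le_rc rcD -!nrE ler_normD. Qed.
Lemma nrB v w : nr (v - w) <= nr v + nr w.
Proof. by rewrite -(nrN w) nrD. Qed.
Lemma nr_dist v w : nr (v - w) = nr (w - v).
Proof. by rewrite -opprB nrN. Qed.
Lemma nr_distD w v u : nr (v - u) <= nr (v - w) + nr (w - u).
Proof. by rewrite -[v - u](subrKA w) nrD. Qed.
Lemma nrZ (a : C) v : nr (a *: v) = nr a * nr v.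
Proof. by apply: rcI; rewrite rcM -!nrE normrZ. Qed.
End Norm.

Lemma nrM (a b : C) : nr (a * b) = nr a * nr b. Proof. exact: nrZ. Qed.
Lemma nrX (a : C) k : nr (a ^+ k) = nr a ^+ k.
Proof. by apply: rcI; rewrite -nrE normrX nrE; elim: k => [//|k IH]; rewrite !exprS IH rcM. Qed.
Lemma nrV (a : C) : nr a^-1 = (nr a)^-1.
Proof. by apply: rcI; rewrite rcV -!nrE normfV. Qed.
Lemma nr_sqr (z : C) : nr z ^+ 2 = cre z ^+ 2 + cim z ^+ 2.
Proof.
rewrite /nr normc_def /cre /= sqr_sqrtr //; apply: addr_ge0; exact: sqr_ge0.
Qed.
Lemma nr_rc x : nr (rc x) = `|x|.
Proof.
apply/eqP; rewrite -(eqrXn2 (n:=2)) ?nr_ge0//.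
by rewrite nr_sqr !creimE expr0n addr0 real_normK ?num_real.
Qed.
Lemma nr1 : nr (1 : C) = 1. Proof. by rewrite -rc1 nr_rc normr1. Qed.
Lemma cre_le (z : C) : `|cre z| <= nr z.
Proof.
rewrite -(ler_pXn2r (n:=2)) ?nnegrE ?nr_ge0// nr_sqr real_normK ?num_real//.
by rewrite lerDl sqr_ge0.
Qed.
Lemma cim_le (z : C) : `|cim z| <= nr z.
Proof.
rewrite -(ler_pXn2r (n:=2)) ?nnegrE ?nr_ge0// nr_sqr real_normK ?num_real//.
by rewrite lerDr sqr_ge0.
Qed.
Lemma nr_le (z : C) : nr z <= `|cre z| + `|cim z|.
Proof.
rewrite -(ler_pXn2r (n:=2)) ?nnegrE ?nr_ge0 ?addr_ge0// nr_sqr sqrrD !real_normK ?num_real//.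
by rewrite -addrA lerD2l addrC lerDl mulrn_wge0 ?mulr_ge0.
Qed.

Lemma nr_sum (V : normedModType C) (I : Type) (s : seq I) (P : pred I) (F : I -> V) :
  nr (\sum_(i <- s | P i) F i) <= \sum_(i <- s | P i) nr (F i).
Proof.
elim/big_ind2 : _ => [|u a v b ua vb|i _]; rewrite ?nr0//.
exact: le_trans (nrD _ _) (lerD ua vb).
Qed.

Lemma pos_rc (e : C) : 0 < e -> exists2 x : R, 0 < x & e = rc x.
Proof.
move=> e0; have e1 : e = rc (nr e) by rewrite -nrE gtr0_norm.
by exists (nr e) => //; rewrite nr_gt0 gt_eqF.
Qed.

Lemma cvg_nrP (T : Type) (F : set_system T) (FF : Filter F) (V : normedModType C) (f : T -> V) (y : V) :
  f @ F --> y <-> forall e : R, 0 < e -> \forall t \near F, nr (f t - y) < e.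
Proof.
split=> [/cvgrPdist_lt h e e0|h].
  have /h : (0 : C) < rc e by rewrite -rc0 lt_rc.
  by apply: filterS => t; rewrite nrE lt_rc nr_dist.
apply/cvgrPdist_lt => _ /pos_rc[e e0 ->]; have := h e e0.
by apply: filterS => t; rewrite nrE lt_rc nr_dist.
Qed.

Lemma near_nrP (V : normedModType C) (x : V) (P : set V) :
  (\forall y \near x, P y) <-> exists2 d : R, 0 < d & forall y, nr (y - x) < d -> P y.
Proof.
split=> [/nbhs_ballP[_ /= /pos_rc[d d0 ->] h]|[d d0 h]].
  by exists d => // y yx; apply: h; rewrite -ball_normE /= nrE lt_rc nr_dist.
apply/nbhs_ballP; exists (rc d); first by rewrite /= -rc0 lt_rc.
by move=> y; rewrite -ball_normE /= nrE lt_rc nr_dist => /h.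
Qed.

Lemma continuous_nrP (V W : normedModType C) (f : V -> W) (x : V) :
  {for x, continuous f} <->
  forall e : R, 0 < e -> exists2 d : R, 0 < d & forall y, nr (y - x) < d -> nr (f y - f x) < e.
Proof.
rewrite /prop_for /continuous_at cvg_nrP.
by split=> h e /h /near_nrP.
Qed.

Lemma differentiable_nr (V W : normedModType C) (f : V -> W) (x : V) :
  differentiable f x -> forall e : R, 0 < e -> exists2 d : R, 0 < d &
    forall h, nr h < d -> nr (f (x + h) - f x - 'd f x h) <= e * nr h.
Proof.
move=> /diff_locallyP[_ df] e e0.
have e0' : (0 : C) < rc e by rewrite -rc0 lt_rc.
have /eqaddoP /(_ _ e0') /near_nrP[d d0 H] := df.
exists d => // h hd; have := H h; rewrite subr0 => /(_ hd).
rewrite /= !nrE -rcM le_rc; congr (nr _ <= _).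
by rewrite -[LHS]/(f (h + x) - (f x + 'd f x h)) opprD addrA (addrC h).
Qed.

Lemma nr_differentiable1 (f : C -> C) (z D : C) :
  (forall e : R, 0 < e -> exists2 d : R, 0 < d &
    forall h, nr h < d -> nr (f (z + h) - f z - D * h) <= e * nr h) ->
  differentiable f z.
Proof.
move=> H; apply/derivable1_diffP; apply/cvg_ex; exists D.
apply/cvg_nrP => e e0; have [d d0 hd] := H (e / 2) (divr_gt0 e0 (ltr0n _ 2)).
have [_ near0] := near_nrP (0 : C) (fun h : C => h != 0 ->
  nr (h^-1 *: ((f \o shift z) (h *: 1) - f z) - D : C) < e).
rewrite near_withinE; apply: near0; exists d => // h; rewrite subr0 => hh h0.
have := hd h hh.
rewrite -[X in nr X < _]/(h^-1 * (f (h * 1 + z) - f z) - D) mulr1 (addrC h).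
have -> : h^-1 * (f (z + h) - f z) - D = h^-1 * (f (z + h) - f z - D * h).
  by rewrite [RHS]mulrBr [h^-1 * (D * h)]mulrCA mulVf// mulr1.
rewrite nrM nrV => H1; have h1 : 0 < nr h by rewrite nr_gt0.
rewrite mulrC ltr_pdivrMr//; apply: le_lt_trans H1 _.
by rewrite ltr_pM2r//; lra.
Qed.

Lemma differentiable_nr1 (f : C -> C) (z : C) : differentiable f z ->
  exists D, forall e : R, 0 < e -> exists2 d : R, 0 < d &
    forall h, nr h < d -> nr (f (z + h) - f z - D * h) <= e * nr h.
Proof.
move=> df; exists ('d f z 1) => e /(differentiable_nr df)[d d0 H].
exists d => // h /H.
have -> : 'd f z h = 'd f z 1 * h; last by [].
by have := linearZ_LR ('d f z) h 1; rewrite -[h *: 1]/(h * 1) mulr1 mulrC.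
Qed.

(** The derivative at [a] is [u a]. A factor that vanishes at [a] thus repairs a function only known
    to be continuous there, which is how [max_principle] treats its exceptional points. *)
Lemma continuous_mulsub (u : C -> C) (a : C) : {for a, continuous u} ->
  differentiable (fun z => (z - a) * u z) a.
Proof.
move=> /continuous_nrP cu; apply: (@nr_differentiable1 _ _ (u a)) => e /cu[d d0 H].
exists d => // h hd; have ah : a + h - a = h by rewrite addrC addKr.
have := H (a + h); rewrite ah => /(_ hd) /ltW H1.
have -> : h * u (a + h) - (a - a) * u a - u a * h = (u (a + h) - u a) * h by ring.
by rewrite nrM; apply: ler_wpM2r; rewrite ?nr_ge0.
Qed.

End ComplexBasics.

(** * Goursat's theorem and holomorphic interpolation *)

Section ScalarFunctions.
Context {K : numFieldType}.
Implicit Types (f g : K -> K).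

Lemma continuous_addf f g z : {for z, continuous f} -> {for z, continuous g} ->
  {for z, continuous (fun z => f z + g z)}.
Proof. by move=> hf hg; exact: continuousD. Qed.

Lemma continuous_mulf f g z : {for z, continuous f} -> {for z, continuous g} ->
  {for z, continuous (fun z => f z * g z)}.
Proof. by move=> hf hg; exact: continuousM. Qed.

Lemma continuous_expf f k z : {for z, continuous f} -> {for z, continuous (fun z => f z ^+ k)}.
Proof.
move=> cf; elim: k => [|k IH]; first exact: cst_continuous.
rewrite (_ : (fun z => f z ^+ k.+1) = fun z => f z * f z ^+ k).
  exact: continuous_mulf.
by apply/funext => w; rewrite exprS.
Qed.

Lemma affine_continuous (A B : K) : continuous (fun z : K => A + B * z).
Proof.
move=> z; apply: continuous_addf; first exact: cst_continuous.
by apply: continuous_mulf; first exact: cst_continuous.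
Qed.

Lemma differentiable_addf f g z : differentiable f z -> differentiable g z ->
  differentiable (fun z => f z + g z) z.
Proof. exact: differentiableD. Qed.

Lemma differentiable_mulf f g z : differentiable f z -> differentiable g z ->
  differentiable (fun z => f z * g z) z.
Proof. exact: differentiableM. Qed.

Lemma differentiable_expf f k z : differentiable f z -> differentiable (fun z => f z ^+ k) z.
Proof.
move=> df; elim: k => [|k IH]; first exact: differentiable_cst.
by under eq_fun do rewrite exprS; exact: differentiable_mulf.
Qed.

Lemma differentiable_subc (a : K) z : differentiable (fun z : K => z - a) z.
Proof. by apply: differentiable_addf. Qed.

Lemma differentiable_invf f z : f z != 0 -> differentiable f z ->
  differentiable (fun z => (f z)^-1) z.
Proof. by move=> f0 df; exact: differentiableV. Qed.

Lemma near_eq_differentiable f g z : (\forall w \near z, f w = g w) ->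
  differentiable f z -> differentiable g z.
Proof.
by move=> fg /derivable1_diffP df; apply/derivable1_diffP; exact: near_eq_derivable df.
Qed.

Lemma differentiable_continuousf f z : differentiable f z -> {for z, continuous f}.
Proof. exact: differentiable_continuous. Qed.

End ScalarFunctions.

Section Goursat.
Context {R : realType}.
Local Notation C := (Cfield R).
Implicit Types (f g : C -> C) (u v : R -> C).

Definition ccont u := continuous (fun t => cre (u t)) /\ continuous (fun t => cim (u t)).

Definition cinteg u a b : C :=
  cx (integ (fun t => cre (u t)) a b) (integ (fun t => cim (u t)) a b).

Lemma cinteg_cat u a b c : cinteg u a b + cinteg u b c = cinteg u a c.
Proof. by apply: ceqP; rewrite !creimE integ_cat. Qed.

Lemma cintegD u v a b : ccont u -> ccont v ->
  cinteg (fun t => u t + v t) a b = cinteg u a b + cinteg v a b.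
Proof.
move=> [u1 u2] [v1 v2]; apply: ceqP; rewrite !creimE -integD//; congr (integ _ a b);
  by apply/funext => t; rewrite !creimE.
Qed.

Lemma continuous_cstM (k : R) (p : R -> R) : continuous p -> continuous (fun t => k * p t).
Proof. by move=> cp x; apply: cvgM; [exact: cvg_cst|exact: cp]. Qed.

Lemma cintegZ k u a b : ccont u -> cinteg (fun t => k * u t) a b = k * cinteg u a b.
Proof.
move=> [u1 u2]; apply: ceqP; rewrite !creimE.
  rewrite -mulNr -!integZ// -integD; [|exact: continuous_cstM|exact: continuous_cstM].
  by congr (integ _ a b); apply/funext => t; rewrite !creimE mulNr.
rewrite -!integZ// -integD; [|exact: continuous_cstM|exact: continuous_cstM].
by congr (integ _ a b); apply/funext => t; rewrite !creimE.
Qed.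

Lemma cinteg_bound u a b M : ccont u ->
  (forall t, Num.min a b <= t <= Num.max a b -> nr (u t) <= M) ->
  nr (cinteg u a b) <= 2 * M * `|b - a|.
Proof.
move=> [u1 u2] H; apply: le_trans (nr_le _) _; rewrite !creimE -mulrA mulrDl mul1r.
by apply: lerD; apply: integ_bound => // t /H; apply: le_trans; rewrite ?cre_le ?cim_le.
Qed.

Lemma ccont_path f (p : R -> C) : (forall s t, nr (p s - p t) <= `|s - t|) ->
  (forall t, {for p t, continuous f}) -> ccont (fun t => f (p t)).
Proof.
move=> pl cf; split=> t; apply/cvgrPdist_lt => e e0;
  have /continuous_nrP /(_ e e0) [d d0 H] := cf t;
  apply/nbhs_ballP; exists d => // s; rewrite /ball /= distrC => st;
  rewrite distrC -?creB -?cimB; apply: le_lt_trans (H (p s) (le_lt_trans (pl s t) st));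
  rewrite ?cre_le ?cim_le //.
Qed.

Lemma hpath_lip (y s t : R) : nr (cx s y - cx t y) <= `|s - t|.
Proof.
have -> : cx s y - cx t y = rc (s - t) by apply: ceqP; rewrite !creimE ?subrr.
by rewrite nr_rc.
Qed.

Lemma vpath_lip (x s t : R) : nr (cx x s - cx x t) <= `|s - t|.
Proof.
have -> : cx x s - cx x t = cx 0 1 * rc (s - t).
  by apply: ceqP; rewrite !creimE ?subrr; ring.
rewrite nrM nr_rc ler_piMl//; apply: le_trans (nr_le _) _.
by rewrite !creimE normr0 normr1 add0r.
Qed.

(* The boundary integral of [f dz] over the rectangle [a, b] x [c, d]. *)
Definition bdint f a b c d : C :=
  (cinteg (fun t => f (cx t c)) a b - cinteg (fun t => f (cx t d)) a b) +
  cx 0 1 * (cinteg (fun t => f (cx b t)) c d - cinteg (fun t => f (cx a t)) c d).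

(** The four full lines that carry the sides, rather than the sides: the rules of [integ] ask for
    continuity on all of [R]. *)
Definition on_lines (a b c d : R) (z : C) : Prop :=
  [\/ cim z = c, cim z = d, cre z = b | cre z = a].

Definition in_rect (a b c d : R) (z : C) : Prop := a <= cre z <= b /\ c <= cim z <= d.

Definition cont_on_lines f a b c d := forall z, on_lines a b c d z -> {for z, continuous f}.

Lemma cont_on_linesP f a b c d : cont_on_lines f a b c d ->
  [/\ ccont (fun t => f (cx t c)), ccont (fun t => f (cx t d)),
      ccont (fun t => f (cx b t)) & ccont (fun t => f (cx a t))].
Proof.
move=> cf; split; apply: ccont_path;
  first [exact: hpath_lip | exact: vpath_lip | move=> t; apply: cf].
- exact: Or41.
- exact: Or42.
- exact: Or43.
- exact: Or44.
Qed.

Lemma bdint_splitx f a m b c d : bdint f a m c d + bdint f m b c d = bdint f a b c d.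
Proof.
rewrite /bdint -(cinteg_cat (fun t => f (cx t c)) a m b).
by rewrite -(cinteg_cat (fun t => f (cx t d)) a m b); ring.
Qed.

Lemma bdint_splity f a b c m d : bdint f a b c m + bdint f a b m d = bdint f a b c d.
Proof.
rewrite /bdint -(cinteg_cat (fun t => f (cx b t)) c m d).
by rewrite -(cinteg_cat (fun t => f (cx a t)) c m d); ring.
Qed.

Lemma eq_bdint f g a b c d : (forall z, on_lines a b c d z -> f z = g z) ->
  bdint f a b c d = bdint g a b c d.
Proof.
move=> fg; rewrite /bdint; congr (_ - _ + _ * (_ - _)); congr (cinteg _ _ _);
  apply/funext => t; apply: fg.
- exact: Or41.
- exact: Or42.
- exact: Or43.
- exact: Or44.
Qed.

Lemma bdintD f g a b c d : cont_on_lines f a b c d -> cont_on_lines g a b c d ->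
  bdint (fun z => f z + g z) a b c d = bdint f a b c d + bdint g a b c d.
Proof.
move=> /cont_on_linesP[? ? ? ?] /cont_on_linesP[? ? ? ?].
by rewrite /bdint !cintegD//; ring.
Qed.

Lemma bdintZ k f a b c d : cont_on_lines f a b c d ->
  bdint (fun z => k * f z) a b c d = k * bdint f a b c d.
Proof. by move=> /cont_on_linesP[? ? ? ?]; rewrite /bdint !cintegZ//; ring. Qed.

(** Each side contributes at most [2 * M] times its length, the 2 coming from [cinteg_bound], where
    real and imaginary parts are bounded separately. *)
Lemma bdint_bound f a b c d M : a <= b -> c <= d -> cont_on_lines f a b c d ->
  (forall z, in_rect a b c d z -> on_lines a b c d z -> nr (f z) <= M) ->
  nr (bdint f a b c d) <= 4 * M * ((b - a) + (d - c)).
Proof.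
move=> ab cd /cont_on_linesP[c1 c2 c3 c4] H.
have I1 y : y = c \/ y = d -> forall t, Num.min a b <= t <= Num.max a b -> nr (f (cx t y)) <= M.
  move=> yE t; rewrite (min_idPl ab) (max_idPr ab) => tab.
  apply: H; case: yE => ->; rewrite /in_rect /on_lines !creimE ?lexx ?cd//.
    exact: Or41.
  exact: Or42.
have I2 x : x = a \/ x = b -> forall t, Num.min c d <= t <= Num.max c d -> nr (f (cx x t)) <= M.
  move=> yE t; rewrite (min_idPl cd) (max_idPr cd) => tab.
  apply: H; case: yE => ->; rewrite /in_rect /on_lines !creimE ?lexx ?ab//.
    exact: Or44.
  exact: Or43.
have := cinteg_bound c1 (I1 c (or_introl erefl)).
have := cinteg_bound c2 (I1 d (or_intror erefl)).
have := cinteg_bound c3 (I2 b (or_intror erefl)).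
have := cinteg_bound c4 (I2 a (or_introl erefl)).
rewrite (ger0_norm (_ : 0 <= b - a)) ?subr_ge0// (ger0_norm (_ : 0 <= d - c)) ?subr_ge0//.
move=> h4 h3 h2 h1.
apply: le_trans (nrD _ _) _; rewrite nrM.
have -> : nr (cx 0 1 : C) = 1.
  apply/eqP; rewrite -(eqrXn2 (n:=2)) ?nr_ge0//.
  by rewrite nr_sqr !creimE expr0n expr1n add0r.
rewrite mul1r.
have := nrB (cinteg (fun t => f (cx t c)) a b) (cinteg (fun t => f (cx t d)) a b).
have := nrB (cinteg (fun t => f (cx b t)) c d) (cinteg (fun t => f (cx a t)) c d).
move=> h5 h6; apply: le_trans (lerD h6 h5) _; lra.
Qed.

Lemma bdint_affine (A B : C) a b c d : bdint (fun z => A + B * z) a b c d = 0.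
Proof.
have I1 y : cinteg (fun t => A + B * cx t y) a b =
    (A + B * cx 0 y) * rc (b - a) + B * rc ((b ^+ 2 - a ^+ 2) / 2).
  apply: ceqP; rewrite !creimE.
    rewrite -[LHS]/(integ (fun t => cre (A + B * cx t y)) a b).
    rewrite (_ : (fun t => _) = fun t => (cre A - cim B * y) + cre B * t).
      by rewrite integ_affine; ring.
    by apply/funext => t; rewrite !creimE; ring.
  rewrite (_ : (fun t => _) = fun t => (cim A + cre B * y) + cim B * t).
    by rewrite integ_affine; ring.
  by apply/funext => t; rewrite !creimE; ring.
have I2 x : cinteg (fun t => A + B * cx x t) c d =
    (A + B * cx x 0) * rc (d - c) + B * (cx 0 1 * rc ((d ^+ 2 - c ^+ 2) / 2)).
  apply: ceqP; rewrite !creimE.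
    rewrite (_ : (fun t => _) = fun t => (cre A + cre B * x) + (- cim B) * t).
      by rewrite integ_affine; ring.
    by apply/funext => t; rewrite !creimE; ring.
  rewrite (_ : (fun t => _) = fun t => (cim A + cim B * x) + cre B * t).
    by rewrite integ_affine; ring.
  by apply/funext => t; rewrite !creimE; ring.
rewrite /bdint !I1 !I2; apply: ceqP; rewrite !creimE; ring.
Qed.

Lemma nested_point (u l : nat -> R) : (forall k, u k <= u k.+1) ->
  (forall k, u k.+1 + l k.+1 <= u k + l k) -> (forall k, 0 <= l k) ->
  exists x, forall k, u k <= x <= u k + l k.
Proof.
move=> u_incr ul_decr l_ge0.
have umon i j : (i <= j)%N -> u i <= u j.
  by move=> /subnK <-; elim: (_ - _)%N => // k IH; apply: le_trans (u_incr _).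
have ulmon i j : (i <= j)%N -> u j + l j <= u i + l i.
  by move=> /subnK <-; elim: (_ - _)%N => // k IH; apply: le_trans (ul_decr _) _.
have ub i j : u i <= u j + l j.
  case: (leqP i j) => [ij|/ltnW ij].
    by apply: le_trans (umon _ _ ij) _; rewrite lerDl.
  by apply: le_trans (ulmon _ _ ij); rewrite lerDl.
exists (sup (range u)) => k; apply/andP; split.
  by apply: sup_upper_bound; [split; [exists (u 0%N), 0%N|exists (u 0%N + l 0%N) => _ [i _ <-]]|exists k].
by apply: ge_sup; [exists (u 0%N), 0%N|move=> _ [i _ <-]].
Qed.

(** Quadrisection: one of the four quarters keeps at least a quarter of the boundary integral. Near
    the common point of the nested rectangles [f] is affine up to [e * nr h], and affine functions
    integrate to 0, so the integral of level [k] is at most [4 * e * S^2 / 4^k], below its lower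
    bound [e0 / 4^k]. *)
Lemma goursat f a b c d : a <= b -> c <= d -> continuous f ->
  (forall z, in_rect a b c d z -> differentiable f z) -> bdint f a b c d = 0.
Proof.
move=> ab cd cf df; apply/eqP; rewrite -nr_eq0; apply/negPn/negP => J0.
set e0 := nr (bdint f a b c d) in J0.
have {J0} e0_gt0 : 0 < e0 by rewrite lt_def J0 nr_ge0.
pose s k := (b - a) / 2 ^+ k; pose t k := (d - c) / 2 ^+ k.
have p2 k : 0 < (2 : R) ^+ k by rewrite exprn_gt0.
have s0 k : 0 <= s k by rewrite divr_ge0 ?subr_ge0// ltW.
have t0 k : 0 <= t k by rewrite divr_ge0 ?subr_ge0// ltW.
have sS k : s k = s k.+1 + s k.+1.
  by rewrite /s exprS; have := gt_eqF (p2 k); move/negbT => ?; field.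
have tS k : t k = t k.+1 + t k.+1.
  by rewrite /t exprS; have := gt_eqF (p2 k); move/negbT => ?; field.
pose J k (p : R * R) := bdint f p.1 (p.1 + s k) p.2 (p.2 + t k).
pose P k (p : R * R) := e0 / 4 ^+ k <= nr (J k p).
pose N k (p q : R * R) := [/\ p.1 <= q.1, q.1 + s k.+1 <= p.1 + s k, p.2 <= q.2
  & q.2 + t k.+1 <= p.2 + t k].
(* The implication is placed under the existential so that [choice] yields a total function; a
   default corner serves where [P] fails. *)
have step : forall kp : nat * (R * R), exists q, P kp.1 kp.2 -> P kp.1.+1 q /\ N kp.1 kp.2 q.
  move=> [k [x y]] /=; have [Pk|] := pselect (P k (x, y)); last by exists (0, 0).
  have [q [Nq Pq]] : exists q, N k (x, y) q /\ P k.+1 q; last by exists q.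
  apply: contrapT => nP.
  have small q : N k (x, y) q -> nr (J k.+1 q) < e0 / 4 ^+ k.+1.
    by move=> Nq; rewrite ltNge; apply/negP => Pq; apply: nP; exists q.
  have NI x' y' : x <= x' -> x' <= x + s k.+1 -> y <= y' -> y' <= y + t k.+1 ->
      N k (x, y) (x', y').
    by move=> ? ? ? ?; split; rewrite ?(sS k) ?(tS k) /fst /snd //; lra.
  have [sp tp] := (s0 k.+1, t0 k.+1).
  have h1 : nr (J k.+1 (x, y)) < e0 / 4 ^+ k.+1.
    by apply: small; apply: NI; lra.
  have h2 : nr (J k.+1 (x + s k.+1, y)) < e0 / 4 ^+ k.+1.
    by apply: small; apply: NI; lra.
  have h3 : nr (J k.+1 (x, y + t k.+1)) < e0 / 4 ^+ k.+1.
    by apply: small; apply: NI; lra.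
  have h4 : nr (J k.+1 (x + s k.+1, y + t k.+1)) < e0 / 4 ^+ k.+1.
    by apply: small; apply: NI; lra.
  move: Pk; rewrite /P.
  have -> : J k (x, y) = J k.+1 (x, y) + J k.+1 (x, y + t k.+1) +
       (J k.+1 (x + s k.+1, y) + J k.+1 (x + s k.+1, y + t k.+1)).
    rewrite /J /fst /snd (sS k) (tS k) !(addrA x) !(addrA y).
    by rewrite bdint_splity bdint_splity bdint_splitx.
  apply/negP; rewrite -ltNge; apply: le_lt_trans (nrD _ _) _.
  have -> : e0 / 4 ^+ k = 4 * (e0 / 4 ^+ k.+1).
    by rewrite exprS invfM [RHS]mulrCA mulVKf// pnatr_eq0.
  have := nrD (J k.+1 (x, y)) (J k.+1 (x, y + t k.+1)).
  have := nrD (J k.+1 (x + s k.+1, y)) (J k.+1 (x + s k.+1, y + t k.+1)).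
  lra.
have [F HF] := choice step.
pose fix q k : R * R := if k is k'.+1 then F (k', q k') else (a, c).
have Pq k : P k (q k).
  elim: k => [|k IH]; last by have [] := HF (k, q k) IH.
  by rewrite /P /J /= /s /t !expr0 !divr1 !subrKC.
have Nq k : N k (q k) (q k.+1) by have [] := HF (k, q k) (Pq k).
have [X HX] : exists x, forall k, (q k).1 <= x <= (q k).1 + s k.
  by apply: nested_point => // k; have [] := Nq k.
have [Y HY] : exists x, forall k, (q k).2 <= x <= (q k).2 + t k.
  by apply: nested_point => // k; have [] := Nq k.
have wR : in_rect a b c d (cx X Y).
  have := HX 0%N; have := HY 0%N; rewrite /= /s /t !expr0 !divr1.
  by rewrite /in_rect !creimE !subrKC.
have [D HD] := differentiable_nr1 (df _ wR).
pose S := (b - a) + (d - c).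
have S0 : 0 <= S by rewrite addr_ge0 ?subr_ge0.
(* This makes [4 * e * S^2] less than [e0 / 2]; the summand 1 covers a rectangle reduced to a
   point. *)
pose e := e0 / (8 * (S ^+ 2 + 1)).
have S21 : 0 < S ^+ 2 + 1 by rewrite ltr_wpDl ?sqr_ge0.
have ep : 0 < e by rewrite divr_gt0// mulr_gt0.
have [dl dl0 Hd] := HD e ep.
have [k Hk] : exists k, S / 2 ^+ k < dl.
  exists (Num.truncn (S / dl)).+1; rewrite ltr_pdivrMr// mulrC -ltr_pdivrMr//.
  apply: lt_le_trans (truncnS_gt _) _.
  by rewrite -natrX ler_nat ltnW// ltn_expl.
pose L := S / 2 ^+ k.
have Lst : L = s k + t k by rewrite /L /S /s /t mulrDl.
pose w := cx X Y.
pose E (z : C) : C := f z + (- (f w - D * w) + (- D) * z).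
have cE (z : C) : {for z, continuous E}.
  by rewrite /E; apply: continuous_addf; [exact: cf|exact: affine_continuous].
have JE : J k (q k) = bdint E (q k).1 ((q k).1 + s k) (q k).2 ((q k).2 + t k).
  rewrite /E bdintD; first by rewrite bdint_affine addr0.
    by move=> z _; exact: cf.
  by move=> z _; exact: affine_continuous.
have := Pq k; rewrite /P JE; apply/negP; rewrite -ltNge.
have [qs qt] : (q k).1 <= (q k).1 + s k /\ (q k).2 <= (q k).2 + t k by rewrite !lerDl.
have := @bdint_bound E _ _ _ _ (e * L) qs qt (fun z _ => cE z).
have -> : (q k).1 + s k - (q k).1 + ((q k).2 + t k - (q k).2) = L by rewrite Lst; ring.
move=> H; apply: le_lt_trans (H _) _.
  move=> z [z1 z2] _.
  have zw : nr (z - w) <= L.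
    apply: le_trans (nr_le _) _; rewrite !creimE Lst.
    have /andP[? ?] := HX k; have /andP[? ?] := HY k; move: z1 z2 => /andP[? ?] /andP[? ?].
    by apply: lerD; rewrite ler_norml; apply/andP; split; lra.
  have := Hd (z - w) (le_lt_trans zw Hk); rewrite subrKC.
  have -> : E z = f z - f w - D * (z - w) by rewrite /E; ring.
  move=> /le_trans; apply.
  by rewrite ler_pM2l.
have -> : 4 * (e * L) * L = 4 * e * S ^+ 2 / 4 ^+ k.
  have -> : (4 : R) ^+ k = 2 ^+ k * 2 ^+ k by rewrite -exprMn; congr (_ ^+ k); rewrite -natrM.
  by rewrite /L; have := gt_eqF (p2 k); move/negbT => ?; field.
rewrite ltr_pM2r ?invr_gt0 ?exprn_gt0//.
have eE : e * (8 * (S ^+ 2 + 1)) = e0 by rewrite /e divfK// gt_eqF// mulr_gt0.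
by have := mulr_ge0 (ltW ep) (sqr_ge0 S); move: eE ep; clear; lra.
Qed.

End Goursat.

(** * Cauchy's estimate, the maximum principle and Newton interpolation *)

Section MaxPrinciple.
Context {R : realType}.
Local Notation C := (Cfield R).
Implicit Types (f g : C -> C) (u v : R -> C).

(** The integral equals the one over any small square about [z0], and this tends to 0 with the
    square because [f] is bounded near [z0]. *)
Lemma goursat_except f a b c d (z0 : C) : a < cre z0 < b -> c < cim z0 < d ->
  (forall z : C, {for z, continuous f}) ->
  (forall z, in_rect a b c d z -> z != z0 -> differentiable f z) ->
  bdint f a b c d = 0.
Proof.
move=> /andP[ax xb] /andP[cy yd] cf df.
set x := cre z0 in ax xb; set y := cim z0 in cy yd.
have shrink s : 0 < s -> a < x - s -> x + s < b -> c < y - s -> y + s < d ->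
    bdint f a b c d = bdint f (x - s) (x + s) (y - s) (y + s).
  move=> s0 h1 h2 h3 h4.
  have Z a' b' c' d' : a' <= b' -> c' <= d' -> a <= a' -> b' <= b -> c <= c' -> d' <= d ->
      (forall z, in_rect a' b' c' d' z -> z != z0) -> bdint f a' b' c' d' = 0.
    move=> ab' cd' ? ? ? ? H; apply: (@goursat R f a' b' c' d' ab' cd' cf).
    move=> z zr; apply: df; last exact: H.
    by move: zr => [/andP[? ?] /andP[? ?]]; split; apply/andP; split; lra.
  have Z1 : bdint f a (x - s) c d = 0.
    apply: Z; [lra|lra|lra|lra|lra|lra|].
    by move=> z [/andP[_ H] _]; apply: contraTneq isT => zE; move: H; rewrite zE -/x; lra.
  have Z2 : bdint f (x + s) b c d = 0.
    apply: Z; [lra|lra|lra|lra|lra|lra|].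
    by move=> z [/andP[H _] _]; apply: contraTneq isT => zE; move: H; rewrite zE -/x; lra.
  have Z3 : bdint f (x - s) (x + s) c (y - s) = 0.
    apply: Z; [lra|lra|lra|lra|lra|lra|].
    by move=> z [_ /andP[_ H]]; apply: contraTneq isT => zE; move: H; rewrite zE -/y; lra.
  have Z4 : bdint f (x - s) (x + s) (y + s) d = 0.
    apply: Z; [lra|lra|lra|lra|lra|lra|].
    by move=> z [_ /andP[H _]]; apply: contraTneq isT => zE; move: H; rewrite zE -/y; lra.
  rewrite -(bdint_splitx f a (x - s) b) -(bdint_splitx f (x - s) (x + s) b).
  rewrite -(bdint_splity f (x - s) (x + s) c (y - s) d).
  rewrite -(bdint_splity f (x - s) (x + s) (y - s) (y + s) d).
  by rewrite Z1 Z2 Z3 Z4 !add0r !addr0.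
apply/eqP; rewrite -nr_eq0; apply/negPn/negP => J0.
set e0 := nr (bdint f a b c d) in J0.
have {J0} e0_gt0 : 0 < e0 by rewrite lt_def J0 nr_ge0.
have /continuous_nrP /(_ 1 ltr01) [dl dl0 Hd] := cf z0.
pose M := nr (f z0) + 1.
have M0 : 0 < M by rewrite ltr_wpDl ?nr_ge0.
(* The bound [dl / 4] keeps the square where [nr (f z)] is at most [M]; [e0 / (32 * M)] makes its
   integral, at most [16 * M * s], not exceed [e0 / 2]; the other bounds keep it inside the
   rectangle. *)
pose s := Num.min (Num.min (dl / 4) (e0 / (32 * M)))
  (Num.min (Num.min ((x - a) / 2) ((b - x) / 2)) (Num.min ((y - c) / 2) ((d - y) / 2))).
have s0 : 0 < s.
  by rewrite /s !lt_min !divr_gt0//= ?subr_gt0 ?ax ?xb ?cy ?yd ?mulr_gt0.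
have : s <= s by [].
rewrite {2}/s !le_min => /andP[/andP[s1 s2] /andP[/andP[s3 s4] /andP[s5 s6]]].
have JE : bdint f a b c d = bdint f (x - s) (x + s) (y - s) (y + s) by apply: shrink; lra.
have := @bdint_bound R f (x - s) (x + s) (y - s) (y + s) M.
rewrite -JE -/e0 => H.
have : e0 <= 4 * M * ((x + s - (x - s)) + (y + s - (y - s))).
  apply: H; [lra|lra|by move=> z _; exact: cf|].
  move=> z [/andP[? ?] /andP[? ?]] _.
  have zz : nr (z - z0) < dl.
    apply: le_lt_trans (nr_le _) _; rewrite !creimE -/x -/y.
    have h1 : `|cre z - x| <= s by rewrite ler_norml; apply/andP; split; lra.
    have h2 : `|cim z - y| <= s by rewrite ler_norml; apply/andP; split; lra.
    by move: h1 h2 s1 dl0; clear; lra.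
  have := Hd z zz => hz; have := nr_distD (f z0) (f z) 0; rewrite !subr0 /M; lra.
have s2' : s * (32 * M) <= e0 by rewrite -ler_pdivlMr// mulr_gt0.
have := mulr_gt0 s0 M0; move: s2' e0_gt0; clear; nra.
Qed.

(** The divided difference at [a], completed by the derivative [D]. At [a] itself it is shown to be
    continuous, not differentiable, which is why the maximum principle allows exceptional points. *)
Definition dquot f (a D : C) (w : C) : C := if w == a then D else (f w - f a) / (w - a).

Definition has_deriv f (a D : C) := forall e : R, 0 < e -> exists2 d : R, 0 < d &
    forall h, nr h < d -> nr (f (a + h) - f a - D * h) <= e * nr h.

Lemma dquotE f a D w : f w = f a + (w - a) * dquot f a D w.
Proof.
rewrite /dquot; have [->|wa] := eqVneq w a; first by rewrite subrr mul0r addr0.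
by rewrite mulrC divfK ?subr_eq0// subrKC.
Qed.

Lemma dquot_near f a D (z : C) : z != a ->
  \forall w \near z, (f w - f a) * (w - a)^-1 = dquot f a D w.
Proof.
move=> za; apply/near_nrP; exists (nr (z - a)); first by rewrite nr_gt0 subr_eq0.
move=> w wz; rewrite /dquot; case: eqVneq => // wa.
by move: wz; rewrite wa nr_dist ltxx.
Qed.

Lemma differentiable_dquot f a D (z : C) : z != a -> differentiable f z ->
  differentiable (dquot f a D) z.
Proof.
move=> za df; apply: near_eq_differentiable (dquot_near f D za) _.
apply: differentiable_mulf; first by apply: differentiable_addf.
by apply: differentiable_invf; [rewrite subr_eq0|exact: differentiable_subc].
Qed.

Lemma continuous_invsub (a z : C) : z != a -> {for z, continuous (fun w : C => (w - a)^-1)}.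
Proof.
move=> za; apply: differentiable_continuousf.
by apply: differentiable_invf; [rewrite subr_eq0|exact: differentiable_subc].
Qed.

Lemma continuous_dquot f a D : has_deriv f a D -> (forall z : C, {for z, continuous f}) ->
  forall z : C, {for z, continuous (dquot f a D)}.
Proof.
move=> HD cf z; apply/continuous_nrP => e e0; have [->|za] := eqVneq z a.
  have [d d0 H] := HD (e / 2) (divr_gt0 e0 (ltr0n _ 2)).
  exists d => // w /H; rewrite {2}/dquot eqxx; have [->|wa] := eqVneq w a.
    by move=> _; rewrite /dquot eqxx subrr nr0.
  have wa0 : 0 < nr (w - a) by rewrite nr_gt0 subr_eq0.
  rewrite /dquot (negbTE wa) subrKC => H1.
  have -> : (f w - f a) / (w - a) - D = (f w - f a - D * (w - a)) / (w - a).
    by rewrite [RHS]mulrBl mulfK// subr_eq0.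
  by rewrite nrM nrV ltr_pdivrMr//; apply: le_lt_trans H1 _; rewrite ltr_pM2r//; lra.
have /continuous_nrP /(_ e e0)[d1 d10 H1] :
    {for z, continuous (fun w : C => (f w + - f a) * (w - a)^-1)}.
  apply: continuous_mulf; last exact: continuous_invsub.
  by apply: continuous_addf; [exact: cf|exact: cst_continuous].
have /near_nrP[d2 d20 H2] := dquot_near f D za.
exists (Num.min d1 d2); first by rewrite lt_min d10 d20.
move=> w; rewrite lt_min => /andP[w1 w2].
by rewrite -(H2 w w2) -(H2 z) ?H1// subrr nr0.
Qed.

Definition on_square (r : R) (z : C) := in_rect (- r) r (- r) r z /\ on_lines (- r) r (- r) r z.

Definition in_square (r : R) (z : C) := in_rect (- r) r (- r) r z.

Lemma creV (z : C) : cre z^-1 = cre z / nr z ^+ 2.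
Proof. by rewrite nr_sqr; case: z. Qed.
Lemma cimV (z : C) : cim z^-1 = - cim z / nr z ^+ 2.
Proof. by rewrite nr_sqr mulNr; case: z. Qed.

Lemma integ_lt0 (phi : R -> R) (a b : R) : continuous phi -> a < b ->
  (forall x, a <= x <= b -> phi x < 0) -> integ phi a b < 0.
Proof.
move=> cphi ab H; rewrite -oppr_gt0 -mulN1r -integZ//; apply: integ_gt0 => //.
  exact: continuous_cstM.
by move=> x /H; rewrite mulN1r oppr_gt0.
Qed.

(** All four sides contribute positively to the imaginary part. Nonvanishing is what allows the
    division in [cauchy_square]. *)
Lemma bdint_inv_neq0 (r : R) (z : C) : `|cre z| < r -> `|cim z| < r ->
  bdint (fun w => (w - z)^-1) (- r) r (- r) r != 0.
Proof.
rewrite !ltr_norml => /andP[x1 x2] /andP[y1 y2].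
have rr : - r < r by lra.
have [c1 c2 c3 c4] : [/\ ccont (fun t => (cx t (- r) - z)^-1), ccont (fun t => (cx t r - z)^-1),
      ccont (fun t => (cx r t - z)^-1) & ccont (fun t => (cx (- r) t - z)^-1)].
  apply: (@cont_on_linesP R (fun w => (w - z)^-1)) => w wl; apply: continuous_invsub.
  by apply/eqP => wz; move: wl; rewrite wz; case; lra.
apply/eqP => /(congr1 cim); rewrite /bdint !creimE => E.
have P w : w != z -> 0 < (nr (w - z) ^+ 2)^-1.
  by move=> wz; rewrite invr_gt0 exprn_gt0// nr_gt0 subr_eq0.
have N (t s : R) : t != cre z \/ s != cim z -> cx t s != z.
  by move=> H; apply/eqP => E1; move: H; rewrite -E1 !creimE !eqxx => -[].
have i1 : 0 < integ (fun t => cim (cx t (- r) - z)^-1) (- r) r.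
  apply: integ_gt0 rr _; first exact: c1.2.
  move=> t _; rewrite cimV mulr_gt0 ?P ?N//; first by rewrite !creimE; lra.
  by right; rewrite lt_eqF.
have i2 : integ (fun t => cim (cx t r - z)^-1) (- r) r < 0.
  apply: integ_lt0 rr _; first exact: c2.2.
  move=> t _; rewrite cimV pmulr_llt0 ?P ?N//; first by rewrite !creimE; lra.
  by right; rewrite gt_eqF.
have i3 : 0 < integ (fun t => cre (cx r t - z)^-1) (- r) r.
  apply: integ_gt0 rr _; first exact: c3.1.
  move=> t _; rewrite creV mulr_gt0 ?P ?N//; first by rewrite !creimE; lra.
  by left; rewrite gt_eqF.
have i4 : integ (fun t => cre (cx (- r) t - z)^-1) (- r) r < 0.
  apply: integ_lt0 rr _; first exact: c4.1.
  move=> t _; rewrite creV pmulr_llt0 ?P ?N//; first by rewrite !creimE; lra.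
  by left; rewrite lt_eqF.
by move: E; rewrite ?/cinteg ?creimE ?mul0r ?add0r ?mul1r; lra.
Qed.

Lemma dist_on_square (r dl : R) (w a : C) : on_square r w -> `|cre a| <= dl -> `|cim a| <= dl ->
  r - dl <= nr (w - a).
Proof.
rewrite !ler_norml => -[_ wl] /andP[? ?] /andP[? ?].
have [] : r - dl <= `|cre (w - a)| \/ r - dl <= `|cim (w - a)|.
- case: wl => wE; [right|right|left|left]; rewrite !creimE wE ler_normr; apply/orP;
    [right|left|left|right]; lra.
- by move=> /le_trans; apply; exact: cre_le.
- by move=> /le_trans; apply; exact: cim_le.
Qed.

(** Goursat's theorem for the divided difference of [f] at [z] equates [f z] times the integral of
    [1 / (w - z)] with the integral of [f w / (w - z)]. The constant [K] depends on [r] and [z] but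
    not on [f], a uniformity that [max_principle] exploits. *)
Lemma cauchy_square (r : R) (z : C) : `|cre z| < r -> `|cim z| < r ->
  exists K, forall f M, (forall w : C, {for w, continuous f}) ->
    (forall w, in_square r w -> differentiable f w) ->
    (forall w, on_square r w -> nr (f w) <= M) -> nr (f z) <= K * M.
Proof.
move=> zr1 zr2.
have J0 := bdint_inv_neq0 zr1 zr2.
pose k (w : C) := (w - z)^-1.
pose dl := Num.max `|cre z| `|cim z|.
have dlr : dl < r by rewrite gt_max zr1.
have r0 : 0 < r by apply: le_lt_trans zr1.
exists (4 * (r - dl)^-1 * ((r - - r) + (r - - r)) / nr (bdint k (- r) r (- r) r)) => f M cf df fM.
have zin : in_square r z.
  by move: zr1 zr2; rewrite !ltr_norml => /andP[? ?] /andP[? ?]; split; rewrite !ltW.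
have nz w : on_lines (- r) r (- r) r w -> w != z.
  move=> wl; apply/eqP => wz; move: wl; rewrite wz.
  by move: zr1 zr2; rewrite !ltr_norml => /andP[? ?] /andP[? ?]; case; lra.
have [D HD] := differentiable_nr1 (df z zin).
have q0 : bdint (dquot f z D) (- r) r (- r) r = 0.
  have zx : - r < cre z < r by rewrite -ltr_norml.
  have zy : - r < cim z < r by rewrite -ltr_norml.
  apply: (goursat_except zx zy (continuous_dquot HD cf)) => w wr wz.
  by apply: differentiable_dquot; [exact: wz|exact: df].
have ck : cont_on_lines k (- r) r (- r) r by move=> w /nz; exact: continuous_invsub.
have cfk : cont_on_lines (fun w => f w * k w) (- r) r (- r) r.
  by move=> w wl; apply: continuous_mulf; [exact: cf|exact: ck].
have : bdint (fun w => f w * k w) (- r) r (- r) r = f z * bdint k (- r) r (- r) r.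
  have ck2 : cont_on_lines (fun w => - f z * k w) (- r) r (- r) r.
    by move=> w wl; apply: continuous_mulf; [exact: cst_continuous|exact: ck].
  apply/eqP; rewrite -subr_eq0 -mulNr -(bdintZ (- f z) ck) -(bdintD cfk ck2) -q0.
  by apply/eqP/eq_bdint => w /nz wz; rewrite /dquot (negbTE wz) -mulrDl.
move=> E; have rr : - r <= r by lra.
have := bdint_bound rr rr cfk; rewrite E nrM => H.
have kpos : 0 < nr (bdint k (- r) r (- r) r) by rewrite nr_gt0.
rewrite mulrAC ler_pdivlMr//; apply: le_trans (H ((r - dl)^-1 * M) _) _.
  move=> w w1 w2; rewrite nrM mulrC.
  have wd : r - dl <= nr (w - z).
    by apply: dist_on_square; rewrite ?le_max ?lexx ?orbT.
  apply: ler_pM; rewrite ?nr_ge0 ?fM// /k nrV lef_pV2// ?posrE ?subr_gt0//.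
  by apply: lt_le_trans wd; rewrite subr_gt0.
by rewrite le_eqVlt; apply/orP; left; apply/eqP; ring.
Qed.

(** If [M < x], then [K * (M / x)^k] tends to 0 although it is at least 1 for every [k]. *)
Lemma expr_le_const (x M K : R) : 0 <= x -> 0 <= M -> (forall k, x ^+ k <= K * M ^+ k) -> x <= M.
Proof.
move=> x0 M0 H; rewrite leNgt; apply/negP => Mx.
have xp : 0 < x by apply: le_lt_trans Mx.
have q1 : `|M / x| < 1 by rewrite ger0_norm ?divr_ge0// ltr_pdivrMr// mul1r.
have cv : K * (M / x) ^+ k @[k --> \oo] --> K * 0.
  by apply: cvgM; [exact: cvg_cst|exact: cvg_expr].
have /cvgrPdist_lt/(_ 1 ltr01)[N _ HN] := cv.
have := HN N (leqnn N); rewrite /= mulr0 sub0r normrN => h.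
have : 1 <= K * (M / x) ^+ N.
  by rewrite expr_div_n mulrA ler_pdivlMr ?exprn_gt0// mul1r.
by move: h; rewrite ltr_norml => /andP[]; lra.
Qed.

(** Cauchy's estimate is applied to the powers of [f], and its constant disappears on taking roots.
    The factor [p e] vanishes at the exceptional points and not at [z]; it makes the product
    differentiable on the whole square. *)
Lemma max_principle f (r M : R) (z : C) (e : seq C) : `|cre z| < r -> `|cim z| < r -> z \notin e ->
  (forall w : C, {for w, continuous f}) ->
  (forall w, in_square r w -> w \notin e -> differentiable f w) ->
  (forall w, on_square r w -> nr (f w) <= M) -> nr (f z) <= M.
Proof.
move=> z1 z2 ze cf df fM.
have r0 : 0 < r by apply: le_lt_trans z1.
have M0 : 0 <= M.
  apply: le_trans (fM (cx r 0) _); first exact: nr_ge0.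
  by split; [split; rewrite !creimE; apply/andP; split; lra|apply: Or43].
have [K HK] := cauchy_square z1 z2.
pose p (s : seq C) (w : C) : C := \prod_(a <- s) (w - a).
have pd s (w : C) : differentiable (p s) w.
  rewrite /p; elim: s => [|a s IH].
    by rewrite (_ : (fun w => _) = cst 1) //; apply/funext => t; rewrite big_nil.
  rewrite (_ : (fun w => _) = fun w => (w - a) * \prod_(a <- s) (w - a)).
    by apply: differentiable_mulf; first exact: differentiable_subc.
  by apply/funext => t; rewrite big_cons.
pose B := \prod_(a <- e) (2 * r + nr a).
have pB w : on_square r w -> nr (p e w) <= B.
  move=> [[wr1 wr2] _]; rewrite /p /B; elim: (e) => [|a s IH]; first by rewrite !big_nil nr1.
  rewrite !big_cons nrM ler_pM ?nr_ge0//; apply: le_trans (nrB _ _) _; rewrite lerD2r.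
  apply: le_trans (nr_le _) _; rewrite mulr_natl mulr2n.
  by apply: lerD; rewrite ler_norml; [exact: wr1|exact: wr2].
have pz : 0 < nr (p e z).
  rewrite nr_gt0 /p prodf_seq_neq0; apply/allP => a ae /=; rewrite subr_eq0.
  by apply: contraNneq ze => ->.
apply: (@expr_le_const _ _ (K * B / nr (p e z))) => //; first exact: nr_ge0.
move=> k; rewrite mulrAC ler_pdivlMr// -mulrA -nrX mulrC -nrM.
apply: (HK (fun w => p e w * f w ^+ k)).
- move=> w; apply: continuous_mulf; last by apply: continuous_expf; exact: cf.
  by apply: differentiable_continuousf; exact: pd.
- move=> w wr; have [we|we] := boolP (w \in e); last first.
    by apply: differentiable_mulf; [exact: pd|apply: differentiable_expf; exact: df].
  rewrite (_ : (fun w => _) = fun v : C => (v - w) * (p (rem w e) v * f v ^+ k)).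
    apply: continuous_mulsub; apply: continuous_mulf; last by apply: continuous_expf; exact: cf.
    by apply: differentiable_continuousf; exact: pd.
  by apply/funext => v; rewrite /p (big_rem _ we) mulrA.
- move=> w wr; rewrite nrM nrX ler_pM ?nr_ge0 ?exprn_ge0 ?nr_ge0 ?pB//.
  by apply: lerXn2r; rewrite ?nnegrE ?nr_ge0 ?fM.
Qed.

(** Newton's form of the polynomial interpolating [f] at the nodes [s], evaluated at [z]. It is
    meant for distinct nodes, the divided difference taking the value 0 at its own node. *)
Fixpoint interp (s : seq R) f (z : R) : C :=
  if s is a :: s' then
    f (rc a) + (rc z - rc a) * interp s' (fun w => (f w - f (rc a)) / (w - rc a)) z
  else 0.

Lemma eq_interp s f g z : {in s, forall a, f (rc a) = g (rc a)} -> interp s f z = interp s g z.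
Proof.
elim: s f g => //= a s IH f g fg; rewrite fg ?mem_head//; congr (_ + _ * _).
by apply: IH => b bs; rewrite !fg ?mem_head// in_cons bs orbT.
Qed.

(** Induction on the nodes: on the boundary of the square the divided difference at [a] is at most
    [2 * M / (r - dl)], because [f] is at most [M] at [a] by the maximum principle and the boundary
    is at distance at least [r - dl] from [a]. Each step adds [a] to the exceptional points. *)
Lemma interp_error (r dl z : R) s f M (e : seq C) : dl < r -> `|z| <= dl ->
  (forall a, a \in s -> `|a| <= dl) -> uniq s -> z \notin s -> rc z \notin e ->
  (forall a, a \in s -> rc a \notin e) ->
  (forall w : C, {for w, continuous f}) ->
  (forall w, in_square r w -> w \notin e -> differentiable f w) ->
  (forall w, on_square r w -> nr (f w) <= M) ->
  nr (f (rc z) - interp s f z) <= M * \prod_(a <- s) (2 * `|z - a| / (r - dl)).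
Proof.
move=> dlr zdl; have dl0 : 0 <= dl by apply: le_trans zdl.
have rd : 0 < r - dl by rewrite subr_gt0.
have in_sq a : `|a| <= dl -> `|cre (rc a)| < r /\ `|cim (rc a)| < r.
  by move=> adl; rewrite !creimE normr0; split; [apply: le_lt_trans dlr|apply: le_lt_trans dlr].
elim: s f M e => [|a s IH] f M e /= sdl us zs ze se cf df fM.
  have [z1 z2] := in_sq z zdl.
  by rewrite big_nil mulr1 subr0; exact: (max_principle z1 z2 ze cf df fM).
have adl : `|a| <= dl by apply: sdl; rewrite mem_head.
have [a1 a2] := in_sq a adl.
have ae : rc a \notin e by apply: se; rewrite mem_head.
have dfa : differentiable f (rc a).
  by apply: df => //; move: a1 a2; rewrite !ltr_norml => /andP[? ?] /andP[? ?]; split; rewrite !ltW.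
have [D HD] := differentiable_nr1 dfa.
pose f1 := dquot f (rc a) D.
move: us zs; rewrite /= in_cons negb_or => /andP[anotin us] /andP[za zs].
have -> : interp s (fun w => (f w - f (rc a)) / (w - rc a)) z = interp s f1 z.
  apply: eq_interp => b bs; rewrite /f1 /dquot; case: eqVneq => // /rcI ba.
  by rewrite -ba bs in anotin.
rewrite (dquotE f (rc a) D (rc z)) opprD addrACA subrr add0r -mulrBr nrM -rcB nr_rc big_cons.
have IH1 := IH f1 (2 * M / (r - dl)) (rc a :: e).
have -> : M * (2 * `|z - a| / (r - dl) * \prod_(j <- s) (2 * `|z - j| / (r - dl))) =
  `|z - a| * (2 * M / (r - dl) * \prod_(j <- s) (2 * `|z - j| / (r - dl))) by ring.
rewrite ler_wpM2l//; apply: IH1; [|exact: us|exact: zs| | | | |].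
- by move=> b bs; apply: sdl; rewrite in_cons bs orbT.
- by rewrite in_cons negb_or ze andbT; apply: contraNneq za => /rcI ->.
- move=> b bs; rewrite in_cons negb_or se ?in_cons ?bs ?orbT// andbT.
  by apply: contraNneq anotin => /rcI <-.
- exact: (continuous_dquot HD cf).
- move=> w wr; rewrite in_cons negb_or => /andP[wa we].
  by apply: differentiable_dquot; [exact: wa|exact: df].
- move=> w wr; have wd : r - dl <= nr (w - rc a).
    by apply: dist_on_square => //; rewrite !creimE ?normr0.
  have wa : w != rc a.
    by rewrite -subr_eq0 -nr_gt0; apply: lt_le_trans wd.
  rewrite /f1 /dquot (negbTE wa) nrM nrV.
  have fa : nr (f (rc a)) <= M by exact: (max_principle a1 a2 ae cf df fM).
  apply: ler_pM; rewrite ?nr_ge0 ?invr_ge0 ?nr_ge0//.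
    by apply: le_trans (nrB _ _) _; rewrite mulr_natl mulr2n; apply: lerD; [exact: fM|exact: fa].
  by rewrite lef_pV2// posrE// (lt_le_trans rd).
Qed.

(** The nodes and [z] are real, hence so are the coefficients, and they do not depend on [f]. Real
    combinations of gradients are gradients: this is how interpolation preserves the existence of a
    potential. *)
Lemma interp_linear s z : uniq s ->
  exists c : R -> R, forall f, interp s f z = \sum_(a <- s) rc (c a) * f (rc a).
Proof.
elim: s => [|a s IH] /=; first by exists (fun=> 0) => f; rewrite big_nil.
move=> /andP[anotin /IH[c Hc]].
(* The divided difference at [b] is [(f b - f a) / (b - a)]; the first case collects all the terms
   in [f a]. *)
pose c' b := if b == a then 1 - (z - a) * \sum_(b <- s) c b / (b - a)
  else (z - a) * c b / (b - a).
exists c' => f; rewrite Hc big_cons {1}/c' eqxx.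
rewrite mulr_sumr rcB rc1 rcM mulrBl mul1r -addrA; congr (_ + _).
rewrite -rcB addrC -[LHS](subrK (\sum_(j <- s) rc (c' j) * f (rc j))).
rewrite addrC; congr (_ + _).
rewrite -sumrB.
have -> : rc (\sum_(b <- s) c b / (b - a)) = \sum_(b <- s) rc (c b / (b - a)).
  by elim: (s) => [|b t IHt]; rewrite ?big_nil// !big_cons rcD IHt.
rewrite mulr_sumr mulr_suml -sumrN big_seq_cond [RHS]big_seq_cond.
apply: eq_bigr => b /andP[bs _].
have ba : b != a by apply: contraNneq anotin => <-.
have rba : rc b - rc a != 0 by rewrite -rcB rc_eq0 subr_eq0.
rewrite /c' (negbTE ba) !rcM rcV !rcB; field; exact: rba.
Qed.

End MaxPrinciple.

(** * Differentiability between complex normed spaces *)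

Section NormedFunctions.
Context {K : numFieldType} {U V W : normedModType K}.

Lemma differentiable_line (y u : U) (w : K) : differentiable (fun t : K => y + t *: u) w.
Proof.
apply: (@differentiableD _ _ _ (cst y) (fun t : K => t *: u)); first exact: differentiable_cst.
by apply: differentiableZl.
Qed.

Lemma differentiable_compf (f : U -> V) (g : V -> W) x :
  differentiable f x -> differentiable g (f x) -> differentiable (fun t => g (f t)) x.
Proof. exact: differentiable_comp. Qed.

Lemma differentiable_subf (f g : U -> V) x :
  differentiable f x -> differentiable g x -> differentiable (fun t => f t - g t) x.
Proof. exact: differentiableB. Qed.

Lemma differentiable_addv (f g : U -> V) x :
  differentiable f x -> differentiable g x -> differentiable (fun t => f t + g t) x.
Proof. exact: differentiableD. Qed.

Lemma differentiable_cstf (a : V) (x : U) : differentiable (fun=> a) x.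
Proof. exact: differentiable_cst. Qed.

Lemma differentiable_idf (x : U) : differentiable (fun t : U => t) x.
Proof. exact: ex_diff. Qed.

Lemma differentiable_scalef (k : K) (f : U -> V) x :
  differentiable f x -> differentiable (fun t => k *: f t) x.
Proof. exact: differentiableZ. Qed.

Lemma differentiable_diff (f : U -> V) x y : differentiable f x ->
  differentiable (fun t => 'd f x t) y.
Proof. by move=> df; apply: linear_differentiable; exact: diff_continuous. Qed.

Lemma differentiable_of_littleo (f : U -> V) (L : {linear U -> V}) x : continuous L ->
  (fun h => f (h + x) - (f x + L h)) =o_ (0 : U) id -> differentiable f x.
Proof.
move=> cL fo.
have E : f \o shift x = cst (f x) + L +o_ (0 : U) id by apply/eqaddoP/eqoP.
have dE := diff_unique cL E.
by apply/diff_locallyP; rewrite dE.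
Qed.

Lemma linear_sub (f g : {linear U -> V}) : linear (fun h => f h - g h).
Proof. by move=> a u v; rewrite (linearP f) (linearP g) scalerBr opprD addrACA. Qed.

End NormedFunctions.

Lemma subrBB (V : zmodType) (p q s a b : V) : (p - s - a) - (q - s - b) = p - q - (a - b).
Proof. by rewrite !opprB (addrC b (s - q)) addrACA subrKA (addrC (- a)). Qed.

Lemma rv_norm_ge (K : numDomainType) d (v : 'rV[K]_d) i : `|v 0 i| <= `|v|.
Proof.
suff : `|v 0 i| <= mx_norm v by [].
by rewrite mx_normE -[leLHS]nngE num_le; exact: (le_bigmax _ _ (0, i)).
Qed.

Lemma rv_norm_max (K : numDomainType) d (v : 'rV[K]_d) : v != 0 -> exists i, `|v| = `|v 0 i|.
Proof.
move=> v0; have /mx_norm_neq0[[j i] vE] : mx_norm v != 0 by rewrite -[mx_norm v]/(`|v|) normr_eq0.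
by exists i; rewrite -[LHS]/(mx_norm v) vE /= ord1.
Qed.

Section SeveralVariables.
Context {R : realType}.
Local Notation C := (Cfield R).
Implicit Types (U : normedModType C).

Lemma nr_differentiable U (V : normedModType C) (f : U -> V) (L : {linear U -> V}) x : continuous L ->
  (forall e : R, 0 < e -> exists2 d : R, 0 < d &
    forall h, nr h < d -> nr (f (x + h) - f x - L h) <= e * nr h) ->
  differentiable f x.
Proof.
move=> cL H; apply: (differentiable_of_littleo cL); apply/eqoP => _ /pos_rc[e e0 ->].
have [d d0 hd] := H e e0; apply/near_nrP; exists d => // h; rewrite subr0 => /hd.
by rewrite !nrE -rcM le_rc opprD addrA (addrC h).
Qed.

(** The supremum of the left ends lies in every interval. This is the form of completeness used
    throughout: the limit comes with its error bounds. *)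
Lemma interval_choice (I : Type) (a b : I -> R) (i0 : I) :
  (forall i j, a i <= b j) -> exists x, forall i, a i <= x <= b i.
Proof.
move=> ab; exists (sup (range a)) => i; apply/andP; split.
  by apply: sup_upper_bound; [split; [exists (a i0), i0|exists (b i0) => _ [j _ <-]]|exists i].
by apply: ge_sup; [exists (a i0), i0|move=> _ [j _ <-]].
Qed.

(** Real and imaginary parts are chosen separately, whence the factor 2. *)
Lemma complex_complete (I : Type) (i0 : I) (u : I -> C) (b : I -> R) :
  (forall i j, nr (u i - u j) <= b i + b j) -> exists l, forall i, nr (u i - l) <= 2 * b i.
Proof.
move=> H.
have [x Hx] : exists x, forall i, cre (u i) - b i <= x <= cre (u i) + b i.
  apply: interval_choice => // i j; have := le_trans (cre_le _) (H i j).
  by rewrite creB ler_norml => /andP[_]; lra.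
have [y Hy] : exists x, forall i, cim (u i) - b i <= x <= cim (u i) + b i.
  apply: interval_choice => // i j; have := le_trans (cim_le _) (H i j).
  by rewrite cimB ler_norml => /andP[_]; lra.
exists (cx x y) => i; apply: le_trans (nr_le _) _; rewrite !creimE mulr_natl mulr2n.
have /andP[? ?] := Hx i; have /andP[? ?] := Hy i.
by apply: lerD; rewrite ler_norml; apply/andP; split; lra.
Qed.

(** The case of the single node 0 in [interp_error], on the square of half-side [r], which lies in
    the disc of radius [2 * r]. *)
Lemma schwarz_real (f : C -> C) (r M t : R) : (forall w : C, differentiable f w) ->
  (forall w, nr w <= 2 * r -> nr (f w) <= M) -> 0 < r -> `|t| <= r / 2 ->
  nr (f (rc t) - f 0) <= 4 * M * `|t| / r.
Proof.
move=> df fM r0 tr; have [->|t0] := eqVneq t 0; first by rewrite subrr nr0 normr0 mulr0 mul0r.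
have := @interp_error R r (r / 2) t [:: 0] f M [::].
rewrite /= mulr0 addr0 rc0 big_seq1 subr0.
have -> : M * (2 * `|t| / (r - r / 2)) = 4 * M * `|t| / r.
  have -> : r - r / 2 = r / 2 by field.
  by have r1 : r != 0 by [apply: lt0r_neq0]; field.
apply.
- lra.
- exact: tr.
- by move=> a; rewrite inE => /eqP ->; rewrite normr0; lra.
- by [].
- by rewrite inE.
- by [].
- by [].
- by move=> w; apply: differentiable_continuousf; exact: df.
- by move=> w _ _; exact: df.
- move=> w [[w1 w2] _]; apply: fM; apply: le_trans (nr_le _) _.
  by rewrite mulr_natl mulr2n; apply: lerD; rewrite ler_norml.
Qed.

(** The function is restricted to the complex line through [y] and [x], parametrized at unit speed.
    With [d = rho / 16], the disc of radius [8 * d] about [y] stays in the ball, and [schwarz_real]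
    applies at [t = nr (x - y) < 2 * d]. *)
Lemma lipschitz_of_bound U (F : U -> C) (x0 : U) (rho M : R) : 0 < rho ->
  (forall x, differentiable F x) -> (forall x, nr (x - x0) < rho -> nr (F x) <= M) ->
  forall x y, nr (x - x0) < rho / 16 -> nr (y - x0) < rho / 16 ->
  nr (F x - F y) <= 16 * M / rho * nr (x - y).
Proof.
move=> rho0 dF FM x y xd yd; pose d := rho / 16; pose t := nr (x - y).
have [->|xy] := eqVneq x y; first by rewrite !subrr !nr0 mulr0.
have t0 : 0 < t by rewrite nr_gt0 subr_eq0.
have t2d : t < 2 * d.
  by apply: le_lt_trans (nr_distD x0 _ _) _; rewrite mulr_natl mulr2n ltrD// nr_dist.
have d0 : 0 < d by rewrite divr_gt0.
pose u := (rc t)^-1 *: (x - y).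
have u1 : nr u = 1 by rewrite nrZ nrV nr_rc gtr0_norm// mulVf// gt_eqF.
have := @schwarz_real (fun w => F (y + w *: u)) (4 * d) M t.
have rt0 : rc t != 0 by rewrite rc_eq0 gt_eqF.
have ux : y + rc t *: u = x by rewrite /u scalerA divff// scale1r subrKC.
rewrite scale0r addr0 ux gtr0_norm//.
have -> : 4 * M * t / (4 * d) = 16 * M / rho * t.
  by rewrite /d; have r1 : rho != 0 by [apply: lt0r_neq0]; field.
apply.
- by move=> w; apply: (differentiable_compf (differentiable_line y u w)); exact: dF.
- move=> w w8; apply: FM; rewrite addrAC.
  apply: le_lt_trans (nrD _ _) _; rewrite nrZ u1 mulr1.
  have -> : rho = 16 * d by rewrite /d; field.
  by move: yd; rewrite -/d; lra.
- by rewrite mulr_gt0.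
- lra.
Qed.

Lemma rv_nr_le d (v : 'rV[C]_d) (e : R) : 0 <= e -> (forall i, nr (v 0 i : C) <= e) -> nr v <= e.
Proof.
move=> e0 H; have [->|v0] := eqVneq v 0; first by rewrite nr0.
by have [i vi] := rv_norm_max v0; rewrite /nr vi; exact: H.
Qed.

Lemma rv_nr_ge d (v : 'rV[C]_d) i : nr (v 0 i : C) <= nr v.
Proof.
by rewrite -le_rc -!nrE; exact: rv_norm_ge.
Qed.

Lemma differentiable_rv U d (F : U -> 'rV[C]_d) x i :
  differentiable F x -> differentiable (fun y => F y 0 i : C) x.
Proof.
move=> dF; apply: (@differentiable_compf _ _ _ _ F (fun v : 'rV[C]_d => v 0 i : C)) => //.
exact: differentiable_coord.
Qed.

Lemma lipschitz_of_bound_rv U d (F : U -> 'rV[C]_d) (x0 : U) (rho M : R) : 0 < rho ->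
  (forall x, differentiable F x) -> (forall x, nr (x - x0) < rho -> nr (F x) <= M) ->
  forall x y, nr (x - x0) < rho / 16 -> nr (y - x0) < rho / 16 ->
  nr (F x - F y) <= 16 * M / rho * nr (x - y).
Proof.
move=> rho0 dF FM x y xd yd.
have M0 : 0 <= M.
  by apply: le_trans (FM x0 _); rewrite ?nr_ge0// subrr nr0.
apply: rv_nr_le; first by rewrite mulr_ge0 ?nr_ge0// divr_ge0 ?mulr_ge0// ltW.
move=> i; rewrite !mxE; apply: (@lipschitz_of_bound U (fun y => F y 0 i) x0) => //.
- by move=> z; apply: differentiable_rv; exact: dF.
- by move=> z /FM; apply: le_trans; exact: rv_nr_ge.
Qed.

(** The remainder of the differential at [x0] is at most [e / 16 * r] on a ball of radius [r]; by
    [lipschitz_of_bound_rv] it is then Lipschitz with constant [e] on the ball of radius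
    [r / 16]. *)
Lemma strict_differentiable U d (F : U -> 'rV[C]_d) (x0 : U) : (forall x, differentiable F x) ->
  forall e : R, 0 < e -> exists2 r : R, 0 < r & forall x y, nr (x - x0) < r -> nr (y - x0) < r ->
  nr (F x - F y - 'd F x0 (x - y)) <= e * nr (x - y).
Proof.
move=> dF e e0; have [r r0 H] := differentiable_nr (dF x0) (divr_gt0 e0 (ltr0n _ 16)).
exists (r / 16); first by rewrite divr_gt0.
move=> x y xr yr.
pose E z := F z - F x0 - 'd F x0 (z - x0).
have := @lipschitz_of_bound_rv U d E x0 r (e / 16 * r) r0 _ _ x y xr yr.
have -> : E x - E y = F x - F y - 'd F x0 (x - y).
  have -> : x - y = (x - x0) - (y - x0) by rewrite opprB addrA subrK.
  by rewrite (linearB ('d F x0)) /E subrBB.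
have -> : 16 * (e / 16 * r) / r = e by have r1 : r != 0 by [apply: lt0r_neq0]; field.
apply.
- move=> z; apply: differentiable_subf.
    by apply: differentiable_subf; [exact: dF|exact: differentiable_cstf].
  apply: (@differentiable_compf _ _ _ _ (fun z => z - x0) ('d F x0)).
    by apply: differentiable_subf; [exact: differentiable_idf|exact: differentiable_cstf].
  exact: differentiable_diff.
- move=> z zr; have := H (z - x0) zr; rewrite subrKC => /le_trans; apply.
  by rewrite ler_wpM2l ?divr_ge0 ?ltW.
Qed.

Lemma small_linear U (L : {linear U -> C}) (r b : R) : 0 < r ->
  (forall h, nr h < r -> nr (L h : C) <= b * nr h) -> forall h, nr (L h : C) <= b * nr h.
Proof.
move=> r0 H h; have [->|h0] := eqVneq h 0; first by rewrite linear0 !nr0 mulr0.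
have n0 : 0 < nr h by rewrite nr_gt0.
pose s := r / (2 * nr h); have s0 : 0 < s by rewrite divr_gt0// mulr_gt0.
have := H (rc s *: h); rewrite linearZ_LR !nrZ nr_rc gtr0_norm// mulrCA ler_pM2l//; apply.
have -> : s * nr h = r / 2 by rewrite /s; have nz := lt0r_neq0 n0; field.
by rewrite ltr_pdivrMr// ltr_pMr// ltr1n.
Qed.

(* A map that is approximated, up to arbitrarily small Lipschitz errors, by differentiable maps is
   differentiable: the approximating differentials form a Cauchy net. *)
Lemma differentiable_approx U (f : U -> C) x :
  (forall e : R, 0 < e -> exists2 g : U -> C, differentiable g x &
    exists2 d : R, 0 < d & forall h, nr h < d ->
      nr ((f (x + h) - g (x + h)) - (f x - g x)) <= e * nr h) -> differentiable f x.
Proof.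
move=> H.
pose ek (k : nat) : R := k.+1%:R^-1.
have ek0 k : 0 < ek k by rewrite invr_gt0.
have /choice[D HD] : forall k : nat, exists D : {linear U -> C}, continuous D /\
    exists2 d : R, 0 < d & forall h, nr h < d -> nr (f (x + h) - f x - D h) <= ek k * nr h.
  move=> k; have [g dg [d d0 Hd]] := H _ (divr_gt0 (ek0 k) (ltr0n _ 2)).
  exists ('d g x); split; first exact: diff_continuous.
  have [d1 d10 Hd1] := differentiable_nr dg (divr_gt0 (ek0 k) (ltr0n _ 2)).
  exists (Num.min d d1); first by rewrite lt_min d0 d10.
  move=> h; rewrite lt_min => /andP[/Hd h1 /Hd1 h2].
  have -> : f (x + h) - f x - 'd g x h = ((f (x + h) - g (x + h)) - (f x - g x)) +
    (g (x + h) - g x - 'd g x h) by ring.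
  apply: le_trans (nrD _ _) _; lra.
have LL k l h : nr (D k h - D l h) <= (ek k + ek l) * nr h.
  have [dk [d1 d10 H1]] := HD k; have [dl [d2 d20 H2]] := HD l.
  have lin := linear_sub (D k) (D l).
  pose M1 := GRing.isLinear.Build _ _ _ _ _ lin.
  pose L : {linear U -> C} := HB.pack (fun h => D k h - D l h) M1.
  have r0 : 0 < Num.min d1 d2 by rewrite lt_min d10 d20.
  apply: (@small_linear U L _ _ r0) => v; rewrite lt_min => /andP[/H1 h1 /H2 h2].
  have -> : L v = (f (x + v) - f x - D l v) - (f (x + v) - f x - D k v).
    have -> : L v = D k v - D l v := erefl.
    by ring.
  apply: le_trans (nrB _ _) _; rewrite mulrDl addrC; exact: lerD.
have /choice[L HL] : forall h : U, exists l : C, forall k, nr (D k h - l) <= 2 * (ek k * nr h).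
  by move=> h; apply: (complex_complete 0%N) => k l; rewrite -mulrDl; exact: LL.
have small (z : C) (B : R) : (forall k, nr z <= ek k * B) -> z = 0.
  move=> zB; apply/eqP; rewrite -nr_eq0; apply/eqP/le_anti; rewrite nr_ge0 andbT.
  rewrite leNgt; apply/negP => z0.
  have := zB (Num.truncn (B / nr z)); apply/negP; rewrite -ltNge /ek mulrC ltr_pdivrMr//.
  by rewrite mulrC -ltr_pdivrMr// truncnS_gt.
have linL : linear L.
  move=> a u v; apply/eqP; rewrite -subr_eq0; apply/eqP.
  apply: (small _ (2 * nr (a *: u + v) + nr a * (2 * nr u) + 2 * nr v)) => k.
  have -> : L (a *: u + v) - (a *: L u + L v) =
     - (D k (a *: u + v) - L (a *: u + v)) + a * (D k u - L u) + (D k v - L v).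
    by rewrite linearP -[a *: D k u]/(a * D k u) -[a *: L u]/(a * L u); ring.
  apply: le_trans (nrD _ _) _; apply: le_trans (lerD (nrD _ _) (lexx _)) _.
  rewrite nrN nrM.
  have h1 := HL (a *: u + v) k; have h2 := HL u k; have h3 := HL v k.
  have h4 := ler_wpM2l (nr_ge0 a) h2.
  apply: le_trans (lerD (lerD h1 h4) h3) _.
  by rewrite le_eqVlt; apply/orP; left; apply/eqP; ring.
pose M1 := GRing.isLinear.Build _ _ _ _ _ linL.
pose LL' : {linear U -> C} := HB.pack L M1.
have cL : continuous LL'.
  have [c0 _] := HD 0%N.
  move=> y; apply/continuous_nrP => e e0.
  have /continuous_nrP /(_ (e / 2) (divr_gt0 e0 (ltr0n _ 2)))[d d0 Hd] := c0 y.
  exists (Num.min d (e / 8)); first by rewrite lt_min d0 divr_gt0.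
  move=> z; rewrite lt_min => /andP[/Hd h1 h2].
  have h3 := HL (z - y) 0%N.
  have -> : LL' z - LL' y = (D 0%N z - D 0%N y) - (D 0%N (z - y) - L (z - y)).
    rewrite -[L (z - y)]/(LL' (z - y)) (linearB (D 0%N)) (linearB LL').
    by move: (LL' z) (LL' y) (D 0%N z) (D 0%N y) => p q s t; ring.
  apply: le_lt_trans (nrB _ _) _; move: h3; rewrite /ek invr1 mul1r; lra.
apply: (nr_differentiable cL) => e e0.
pose k := Num.truncn (3 / e).
have ke : 3 * ek k < e.
  by rewrite /ek ltr_pdivrMr// mulrC -ltr_pdivrMr// truncnS_gt.
have [_ [d d0 Hd]] := HD k; exists d => // h /Hd h1.
have -> : f (x + h) - f x - LL' h = (f (x + h) - f x - D k h) + (D k h - L h).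
  by rewrite -[LL' h]/(L h); ring.
apply: le_trans (nrD _ _) _; have h2 := HL h k; apply: le_trans (lerD h1 h2) _.
have := ler_wpM2r (nr_ge0 h) (ltW ke); lra.
Qed.

End SeveralVariables.

Section PairNorm.
Context {K : numFieldType} {U V : normedModType K}.

Lemma pair_norm_le (a : U) (b : V) (e : K) : `|a| <= e -> `|b| <= e -> `|(a, b)| <= e.
Proof. by move=> ae be; rewrite num_ge_max /= ae be. Qed.

Lemma fst_norm_le (a : U) (b : V) : `|a| <= `|(a, b)|.
Proof. by rewrite num_le_max /= lexx. Qed.

Lemma snd_norm_le (a : U) (b : V) : `|b| <= `|(a, b)|.
Proof. by rewrite num_le_max /= lexx orbT. Qed.

Lemma differentiable_pairf (W : normedModType K) (f : W -> U) (g : W -> V) x :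
  differentiable f x -> differentiable g x -> differentiable (fun t => (f t, g t)) x.
Proof. exact: differentiable_pair. Qed.

Lemma linear_inr : linear (fun v : V => ((0 : U), v)).
Proof. by move=> a u v; rewrite -[RHS]/((a *: 0 + 0 : U), (a *: u + v)) scaler0 addr0. Qed.

Lemma linear_comp_inr (W : normedModType K) (f : {linear (U * V)%type -> W}) :
  linear (fun v : V => f (0, v)).
Proof. by move=> a u v; rewrite linear_inr (linearP f). Qed.

End PairNorm.

(** * Holomorphy of directional derivatives *)

Section PartialDerivative.
Context {R : realType}.
Local Notation C := (Cfield R).
Implicit Types (U : normedModType C).

Lemma differentiable_bounded U (V : normedModType C) (g : U -> V) x0 : differentiable g x0 ->
  exists2 rho : R, 0 < rho & forall x, nr (x - x0) < rho -> nr (g x) <= nr (g x0) + 1.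
Proof.
move=> dg; have cg : {for x0, continuous g} by exact: differentiable_continuous.
have /continuous_nrP /(_ 1 ltr01)[d d0 H] := cg.
exists d => // x /H h; have := nr_distD (g x0) (g x) 0; rewrite !subr0; lra.
Qed.

(** Interpolation at the nodes 0 and [s]. The bound is linear in [|t - s|], so the difference
    quotients at 0 form a Cauchy family as the step tends to 0. *)
Lemma second_difference (f : C -> C) (r M s t : R) : (forall w : C, differentiable f w) ->
  (forall w, nr w <= 2 * r -> nr (f w) <= M) -> 0 < s -> 0 < t -> s <= r / 2 -> t <= r / 2 ->
  s != t ->
  nr ((f (rc t) - f 0) / rc t - (f (rc s) - f 0) / rc s) <= 16 * M / r ^+ 2 * `|t - s|.
Proof.
move=> df fM s0 t0 sr tr st.
have r0 : 0 < r by lra.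
have := @interp_error R r (r / 2) t [:: 0; s] f M [::].
rewrite /= mulr0 addr0 rc0 big_cons big_seq1 !subr0 => H.
have tz : rc t != 0 by rewrite rc_eq0 gt_eqF.
have : nr (f (rc t) - (f 0 + rc t * ((f (rc s) - f 0) / rc s))) <=
   t * (16 * M / r ^+ 2 * `|t - s|).
  have -> : t * (16 * M / r ^+ 2 * `|t - s|) =
     M * (2 * `|t| / (r - r / 2) * (2 * `|t - s| / (r - r / 2))).
    rewrite (gtr0_norm t0); have -> : r - r / 2 = r / 2 by field.
    by have r1 : r != 0 by [apply: lt0r_neq0]; field.
  apply: H.
  - lra.
  - by rewrite gtr0_norm.
  - by move=> a; rewrite !inE => /orP[] /eqP ->; rewrite ?normr0 ?gtr0_norm//; lra.
  - by rewrite inE eq_sym gt_eqF.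
  - by rewrite !inE gt_eqF//= eq_sym.
  - by [].
  - by [].
  - by move=> w; apply: differentiable_continuousf; exact: df.
  - by move=> w _ _; exact: df.
  - move=> w [[w1 w2] _]; apply: fM; apply: le_trans (nr_le _) _.
    by rewrite mulr_natl mulr2n; apply: lerD; rewrite ler_norml.
have -> : f (rc t) - (f 0 + rc t * ((f (rc s) - f 0) / rc s)) =
   rc t * ((f (rc t) - f 0) / rc t - (f (rc s) - f 0) / rc s).
  move: (f (rc t)) (f 0) ((f (rc s) - f 0) / rc s) => p q u.
  by rewrite mulrBr [rc t * (_ / _)]mulrC divfK// opprD addrA.
by rewrite nrM nr_rc gtr0_norm// ler_pM2l.
Qed.

(** The difference quotients [phi t] are holomorphic and form a Cauchy family, uniformly near [x0].
    By [lipschitz_of_bound] they also converge in Lipschitz constant, and [differentiable_approx]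
    applies. *)
Lemma differentiable_partial U (g : U -> C) (v : U) : (forall x, differentiable g x) ->
  forall x, differentiable (fun y => 'd g y v : C) x.
Proof.
move=> dg x0; pose kap := nr v.
have kap0 : 0 <= kap by exact: nr_ge0.
have [rho rho0 gM] := differentiable_bounded (dg x0).
set M := nr (g x0) + 1 in gM.
have M0 : 0 < M by rewrite ltr_wpDl ?nr_ge0.
(* This keeps [x + w *: v] in the ball of radius [rho] when [nr w <= 2 * r] and
   [nr (x - x0) < rho / 2]. *)
pose r := rho / (8 * (kap + 1)).
have k1 : 0 < kap + 1 by rewrite ltr_wpDl.
have r0 : 0 < r by rewrite divr_gt0// mulr_gt0.
have rk : 2 * r * kap < rho / 2.
  have -> : 2 * r * kap = rho * (kap / (kap + 1)) / 4.
    by rewrite /r; have nz := lt0r_neq0 k1; field.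
  have : kap / (kap + 1) <= 1 by rewrite ler_pdivrMr// mul1r lerDl.
  by move=> /(ler_wpM2l (ltW rho0)); lra.
pose phi (t : R) (x : U) : C := (rc t)^-1 *: (g (x + rc t *: v) - g x).
have phiE t x : phi t x = (g (x + rc t *: v) - g x) / rc t by rewrite mulrC.
have dphi t x : differentiable (phi t) x.
  apply: differentiable_scalef; apply: differentiable_subf; last exact: dg.
  apply: (@differentiable_compf _ _ _ _ (fun x => x + rc t *: v) g); last exact: dg.
  by apply: differentiable_addv; [exact: differentiable_idf|exact: differentiable_cstf].
pose K1 := 16 * M / r ^+ 2.
have K10 : 0 < K1 by apply: divr_gt0; [apply: mulr_gt0 => //; lra|apply: exprn_gt0].
have claim1 t s x : 0 < s -> 0 < t -> s <= r / 2 -> t <= r / 2 -> s != t ->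
    nr (x - x0) < rho / 2 -> nr (phi t x - phi s x) <= K1 * `|t - s|.
  move=> s0 t0 sr tr st xr; rewrite !phiE.
  have := @second_difference (fun w => g (x + w *: v)) r M s t.
  rewrite scale0r addr0; apply => //.
    move=> w; apply: (differentiable_compf (differentiable_line x v w)); exact: dg.
  move=> w wr; apply: gM; rewrite addrAC; apply: le_lt_trans (nrD _ _) _; rewrite nrZ.
  have := ler_wpM2r kap0 wr; rewrite -/kap; lra.
pose K2 := 16 * K1 / (rho / 2).
have K20 : 0 < K2 by apply: divr_gt0; [apply: mulr_gt0 => //; lra|lra].
have r2 : 0 < rho / 2 by rewrite divr_gt0.
have claim2 t s x y : 0 < s -> 0 < t -> s <= r / 2 -> t <= r / 2 -> s != t ->
    nr (x - x0) < rho / 2 / 16 -> nr (y - x0) < rho / 2 / 16 ->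
    nr ((phi t x - phi s x) - (phi t y - phi s y)) <= K2 * `|t - s| * nr (x - y).
  move=> s0 t0 sr tr st xr yr.
  have -> : K2 * `|t - s| = 16 * (K1 * `|t - s|) / (rho / 2) by rewrite /K2; ring.
  apply: (@lipschitz_of_bound R U (fun x => phi t x - phi s x) x0 _ _ r2); [| |exact: xr|exact: yr].
  - by move=> z; apply: differentiable_subf; exact: dphi.
  - by move=> z zr; exact: claim1.
have claim3 x (e : R) : 0 < e -> exists2 eta : R, 0 < eta & forall t, 0 < t -> t < eta ->
    nr (phi t x - 'd g x v) <= e.
  move=> e0; have [d d0 Hd] := differentiable_nr (dg x) (divr_gt0 e0 k1).
  exists (d / (kap + 1)); first by rewrite divr_gt0.
  move=> t t0 td; have := Hd (rc t *: v); rewrite nrZ nr_rc gtr0_norm// -/kap.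
  have tk : t * kap < d.
    move: td; rewrite ltr_pdivlMr//; apply: le_lt_trans.
    by rewrite ler_pM2l// lerDl.
  move=> /(_ tk); rewrite (linearZ_LR ('d g x)).
  have tz : rc t != 0 by rewrite rc_eq0 gt_eqF.
  have -> : g (x + rc t *: v) - g x - rc t *: 'd g x v = rc t * (phi t x - 'd g x v).
    rewrite phiE; move: ('d g x v) (g (x + rc t *: v) - g x) => a b.
    by rewrite -[rc t *: a]/(rc t * a) mulrBr [rc t * (_ / _)]mulrC divfK.
  rewrite nrM nr_rc gtr0_norm// => H; rewrite -(ler_pM2l t0); apply: le_trans H _.
  rewrite mulrCA ler_pM2l// mulrAC ler_pdivrMr// ler_pM2l// lerDl//.
(* The limit of [claim2] as [t] tends to 0, identified by [claim3]. *)
have claim4 s x y : 0 < s -> s <= r / 2 ->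
    nr (x - x0) < rho / 2 / 16 -> nr (y - x0) < rho / 2 / 16 ->
    nr (('d g x v - phi s x) - ('d g y v - phi s y)) <= K2 * s * nr (x - y).
  move=> s0 sr xr yr; apply/ler_addgt0Pr => e e0.
  have [e1 e10 H1] := claim3 x (e / 2) (divr_gt0 e0 (ltr0n _ 2)).
  have [e2 e20 H2] := claim3 y (e / 2) (divr_gt0 e0 (ltr0n _ 2)).
  pose t := Num.min (Num.min e1 e2 / 2) (s / 2).
  have t0 : 0 < t by rewrite lt_min !divr_gt0// lt_min e10.
  have : t <= t by [].
  rewrite {2}/t le_min => /andP[te ts].
  have m0 : 0 < Num.min e1 e2 by rewrite lt_min e10.
  have m1 : Num.min e1 e2 <= e1 by rewrite ge_min lexx.
  have m2 : Num.min e1 e2 <= e2 by rewrite ge_min lexx orbT.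
  have te1 : t < e1 by lra.
  have te2 : t < e2 by lra.
  have h1 := H1 t t0 te1; have h2 := H2 t t0 te2.
  have h3 : nr ((phi t x - phi s x) - (phi t y - phi s y)) <= K2 * s * nr (x - y).
    apply: le_trans (claim2 t s x y _ _ _ _ _ _ _) _ => //.
    - by apply: le_trans ts _; lra.
    - by rewrite gt_eqF//; lra.
    - rewrite ler_wpM2r ?nr_ge0// ler_wpM2l ?(ltW K20)// ler_norml; apply/andP; split; lra.
  move: h1 h2 h3; move: ('d g x v) ('d g y v) (phi t x) (phi t y) (phi s x) (phi s y) => a b c d k l.
  move=> h1 h2 h3.
  have -> : a - k - (b - l) = (c - k - (d - l)) + ((d - b) - (c - a)) by ring.
  apply: le_trans (nrD _ _) _; have := nrB (d - b) (c - a); lra.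
apply: differentiable_approx => e e0.
pose s := Num.min (r / 2) (e / K2).
have s0 : 0 < s by rewrite lt_min; apply/andP; split; exact: divr_gt0.
have : s <= s by [].
rewrite {2}/s le_min => /andP[sr se].
exists (phi s); first exact: dphi.
exists (rho / 2 / 16); first by rewrite !divr_gt0.
move=> h hr; have := claim4 s (x0 + h) x0 s0 sr.
have -> : x0 + h - x0 = h by rewrite addrC addKr.
rewrite subrr nr0 => H; apply: le_trans (H hr _) _; first by rewrite !divr_gt0.
by rewrite ler_wpM2r ?nr_ge0// mulrC -ler_pdivlMr.
Qed.

End PartialDerivative.

(** * The implicit function theorem *)

Section ImplicitFunction.
Context {R : realType}.
Local Notation C := (Cfield R).

Lemma nr_pair_le (U V : normedModType C) (a : U) (b : V) (e : R) :
  nr a <= e -> nr b <= e -> nr ((a, b) : (U * V)%type) <= e.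
Proof. by rewrite -!le_rc -!nrE => *; exact: pair_norm_le. Qed.

Lemma nr_pair_lt (U V : normedModType C) (a : U) (b : V) (e : R) :
  nr a < e -> nr b < e -> nr ((a, b) : (U * V)%type) < e.
Proof.
move=> ae be; apply: (@le_lt_trans _ _ (Num.max (nr a) (nr b))).
  by apply: nr_pair_le; rewrite le_max lexx ?orbT.
by rewrite gt_max ae be.
Qed.

Lemma mulmx_bound d (B : 'M[C]_d) :
  exists2 beta : R, 0 < beta & forall v : 'rV[C]_d, nr (v *m B) <= beta * nr v.
Proof.
pose S := \sum_j \sum_i nr (B j i : C).
have S0 : 0 <= S by apply: sumr_ge0 => j _; apply: sumr_ge0 => i _; exact: nr_ge0.
exists (1 + S); first by rewrite ltr_pwDl.
move=> v; apply: rv_nr_le; first by rewrite mulr_ge0 ?nr_ge0// addr_ge0.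
move=> i; rewrite mxE; apply: le_trans (nr_sum _ _ _) _.
apply: (@le_trans _ _ (S * nr v)); last by rewrite ler_wpM2r ?nr_ge0// lerDr.
rewrite /S mulr_suml; apply: ler_sum => j _.
rewrite nrM mulrC ler_pM ?nr_ge0 ?rv_nr_ge//.
by rewrite (bigD1 i)//= lerDl sumr_ge0// => k _; exact: nr_ge0.
Qed.

Lemma differentiable_mulmxr (U : normedModType C) d (B : 'M[C]_d) (F : U -> 'rV[C]_d) x :
  differentiable F x -> differentiable (fun y => F y *m B) x.
Proof.
move=> dF; apply: (@differentiable_compf _ _ _ _ F (mulmxr B)) => //.
apply: linear_differentiable => y; apply/continuous_nrP => e e0.
have [beta b0 Hb] := mulmx_bound B.
exists (e / beta); first by rewrite divr_gt0.
move=> z zy; rewrite /= -mulmxBl; apply: le_lt_trans (Hb _) _.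
by rewrite mulrC -ltr_pdivlMr.
Qed.

(* Newton's iteration [p - Phi(x, p) B], with [B] the inverse of the partial differential at the
   base point, consists of entire maps of [x] and converges uniformly. *)
Lemma implicit_function (P : normedModType C) d (Phi : (P * 'rV[C]_d)%type -> 'rV[C]_d)
    (x0 : P) (p0 : 'rV[C]_d) :
  (forall z, differentiable Phi z) -> Phi (x0, p0) = 0 ->
  (forall v, 'd Phi (x0, p0) (0, v) = 0 -> v = 0) ->
  exists r rho L : R, exists h : P -> 'rV[C]_d, [/\ 0 < r, 0 < rho,
    forall x, nr (x - x0) < r -> Phi (x, h x) = 0 /\ nr (h x - p0) < rho,
    forall x p, nr (x - x0) < r -> nr (p - p0) < rho -> Phi (x, p) = 0 -> p = h x &
    (forall x y, nr (x - x0) < r -> nr (y - x0) < r -> nr (h x - h y) <= L * nr (x - y)) /\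
    (forall x i, nr (x - x0) < r -> differentiable (fun y => h y 0 i : C) x)].
Proof.
move=> dPhi Phi0 inj; set z0 := (x0, p0) in Phi0 inj.
pose D : {linear _ -> _} := 'd Phi z0.
pose f1 v := D ((0 : P), v).
have lin1 : linear f1 by exact: linear_comp_inr.
pose M1 := GRing.isLinear.Build _ _ _ _ _ lin1.
pose f : {linear 'rV[C]_d -> 'rV[C]_d} := HB.pack f1 M1.
pose A := lin1_mx f.
have AE v : v *m A = D ((0 : P), v) by rewrite mul_rV_lin1.
have Aunit : A \in unitmx.
  rewrite -row_free_unit -kermx_eq0; apply/rowV0P => v /sub_kermxP.
  by rewrite AE; exact: inj.
pose B := invmx A.
have AB (v : 'rV[C]_d) : v *m A *m B = v by rewrite -mulmxA mulmxV// mulmx1.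
have BA (v : 'rV[C]_d) : v *m B *m A = v by rewrite -mulmxA mulVmx// mulmx1.
have [beta b0 Hb] := mulmx_bound B.
(* With this error in the strict differential, [T x] contracts distances by the factor 1/2. *)
have e0 : 0 < 1 / (2 * beta) by rewrite divr_gt0// mulr_gt0.
have [r1 r10 Hr1] := @strict_differentiable R _ _ Phi z0 dPhi _ e0.
have [rho0 rho00 HM] := differentiable_bounded (dPhi z0).
set Mb := nr (Phi z0) + 1 in HM.
have Klip := @lipschitz_of_bound_rv R _ d Phi z0 rho0 Mb rho00 dPhi HM.
set K := 16 * Mb / rho0 in Klip.
have K0 : 0 < K by rewrite /K /Mb Phi0 nr0 add0r mulr1 divr_gt0.
pose d0 := Num.min r1 (rho0 / 16).
have d00 : 0 < d0 by rewrite lt_min r10 divr_gt0.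
have d0r : d0 <= r1 by rewrite ge_min lexx.
have d0rho : d0 <= rho0 / 16 by rewrite ge_min lexx orbT.
(* The first Newton step, at most [beta * K * r], must not exceed [b 1 = d0 / 8], so that all
   iterates remain within [d0 / 4] of [p0]. *)
pose r := Num.min d0 (d0 / (8 * (beta * K))).
have bK : 0 < beta * K by rewrite mulr_gt0.
have r0 : 0 < r by rewrite lt_min d00 divr_gt0// mulr_gt0.
have rd : r <= d0 by rewrite ge_min lexx.
have rbK : beta * K * r <= d0 / 8.
  have : r <= d0 / (8 * (beta * K)) by rewrite ge_min lexx orbT.
  have b8 : 0 < 8 * (beta * K) by rewrite pmulr_rgt0.
  by rewrite (ler_pdivlMr r d0 b8) => H; clear -H; lra.
pose T x p := p - Phi (x, p) *m B.
have Tcontr x p q : nr (x - x0) < d0 -> nr (p - p0) < d0 -> nr (q - p0) < d0 ->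
    nr (T x p - T x q) <= nr (p - q) / 2.
  move=> xd pd qd.
  have zB s : nr (s - p0) < d0 -> nr ((x, s) - z0) < r1.
    by move=> sd; apply: lt_le_trans d0r; exact: nr_pair_lt.
  have := Hr1 (x, p) (x, q) (zB p pd) (zB q qd).
  have -> : (x, p) - (x, q) = (0, p - q) by congr pair; rewrite ?subrr.
  have n0q : nr ((0, p - q) : (P * 'rV[C]_d)%type) <= nr (p - q).
    by apply: nr_pair_le; rewrite ?nr0 ?nr_ge0.
  rewrite -/D -AE => H.
  have -> : T x p - T x q = - ((Phi (x, p) - Phi (x, q) - (p - q) *m A) *m B).
    rewrite /T [in RHS]mulmxBl AB mulmxBl opprB.
    move: (Phi (x, p) *m B) (Phi (x, q) *m B) => a c.
    by apply/rowP => j; rewrite !mxE; ring.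
  rewrite nrN; apply: le_trans (Hb _) _.
  apply: le_trans (ler_wpM2l (ltW b0) H) _.
  have -> : beta * (1 / (2 * beta) * nr ((0, p - q) : (P * 'rV[C]_d)%type)) =
     nr ((0, p - q) : (P * 'rV[C]_d)%type) / 2.
    by have nz := lt0r_neq0 b0; field.
  by rewrite ler_pM2r ?invr_gt0.
pose p (k : nat) (x : P) : 'rV[C]_d := iter k (T x) p0.
have dp k x : differentiable (p k) x.
  elim: k => [|k IH]; first exact: differentiable_cstf.
  have -> : p k.+1 = (fun x => p k x - Phi (x, p k x) *m B) by [].
  apply: differentiable_subf => //; apply: differentiable_mulmxr.
  apply: (@differentiable_compf _ _ _ _ (fun x => (x, p k x)) Phi); last exact: dPhi.
  by apply: differentiable_pairf; first exact: differentiable_idf.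
pose b (k : nat) : R := d0 / 4 / 2 ^+ k.
have p2 k : (0 : R) < 2 ^+ k by rewrite exprn_gt0.
have bS k : b k.+1 = b k / 2 by rewrite /b exprS; have nz := lt0r_neq0 (p2 k); field.
have b2 k : 2 * b k = d0 / 2 / 2 ^+ k by rewrite /b; have nz := lt0r_neq0 (p2 k); field.
have b4 k : 4 * b k = d0 / 2 ^+ k by rewrite /b; have nz := lt0r_neq0 (p2 k); field.
have bpos k : 0 < b k by rewrite !divr_gt0.
have pk x k : nr (x - x0) < r ->
    nr (p k.+1 x - p k x) <= b k.+1 /\ nr (p k x - p0) <= d0 / 4 - b k.
  move=> xr; have xd : nr (x - x0) < d0 by apply: lt_le_trans rd.
  elim: k => [|k [IH1 IH2]].
    split; last by rewrite /= subrr nr0 /b expr0 divr1 subrr.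
    rewrite /= /T addrC addKr nrN; apply: le_trans (Hb _) _.
    have zz : nr (z0 - z0) < rho0 / 16 by rewrite subrr nr0 divr_gt0.
    have zx : nr ((x, p0) - z0) < rho0 / 16.
      by apply: lt_le_trans d0rho; apply: nr_pair_lt => //=; rewrite subrr nr0.
    have := Klip _ _ zx zz; rewrite Phi0 subr0.
    have nz : nr ((x, p0) - z0) <= r.
      by apply: nr_pair_le => /=; [exact: ltW|rewrite subrr nr0 ltW].
    move=> H; apply: le_trans (ler_wpM2l (ltW b0) H) _; rewrite bS /b expr0 divr1.
    rewrite mulrA; apply: le_trans (ler_wpM2l (ltW bK) nz) _; lra.
  have near1 : nr (p k.+1 x - p0) <= d0 / 4 - b k.+1.
    apply: le_trans (nr_distD (p k x) _ _) _; apply: le_trans (lerD IH1 IH2) _.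
    by rewrite bS; have := bpos k; lra.
  split => //.
  have := Tcontr x (p k.+1 x) (p k x) xd.
  rewrite -[T x (p k.+1 x)]/(p k.+2 x) -[T x (p k x)]/(p k.+1 x) => H.
  apply: le_trans (H _ _) _.
  - by apply: le_lt_trans near1 _; have := bpos k.+1; lra.
  - by apply: le_lt_trans IH2 _; have := bpos k; lra.
  - by rewrite (bS k.+1) ler_pM2r ?invr_gt0.
have pkj x k j : nr (x - x0) < r -> nr (p (k + j)%N x - p k x) <= b k - b (k + j)%N.
  move=> xr; elim: j => [|j IH]; first by rewrite addn0 !subrr nr0.
  rewrite addnS; apply: le_trans (nr_distD (p (k + j)%N x) _ _) _.
  have [h1 _] := pk x (k + j)%N xr; apply: le_trans (lerD h1 IH) _.
  by rewrite bS; lra.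
have pkl x k l : nr (x - x0) < r -> nr (p k x - p l x) <= b k + b l.
  move=> xr; wlog kl : k l / (k <= l)%N.
    move=> H; have [/H//|/ltnW /H] := leqP k l.
    by rewrite nr_dist (addrC (b l)).
  rewrite nr_dist -(subnKC kl); apply: le_trans (pkj _ _ _ xr) _.
  by have := bpos (k + (l - k))%N; lra.
have /choice[h Hh] : forall x, exists hx : 'rV[C]_d, nr (x - x0) < r ->
    forall k, nr (p k x - hx) <= 2 * b k.
  move=> x; have [xr|] := pselect (nr (x - x0) < r); last by exists 0.
  have /choice[l Hl] : forall i, exists l : C, forall k, nr ((p k x) 0 i - l : C) <= 2 * b k.
    move=> i; apply: (complex_complete 0%N) => k k'.
    have := rv_nr_ge (p k x - p k' x) i; rewrite !mxE => /le_trans; apply; exact: pkl.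
  exists (\row_i l i) => _ k; apply: rv_nr_le; first by rewrite mulr_ge0// ltW.
  by move=> i; rewrite !mxE.
have hd x : nr (x - x0) < r -> nr (h x - p0) < d0.
  move=> xr; have : nr (p0 - h x) <= 2 * b 0%N := Hh x xr 0%N.
  rewrite nr_dist => /le_lt_trans; apply.
  by rewrite /b expr0; lra.
have hfix x : nr (x - x0) < r -> T x (h x) = h x.
  move=> xr; have xd : nr (x - x0) < d0 by apply: lt_le_trans rd.
  apply/eqP; rewrite -subr_eq0 -nr_eq0; apply/eqP/le_anti; rewrite nr_ge0 andbT.
  rewrite leNgt; apply/negP => n0.
  set n1 := nr _ in n0.
  have bound k : n1 <= 2 * b k.
    apply: le_trans (nr_distD (T x (p k x)) _ _) _.
    have [_ h2] := pk x k xr.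
    have h1 : nr (T x (h x) - T x (p k x)) <= nr (h x - p k x) / 2.
      by apply: Tcontr => //; [exact: hd|apply: le_lt_trans h2 _; have := bpos k; lra].
    have h0 : nr (h x - p k x) <= 2 * b k by rewrite nr_dist; exact: Hh.
    have h3 : nr (T x (p k x) - h x) <= b k.
      have : nr (p k.+1 x - h x) <= 2 * b k.+1 := Hh x xr k.+1.
      by rewrite bS mulrC divfK// pnatr_eq0.
    apply: (le_trans (lerD h1 h3)); clear -h0; lra.
  pose k := Num.truncn (d0 / 2 / n1).
  have := bound k; apply/negP; rewrite -ltNge.
  rewrite b2.
  rewrite ltr_pdivrMr// -ltr_pdivrMl// mulrC; apply: lt_le_trans (truncnS_gt _) _.
  by rewrite -natrX ler_nat ltn_expl.
have Tfix x q : T x q = q <-> Phi (x, q) = 0.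
  split=> [|E]; last by rewrite /T E mul0mx subr0.
  move=> /eqP; rewrite subr_eq addrC -subr_eq subrr eq_sym => /eqP E.
  by rewrite -(BA (Phi _)) E mul0mx.
exists r, d0, (2 * (beta * K)), h; split => //.
- by move=> x xr; split; [apply/Tfix; exact: hfix|exact: hd].
- move=> x q xr qd /Tfix Tq; have xd : nr (x - x0) < d0 by apply: lt_le_trans rd.
  have := Tcontr x q (h x) xd qd (hd x xr); rewrite Tq hfix// => H.
  apply/eqP; rewrite -subr_eq0 -nr_eq0; apply/eqP/le_anti; rewrite nr_ge0 andbT; lra.
split.
- move=> x y xr yr; have xd : nr (x - x0) < d0 by apply: lt_le_trans rd.
  have yd : nr (y - x0) < d0 by apply: lt_le_trans rd.
  have h1 := Tcontr x (h x) (h y) xd (hd x xr) (hd y yr).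
  have h2 : nr (T x (h y) - T y (h y)) <= beta * K * nr (x - y).
    have -> : T x (h y) - T y (h y) = - ((Phi (x, h y) - Phi (y, h y)) *m B).
      rewrite /T mulmxBl; move: (Phi (x, h y) *m B) (Phi (y, h y) *m B) => a c.
      by apply/rowP => j; rewrite !mxE; ring.
    rewrite nrN; apply: le_trans (Hb _) _; rewrite -mulrA ler_pM2l//.
    apply: le_trans (Klip _ _ _ _) _.
    + by apply: lt_le_trans d0rho; apply: nr_pair_lt => //=; exact: hd.
    + by apply: lt_le_trans d0rho; apply: nr_pair_lt => //=; exact: hd.
    + rewrite ler_pM2l//; apply: nr_pair_le => /=; first exact: lexx.
      by rewrite subrr nr0 nr_ge0.
  rewrite (hfix x xr) in h1; rewrite (hfix y yr) in h2.
  have h3 := nr_distD (T x (h y)) (h x) (h y).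
  clear -h1 h2 h3; lra.
- move=> x1 i xr.
  pose rho := r - nr (x1 - x0).
  have rho_gt0 : 0 < rho by rewrite subr_gt0.
  have b32 k : 32 * b k / rho = 8 * d0 / rho / 2 ^+ k.
    by rewrite /b; have nz := lt0r_neq0 (p2 k); have nz2 := lt0r_neq0 rho_gt0; field; rewrite nz.
  have ball x : nr (x - x1) < rho -> nr (x - x0) < r.
    by move=> xx; apply: le_lt_trans (nr_distD x1 _ _) _; move: xx; rewrite /rho; lra.
  (* The Lipschitz constant of [p l - p k] follows from its size on the ball; [l] is then taken so
     large that replacing [p l] by its limit costs at most [e]. *)
  have lipk k x y : nr (x - x1) < rho / 16 -> nr (y - x1) < rho / 16 ->
      nr ((h x - p k x) - (h y - p k y)) <= 32 * b k / rho * nr (x - y).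
    move=> xx yy; apply/ler_addgt0Pr => e ep.
    have rr : rho / 16 < rho by rewrite ltr_pdivrMr// ltr_pMr// ltr1n.
    have xr' : nr (x - x0) < r by apply: ball; apply: lt_trans rr.
    have yr' : nr (y - x0) < r by apply: ball; apply: lt_trans rr.
    have [l [bl blk]] : exists l, 4 * b l <= e /\ b l <= b k.
      exists (k + Num.truncn (d0 / e))%N; split.
        rewrite b4 ler_pdivrMr// mulrC -ler_pdivrMr//; apply: le_trans (ltW (truncnS_gt _)) _.
        rewrite -natrX ler_nat; apply: leq_trans (_ : (k + Num.truncn (d0 / e)).+1 <= _)%N.
          by rewrite ltnS leq_addl.
        by rewrite ltn_expl.
      have := pkj x k (Num.truncn (d0 / e)) xr'.
      by move=> /(le_trans (nr_ge0 _)); rewrite subr_ge0.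
    have lip1 := @lipschitz_of_bound_rv R P d (fun x => p l x - p k x) x1 rho (2 * b k) rho_gt0.
    have := lip1 _ _ x y xx yy.
    have -> : 16 * (2 * b k) / rho = 32 * b k / rho by rewrite mulrA -natrM.
    move=> H; have {}H := H _ _.
    have h1 : nr (p l x - p k x - (p l y - p k y)) <= 32 * b k / rho * nr (x - y).
      apply: H => [z|z zr]; first by apply: differentiable_subf.
      by apply: le_trans (pkl z l k (ball z zr)) _; lra.
    have h2 := Hh x xr' l; have h3 := Hh y yr' l.
    have -> : h x - p k x - (h y - p k y) =
       (p l x - p k x - (p l y - p k y)) - ((p l x - h x) - (p l y - h y)).
      clear; move: (h x) (h y) (p l x) (p l y) (p k x) (p k y) => q1 q2 q3 q4 q5 q6.
      by apply/rowP => j; rewrite !mxE; ring.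
    apply: le_trans (nrB _ _) _; apply: (lerD h1).
    apply: le_trans (nrB _ _) _; apply: le_trans (lerD h2 h3) _; clear -bl; lra.
  apply: differentiable_approx => e ep.
  pose k := Num.truncn (8 * d0 / rho / e).
  have bk : 32 * b k / rho <= e.
    rewrite b32.
    rewrite ler_pdivrMr// -ler_pdivrMl// mulrC; apply: le_trans (ltW (truncnS_gt _)) _.
    by rewrite -natrX ler_nat ltn_expl.
  exists (fun x => p k x 0 i : C); first by apply: differentiable_rv; exact: dp.
  exists (rho / 16); first by rewrite divr_gt0.
  move=> v vr; have := lipk k (x1 + v) x1.
  have -> : x1 + v - x1 = v by rewrite addrC addKr.
  rewrite subrr nr0 => H; have {}H := H vr (divr_gt0 rho_gt0 (ltr0n _ 16)).
  have := rv_nr_ge (h (x1 + v) - p k (x1 + v) - (h x1 - p k x1)) i; rewrite !mxE => H2.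
  apply: le_trans H2 _; apply: le_trans H _; rewrite ler_wpM2r ?nr_ge0//.
Qed.

End ImplicitFunction.

(** * The dot product and the first-order condition *)

Section DotProduct.
Context {R : realType} {d : nat}.
Implicit Types (u v w : 'rV[R]_d).

Lemma dotC u v : dot u v = dot v u.
Proof. by apply: eq_bigr => i _; rewrite mulrC. Qed.
Lemma dotDl u v w : dot (u + v) w = dot u w + dot v w.
Proof. by rewrite /dot -big_split; apply: eq_bigr => i _; rewrite mxE mulrDl. Qed.
Lemma dotDr u v w : dot u (v + w) = dot u v + dot u w.
Proof. by rewrite !(dotC u) dotDl. Qed.
Lemma dotNl u v : dot (- u) v = - dot u v.
Proof. by rewrite /dot -sumrN; apply: eq_bigr => i _; rewrite mxE mulNr. Qed.
Lemma dotNr u v : dot u (- v) = - dot u v.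
Proof. by rewrite !(dotC u) dotNl. Qed.
Lemma dotBl u v w : dot (u - v) w = dot u w - dot v w.
Proof. by rewrite dotDl dotNl. Qed.
Lemma dotBr u v w : dot u (v - w) = dot u v - dot u w.
Proof. by rewrite dotDr dotNr. Qed.
Lemma dotZl (k : R) u v : dot (k *: u) v = k * dot u v.
Proof. by rewrite /dot mulr_sumr; apply: eq_bigr => i _; rewrite mxE mulrA. Qed.
Lemma dotZr (k : R) u v : dot u (k *: v) = k * dot u v.
Proof. by rewrite !(dotC u) dotZl. Qed.
Lemma dot0l u : dot 0 u = 0.
Proof. by rewrite /dot big1// => i _; rewrite mxE mul0r. Qed.
Lemma dot0r u : dot u 0 = 0.
Proof. by rewrite dotC dot0l. Qed.

Lemma dot_bound u v : `|dot u v| <= d%:R * `|u| * `|v|.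
Proof.
apply: le_trans (ler_norm_sum _ _ _) _.
apply: (@le_trans _ _ (\sum_(i < d) `|u| * `|v|)).
  by apply: ler_sum => i _; rewrite normrM ler_pM// rv_norm_ge.
by rewrite sumr_const card_ord -mulrA mulr_natl.
Qed.

Lemma dot_ge u : `|u| ^+ 2 <= dot u u.
Proof.
have [->|u0] := eqVneq u 0; first by rewrite normr0 expr0n dot0l.
have [i ->] := rv_norm_max u0; rewrite /dot (bigD1 i)//= -expr2 real_normK ?num_real//.
by rewrite lerDl sumr_ge0// => j _; rewrite -expr2 sqr_ge0.
Qed.

Lemma rv_norm_le u (e : R) : 0 <= e -> (forall i, `|u 0 i| <= e) -> `|u| <= e.
Proof.
move=> e0 H; have [->|u0] := eqVneq u 0; first by rewrite normr0.
by have [i ->] := rv_norm_max u0.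
Qed.

Lemma dot_delta u i : dot u (delta_mx 0 i) = u 0 i.
Proof.
rewrite /dot (bigD1 i)//= mxE !eqxx mulr1 big1 ?addr0// => j ji.
by rewrite mxE (negbTE ji) mulr0.
Qed.

(** Tested on a small multiple of [- c]. This is the first-order condition at a minimum, from a
    one-sided lower bound. *)
Lemma dot_nonneg_small (c : 'rV[R]_d) :
  (forall e : R, 0 < e -> exists2 r : R, 0 < r & forall h, `|h| < r -> - (e * `|h|) <= dot c h) ->
  c = 0.
Proof.
move=> H; apply/eqP; rewrite -normr_eq0; apply/negPn/negP => c0.
have {}c0 : 0 < `|c| by rewrite lt_def c0 normr_ge0.
have [r r0 Hr] := H (`|c| / 2) (divr_gt0 c0 (ltr0n _ 2)).
pose t := r / (2 * `|c|); have t0 : 0 < t by rewrite divr_gt0// mulr_gt0.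
have tc : t * `|c| = r / 2 by rewrite /t; have nz := lt0r_neq0 c0; field.
have := Hr (- (t *: c)); rewrite normrN normrZ gtr0_norm// tc => /(_ _).
have -> : (r / 2 < r) by rewrite ltr_pdivrMr// ltr_pMr// ltr1n.
move=> /(_ isT); rewrite dotNr dotZr lerN2 => h1.
have h2 : t * `|c| ^+ 2 <= `|c| / 2 * (r / 2).
  by apply: le_trans h1; rewrite ler_pM2l// dot_ge.
have : t * `|c| ^+ 2 = `|c| * (r / 2) by rewrite expr2 mulrA tc mulrC.
by move=> h3; rewrite h3 in h2; have := mulr_gt0 c0 r0; clear -h2; lra.
Qed.

End DotProduct.

Section Dini.
Context {R : realType}.

(** The supremum of the points up to which the bound with [L + e] holds has the same property and
    cannot be less than [b]. The lemma serves for the action along a family of orbits for which only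
    Lipschitz bounds have been established. *)
Lemma dini_lipschitz (f : R -> R) (L a b : R) : a <= b ->
  (forall s, a <= s <= b -> forall e : R, 0 < e -> exists2 r : R, 0 < r &
     forall t, a <= t <= b -> `|t - s| < r -> `|f t - f s| <= (L + e) * `|t - s|) ->
  `|f b - f a| <= L * (b - a).
Proof.
move=> ab H.
suff He (e : R) : 0 < e -> `|f b - f a| <= (L + e) * (b - a).
  have [->|ba] := eqVneq a b; first by rewrite !subrr normr0 mulr0.
  have bap : 0 < b - a by rewrite subr_gt0 lt_neqAle ba.
  apply/ler_addgt0Pr => e e0; apply: le_trans (He (e / (b - a)) (divr_gt0 e0 bap)) _.
  by rewrite mulrDl divfK// gt_eqF.
move=> e0; pose E := [set t : R | a <= t <= b /\ `|f t - f a| <= (L + e) * (t - a)].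
have Ea : E a by split; rewrite ?lexx ?ab// !subrr normr0 mulr0.
have Eub : ubound E b by move=> t [/andP[]].
have supE : has_sup E by split; [exists a|exists b].
pose T := sup E.
have aT : a <= T by apply: sup_upper_bound.
have Tb : T <= b by apply: ge_sup => //; exists a.
have aTb : a <= T <= b by rewrite aT Tb.
have [r r0 Hr] := H T aTb e e0.
have ET : E T.
  have [t Et] := sup_adherent r0 supE; rewrite -/T => Tt.
  have tT : t <= T by apply: sup_upper_bound.
  have [/andP[at_ tb] ft] := Et.
  have := Hr t; rewrite at_ tb => /(_ isT).
  have -> : `|t - T| = T - t by rewrite distrC ger0_norm// subr_ge0.
  move=> /(_ _); have -> : T - t < r by lra.
  move=> /(_ isT) h; split; first by rewrite aT Tb.
  have -> : f T - f a = (f T - f t) + (f t - f a) by ring.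
  apply: le_trans (ler_normD _ _) _; rewrite distrC; apply: le_trans (lerD h ft) _.
  by rewrite -mulrDr addrA subrK.
have [TE|Tnb] := eqVneq T b; first by have [_] := ET; rewrite TE.
have Tb' : T < b by rewrite lt_neqAle Tnb.
pose t := Num.min (T + r / 2) b.
have Tt : T < t by rewrite lt_min Tb' ltrDl divr_gt0.
have tb : t <= b by rewrite ge_min lexx orbT.
have tr : t <= T + r / 2 by rewrite ge_min lexx.
have [_ fT] := ET.
suff : E t by move=> /(sup_upper_bound supE); rewrite -/T leNgt Tt.
have at_ : a <= t by apply: le_trans aT (ltW Tt).
split; first by rewrite at_ tb.
have := Hr t; rewrite at_ tb => /(_ isT).
have -> : `|t - T| = t - T by rewrite ger0_norm// subr_ge0 ltW.
move=> /(_ _); have -> : t - T < r by lra.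
move=> /(_ isT) h.
have -> : f t - f a = (f t - f T) + (f T - f a) by ring.
apply: le_trans (ler_normD _ _) _; apply: le_trans (lerD h fT) _.
by rewrite -mulrDr addrA subrK.
Qed.

Lemma is_derive_small (f : R -> R) (x D : R) :
  (forall e : R, 0 < e -> exists2 r : R, 0 < r &
    forall h, `|h| < r -> `|f (x + h) - f x - h * D| <= e * `|h|) -> is_derive x 1 f D.
Proof.
move=> H; have cv : (fun h : R => h^-1 *: ((f \o shift x) (h *: 1) - f x)) @ 0^' --> D.
  apply/cvgrPdist_lt => e e0; have [r r0 Hr] := H (e / 2) (divr_gt0 e0 (ltr0n _ 2)).
  rewrite near_withinE; apply/nbhs_ballP; exists r => // h.
  rewrite /ball /= sub0r normrN => hr h0.
  have hp : 0 < `|h| by rewrite normr_gt0.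
  have -> : D - h^-1 *: (f (h *: 1 + x) - f x) = - (h^-1 * (f (x + h) - f x - h * D)).
    rewrite -[h *: 1]/(h * 1) mulr1 (addrC h).
    rewrite -[_ *: _]/(_ * _) [in RHS]mulrBr mulKf// opprB.
    by [].
  rewrite normrN normrM normfV mulrC ltr_pdivrMr//; apply: le_lt_trans (Hr h hr) _.
  by rewrite ltr_pM2r//; lra.
apply: DeriveDef; first by apply/cvg_ex; exists D.
exact: cvg_lim cv.
Qed.

End Dini.

(** * Real points of complex spaces *)

Section Complexification.
Context {R : realType} {d : nat}.
Local Notation C := (Cfield R).

Lemma linear_nr_bound (U V : normedModType C) (L : {linear U -> V}) : continuous L ->
  exists2 B : R, 0 < B & forall h, nr (L h) <= B * nr h.
Proof.
move=> cL; have c0 : {for (0 : U), continuous L} by exact: cL.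
have /continuous_nrP /(_ 1 ltr01)[r r0 Hr] := c0.
exists (2 / r); first by rewrite divr_gt0.
move=> h; have [->|h0] := eqVneq h 0; first by rewrite linear0 !nr0 mulr0.
have n0 : 0 < nr h by rewrite nr_gt0.
pose s := r / (2 * nr h); have s0 : 0 < s by rewrite divr_gt0// mulr_gt0.
have sh : s * nr h = r / 2 by rewrite /s; have nz := lt0r_neq0 n0; field.
have := Hr (rc s *: h); rewrite (linear0 L) [X in nr X < r]subr0 [X in nr X < 1]subr0 (linearZ_LR L) !nrZ nr_rc gtr0_norm// sh.
have -> : (r / 2 < r) by rewrite ltr_pdivrMr// ltr_pMr// ltr1n.
move=> /(_ isT) /ltW h1; rewrite -(ler_pM2l s0); apply: le_trans h1 _.
rewrite mulrCA sh; have nz := lt0r_neq0 r0; have -> : 2 / r * (r / 2) = 1 by field.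
exact: lexx.
Qed.

Lemma differentiable_lipschitz (U V : normedModType C) (f : U -> V) x : differentiable f x ->
  exists L r : R, [/\ 0 <= L, 0 < r & forall y, nr (y - x) < r -> nr (f y - f x) <= L * nr (y - x)].
Proof.
move=> df; have [B B0 HB] := @linear_nr_bound _ _ ('d f x) (diff_continuous df).
have [r r0 Hr] := differentiable_nr df ltr01.
exists (B + 1), r; split => //; first by rewrite addr_ge0// ltW.
move=> y yx; have := Hr (y - x) yx; rewrite subrKC mul1r => h1.
have := nrD (f y - f x - 'd f x (y - x)) ('d f x (y - x)); rewrite subrK => h2.
apply: le_trans h2 _; rewrite mulrDl mul1r addrC; exact: lerD.
Qed.

Lemma complexifyE (q : 'rV[R]_d) i : complexify q 0 i = rc (q 0 i).
Proof. by rewrite mxE. Qed.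

Lemma complexifyD (q p : 'rV[R]_d) : complexify (q + p) = complexify q + complexify p.
Proof. by apply/rowP => i; rewrite complexifyE [RHS]mxE !complexifyE mxE rcD. Qed.

Lemma complexifyB (q p : 'rV[R]_d) : complexify (q - p) = complexify q - complexify p.
Proof.
rewrite complexifyD; congr (_ + _); apply/rowP => i.
by rewrite complexifyE [RHS]mxE complexifyE mxE rcN.
Qed.

Lemma complexifyZ (k : R) (q : 'rV[R]_d) : complexify (k *: q) = rc k *: complexify q.
Proof. by apply/rowP => i; rewrite complexifyE [RHS]mxE !complexifyE mxE rcM. Qed.

Lemma complexify_inj : injective (@complexify R d).
Proof.
move=> q p /rowP H; apply/rowP => i; have := H i; rewrite !complexifyE.
exact: rcI.
Qed.

Lemma complexify2B (z w : phase R d) : complexify2 (z - w) = complexify2 z - complexify2 w.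
Proof. by rewrite /complexify2 !complexifyB. Qed.

Lemma nr_complexify (q : 'rV[R]_d) : nr (complexify q) = `|q|.
Proof.
apply/le_anti/andP; split.
  by apply: rv_nr_le => // i; rewrite complexifyE nr_rc rv_norm_ge.
apply: rv_norm_le => [|i]; first exact: nr_ge0.
by rewrite -nr_rc -complexifyE rv_nr_ge.
Qed.

Lemma nr_complexify2 (z : phase R d) : nr (complexify2 z) = `|z|.
Proof.
case: z => q p; apply/le_anti/andP; split.
  by apply: nr_pair_le; rewrite nr_complexify; [exact: fst_norm_le|exact: snd_norm_le].
apply: pair_norm_le; rewrite -nr_complexify -le_rc -!nrE; [exact: fst_norm_le|exact: snd_norm_le].
Qed.

End Complexification.

(** * Generating functions and the action *)

Section TwistSystem.
Context (R : realType) (d : nat).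
Local Notation V := 'rV[R]_d.
Local Notation C := (Cfield R).

Definition gradient_at (f : V -> R) (x c : V) := forall e : R, 0 < e ->
  exists2 r : R, 0 < r & forall h, `|h| < r -> `|f (x + h) - f x - dot c h| <= e * `|h|.

(* [ts_p q Q] and [ts_P q Q] are the initial and final momenta of the orbit segment of [F] from
   [q] to [Q], so that [dS = P dQ - p dq]; [ts_cFi] is the inverse of the complexified map. *)
Record twist_system := TwistSystem {
  ts_F : phase R d -> phase R d;
  ts_p : V -> V -> V;
  ts_P : V -> V -> V;
  ts_S : V -> V -> R;
  ts_G : V -> R;
  ts_dG : V -> V;
  ts_cF : phase C d -> phase C d;
  ts_cFi : phase C d -> phase C d;
  ts_cdG : 'rV[C]_d -> 'rV[C]_d;
  ts_FP : forall q p Q P, ts_F (q, p) = (Q, P) <-> p = ts_p q Q /\ P = ts_P q Q;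
  ts_F_per : forall k q p, ts_F (q + intv R k, p) = ((ts_F (q, p)).1 + intv R k, (ts_F (q, p)).2);
  ts_S_diff : forall q Q (e : R), 0 < e -> exists2 r : R, 0 < r & forall u v, `|u| < r -> `|v| < r ->
    `|ts_S (q + u) (Q + v) - ts_S q Q - (dot (ts_P q Q) v - dot (ts_p q Q) u)| <= e * (`|u| + `|v|);
  ts_S_per : forall k q Q, ts_S (q + intv R k) (Q + intv R k) = ts_S q Q;
  ts_pos : exists2 alpha : R, 0 < alpha & forall q q' Q,
    dot (ts_P q Q - ts_P q' Q) (q - q') <= - alpha * dot (q - q') (q - q');
  ts_rate : exists B : R, [/\ 0 <= B, forall q Q Q', `|ts_P q Q - ts_P q Q'| <= B * `|Q - Q'|
    & forall q q' Q, `|ts_p q Q - ts_p q' Q| <= B * `|q - q'|];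
  ts_diag : exists M : R, forall q, `|ts_P q q| <= M /\ `|ts_S q q| <= M;
  ts_p_cont : continuous (fun z : V * V => ts_p z.1 z.2);
  ts_G_grad : forall q, gradient_at ts_G q (ts_dG q);
  ts_G_per : forall k q, ts_G (q + intv R k) = ts_G q;
  ts_dG_per : forall k q, ts_dG (q + intv R k) = ts_dG q;
  ts_G_bound : exists M : R, forall q, `|ts_G q| <= M;
  ts_cF_diff : forall z, differentiable ts_cF z;
  ts_cFi_diff : forall z, differentiable ts_cFi z;
  ts_cFK : cancel ts_cF ts_cFi;
  ts_cFE : forall z, ts_cF (complexify2 z) = complexify2 (ts_F z);
  ts_cdG_diff : forall q, differentiable ts_cdG q;
  ts_cdGE : forall q, ts_cdG (complexify q) = complexify (ts_dG q)
}.

End TwistSystem.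

Section Variational.
Context {R : realType} {d : nat} (T : twist_system R d).
Local Notation V := 'rV[R]_d.
Local Notation C := (Cfield R).
Local Notation S := (ts_S T).
Local Notation G := (ts_G T).
Local Notation dG := (ts_dG T).
Local Notation pm := (ts_p T).
Local Notation Pm := (ts_P T).
Implicit Types (q Q p P h u v : V) (x y : nat -> V) (e : R) (k m : 'rV[int]_d).

(** A Lipschitz bound centred at [z]. The real maps inherit it from the differentiability of their
    complexifications, and it is the regularity of orbits on which the variational arguments
    rely. *)
Definition lip_at (U W : normedModType R) (f : U -> W) (z : U) :=
  exists L r : R, [/\ 0 <= L, 0 < r & forall w, `|w - z| < r -> `|f w - f z| <= L * `|w - z|].

Lemma lip_at_comp (U W X : normedModType R) (f : U -> W) (g : W -> X) z :
  lip_at f z -> lip_at g (f z) -> lip_at (g \o f) z.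
Proof.
move=> [L [r [L0 r0 H]]] [L' [r' [L'0 r'0 H']]].
exists (L' * L), (Num.min r (r' / (L + 1))); split; first exact: mulr_ge0.
  by rewrite lt_min r0 divr_gt0// ltr_wpDl.
move=> w; rewrite lt_min => /andP[w1 w2]; have h1 := H w w1.
have L1 : 0 < L + 1 by rewrite ltr_wpDl.
rewrite -mulrA; apply: le_trans (H' _ _) _; last by rewrite ler_wpM2l.
apply: le_lt_trans h1 _; move: w2; rewrite ltr_pdivlMr//; apply: le_lt_trans.
by rewrite mulrC ler_wpM2l// lerDl.
Qed.

Lemma ts_F_lip z : lip_at (ts_F T) z.
Proof.
have [L [r [L0 r0 H]]] := differentiable_lipschitz (ts_cF_diff T (complexify2 z)).
exists L, r; split => // w; have := H (complexify2 w).
by rewrite !ts_cFE -!complexify2B !nr_complexify2.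
Qed.

Lemma ts_dG_lip q : lip_at dG q.
Proof.
have [L [r [L0 r0 H]]] := differentiable_lipschitz (ts_cdG_diff T (complexify q)).
exists L, r; split => // w; have := H (complexify w).
by rewrite !ts_cdGE -!complexifyB !nr_complexify.
Qed.

Definition Feps e (z : phase R d) : phase R d := ts_F T (z.1, z.2 + e *: dG z.1).

(** In other words [S(q, Q) + e G(q)] generates [Feps e]: the perturbation changes the initial
    momentum by [- e dG(q)] and leaves the final one as it is. *)
Lemma FepsP e q p Q P : Feps e (q, p) = (Q, P) <-> p = pm q Q - e *: dG q /\ P = Pm q Q.
Proof.
rewrite /Feps ts_FP /=; split=> -[pE ->]; split => //.
  by rewrite -pE addrK.
by rewrite pE subrK.
Qed.

Lemma Feps_lip e z : lip_at (Feps e) z.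
Proof.
apply: (@lip_at_comp _ _ _ (fun z : phase R d => (z.1, z.2 + e *: dG z.1) : phase R d));
  last exact: ts_F_lip.
have [L [r [L0 r0 H]]] := ts_dG_lip z.1.
exists (1 + `|e| * L), r; split => //; first by rewrite addr_ge0// mulr_ge0.
case: z H => zq zp /= H [q p] /= zr.
have h1 : `|q - zq| <= `|(q, p) - (zq, zp)| by exact: fst_norm_le.
have h2 : `|p - zp| <= `|(q, p) - (zq, zp)| by exact: snd_norm_le.
apply: pair_norm_le => /=.
  by apply: le_trans h1 _; rewrite mulrDl mul1r lerDl mulr_ge0// mulr_ge0.
have -> : p + e *: dG q - (zp + e *: dG zq) = (p - zp) + e *: (dG q - dG zq).
  by rewrite scalerBr opprD addrACA.
apply: le_trans (ler_normD _ _) _; rewrite mulrDl mul1r lerD// normrZ -mulrA ler_wpM2l//.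
apply: le_trans (H _ (le_lt_trans h1 zr)) _.
by rewrite ler_wpM2l.
Qed.

Lemma Feps_per e k q p :
  Feps e (q + intv R k, p) = ((Feps e (q, p)).1 + intv R k, (Feps e (q, p)).2).
Proof. by rewrite /Feps /= ts_dG_per ts_F_per. Qed.

Lemma S_line q Q u v (t : R) : is_derive t 1 (fun t => S (q + t *: u) (Q + t *: v))
  (dot (Pm (q + t *: u) (Q + t *: v)) v - dot (pm (q + t *: u) (Q + t *: v)) u).
Proof.
apply: is_derive_small => e e0.
pose n := `|u| + `|v| + 1; have n0 : 0 < n by rewrite ltr_wpDl// addr_ge0.
have [r r0 H] := ts_S_diff T (q + t *: u) (Q + t *: v) (divr_gt0 e0 n0).
exists (r / n); first by rewrite divr_gt0.
move=> h; rewrite ltr_pdivlMr// => hr.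
have b (w : V) : `|w| <= n -> `|h *: w| < r.
  by move=> wn; rewrite normrZ; apply: le_lt_trans hr; rewrite ler_wpM2l.
have := H (h *: u) (h *: v).
have un : `|u| <= n by rewrite /n -addrA lerDl addr_ge0.
have vn : `|v| <= n by rewrite /n addrC addrA lerDr addr_ge0.
move=> /(_ (b u un) (b v vn)).
rewrite !dotZr -!addrA -!scalerDl !addrA -mulrBr => H1; apply: le_trans H1 _.
rewrite !normrZ -mulrDr -mulrA ler_wpM2l ?(ltW e0)// mulrCA ler_piMr//.
by rewrite mulrC ler_pdivrMr// mul1r /n lerDl.
Qed.

(** The Lipschitz bound on [Pm q] is applied along the segment from [Q] to [Q + h]. An upper bound
    is what is wanted, as it is applied to competitors of a minimizer. *)
Lemma S_right : exists2 B : R, 0 <= B &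
  forall q Q h, S q (Q + h) <= S q Q + dot (Pm q Q) h + B * `|h| ^+ 2.
Proof.
have [B [B0 HP _]] := ts_rate T.
exists (d%:R * B); first by rewrite mulr_ge0.
move=> q Q h; have := mean_value 0 1 (S_line q Q 0 h).
rewrite (min_idPl ler01) (max_idPr ler01) => -[c /andP[c0 c1]].
rewrite !scaler0 !addr0 scale0r addr0 scale1r dot0r subr0 subr0 mulr1 => E.
have -> : S q (Q + h) = S q Q + dot (Pm q Q) h + dot (Pm q (Q + c *: h) - Pm q Q) h.
  by rewrite dotBl -addrA [dot _ _ + (_ - _)]addrC subrK -E addrC subrK.
rewrite lerD2l; apply: le_trans (ler_norm _) _; apply: le_trans (dot_bound _ _) _.
rewrite expr2 mulrA ler_wpM2r// -mulrA ler_wpM2l//.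
apply: le_trans (HP _ _ _) _; rewrite ler_wpM2l// addrC addKr normrZ ger0_norm//.
by rewrite ler_piMl.
Qed.

Lemma S_left : exists2 B : R, 0 <= B &
  forall q Q h, S (q + h) Q <= S q Q - dot (pm q Q) h + B * `|h| ^+ 2.
Proof.
have [B [B0 _ Hp]] := ts_rate T.
exists (d%:R * B); first by rewrite mulr_ge0.
move=> q Q h; have := mean_value 0 1 (S_line q Q h 0).
rewrite (min_idPl ler01) (max_idPr ler01) => -[c /andP[c0 c1]].
rewrite !scaler0 !addr0 scale0r addr0 scale1r dot0r sub0r subr0 mulr1 => E.
have -> : S (q + h) Q = S q Q - dot (pm q Q) h - dot (pm (q + c *: h) Q - pm q Q) h.
  by rewrite dotBl opprB addrA subrK -E addrC subrK.
rewrite lerD2l; apply: le_trans (ler_norm _) _; rewrite normrN.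
apply: le_trans (dot_bound _ _) _.
rewrite expr2 mulrA ler_wpM2r// -mulrA ler_wpM2l//.
apply: le_trans (Hp _ _ _) _; rewrite ler_wpM2l// addrC addKr normrZ ger0_norm//.
by rewrite ler_piMl.
Qed.

(** The derivative of [S(q, q + t v)] in [t] is [Pm q (q + t v)] paired with [v]. Strong positivity
    compares it with the same momentum on the diagonal, which is bounded, and gains
    [alpha * t * dot v v]. *)
Lemma S_coercive : exists c b K : R, [/\ 0 < c, 0 <= b &
  forall q Q, c * `|Q - q| ^+ 2 - b * `|Q - q| - K <= S q Q].
Proof.
have [alpha a0 Hpos] := ts_pos T.
have [M HM] := ts_diag T.
have M0 : 0 <= M by have [+ _] := HM 0; apply: le_trans.
exists (alpha / 2), (d%:R * M), M; split; [by rewrite divr_gt0|by rewrite mulr_ge0|].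
move=> q Q; pose v := Q - q; pose b := d%:R * M * `|v|.
pose f (t : R) := S (q + t *: 0) (q + t *: v) + b * t - alpha / 2 * dot v v * t ^+ 2.
have df (t : R) : is_derive t 1 f (dot (Pm (q + t *: 0) (q + t *: v)) v - dot (pm (q + t *: 0) (q + t *: v)) 0
    + b - alpha * dot v v * t).
  have := S_line q q 0 v t => ?; apply: is_derive_eq.
  by rewrite /GRing.scale /=; field.
have := mean_value 0 1 df.
rewrite (min_idPl ler01) (max_idPr ler01) => -[c /andP[c0 c1]].
rewrite /f !scaler0 !addr0 scale0r scale1r !addr0 dot0r subr0 subr0 mulr1 expr0n expr1n /= !mulr0 !addr0 subr0 !mulr1.
have qv : q + v = Q by rewrite /v subrKC.
rewrite qv => E.
have pos : 0 <= dot (Pm q (q + c *: v)) v + b - alpha * dot v v * c.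
  have h1 : - b <= dot (Pm (q + c *: v) (q + c *: v)) v.
    have [h1 _] := HM (q + c *: v); have := dot_bound (Pm (q + c *: v) (q + c *: v)) v.
    rewrite ler_norml => /andP[h2 _]; apply: le_trans h2; rewrite lerN2 /b ler_wpM2r// ler_wpM2l//.
  have [cz|cn] := eqVneq c 0.
    move: h1; rewrite cz scale0r addr0 mulr0; lra.
  have cp : 0 < c by rewrite lt_def cn c0.
  have := Hpos q (q + c *: v) (q + c *: v).
  have -> : q - (q + c *: v) = - (c *: v) by rewrite opprD addrA subrr add0r.
  rewrite !dotNr dotNl opprK !dotZl !dotZr mulNr lerN2 [alpha * (c * _)]mulrCA ler_pM2l// dotBl.
  move: h1; move: (dot _ v) (dot _ v) (dot v v) => r1 r2 r3; lra.
have [_ h2] := HM q; move: h2; rewrite ler_norml => /andP[h2 _].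
have h3 := dot_ge v.
have h4 : alpha / 2 * `|v| ^+ 2 <= alpha / 2 * dot v v by rewrite ler_wpM2l// divr_ge0// ltW.
rewrite -/v -/b; move: pos; rewrite -E; lra.
Qed.

Lemma gradient_line (f : V -> R) (c : V -> V) q h (t : R) :
  (forall z, gradient_at f z (c z)) ->
  is_derive t 1 (fun t => f (q + t *: h)) (dot (c (q + t *: h)) h).
Proof.
move=> fc; apply: is_derive_small => e e0; pose n := `|h| + 1; have n0 : 0 < n by rewrite ltr_wpDl.
have [s s0 H] := fc (q + t *: h) _ (divr_gt0 e0 n0).
exists (s / n); first by rewrite divr_gt0.
move=> w; rewrite ltr_pdivlMr// => ws.
have := H (w *: h); rewrite normrZ.
have -> : `|w| * `|h| < s by apply: le_lt_trans ws; rewrite ler_wpM2l// lerDl.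
move=> /(_ isT); rewrite dotZr (scalerDl h t w) addrA => H1; apply: le_trans H1 _.
rewrite -mulrA ler_wpM2l ?(ltW e0)// mulrCA ler_piMr//.
by rewrite mulrC ler_pdivrMr// mul1r lerDl.
Qed.

Lemma gradient_lipschitz (f : V -> R) (c : V -> V) (M : R) :
  (forall z, gradient_at f z (c z)) -> (forall z, `|c z| <= M) ->
  forall q q', `|f q - f q'| <= d%:R * M * `|q - q'|.
Proof.
move=> fc cM q q'; have := mean_value 0 1 (gradient_line q' (q - q') ^~ fc).
move=> [t _]; rewrite scale0r addr0 scale1r subrKC subr0 mulr1 => ->.
apply: le_trans (dot_bound _ _) _; rewrite ler_wpM2r// ler_wpM2l//.
Qed.

Lemma G_second q : exists B r : R, [/\ 0 <= B, 0 < r &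
  forall h, `|h| < r -> `|G (q + h) - G q - dot (dG q) h| <= B * `|h| ^+ 2].
Proof.
have [L [r [L0 r0 HL]]] := ts_dG_lip q.
exists (d%:R * L), r; split => //; first by rewrite mulr_ge0.
move=> h hr.
have := mean_value 0 1 (gradient_line q h ^~ (ts_G_grad T)).
rewrite (min_idPl ler01) (max_idPr ler01) => -[c /andP[c0 c1]].
rewrite scale0r addr0 scale1r subr0 mulr1 => ->.
rewrite -dotBl; apply: le_trans (dot_bound _ _) _.
rewrite expr2 mulrA ler_wpM2r// -mulrA ler_wpM2l//.
have cE : q + c *: h - q = c *: h by rewrite addrC addKr.
have ch : `|c *: h| <= `|h| by rewrite normrZ ger0_norm// ler_piMl.
have := HL (q + c *: h); rewrite cE => H; apply: le_trans (H (le_lt_trans ch hr)) _.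
by rewrite ler_wpM2l.
Qed.

Definition action e N x : R := \sum_(i < N) (S (x i) (x i.+1) + e * G (x i)).

Lemma actionE e N x : action e N x = \sum_(i < N) (S (x i) (x i.+1) + e * G (x i)).
Proof. by []. Qed.

Lemma action_split e N M x : action e (N + M) x = action e N x + action e M (fun i => x (N + i)%N).
Proof. by rewrite /action big_split_ord /=; congr (_ + _); apply: eq_bigr => i _; rewrite addnS. Qed.

Lemma actionS e N x : action e N.+1 x = action e N x + (S (x N) (x N.+1) + e * G (x N)).
Proof. by rewrite /action big_ord_recr. Qed.

Lemma eq_action e N x y : (forall i, (i <= N)%N -> x i = y i) -> action e N x = action e N y.
Proof. by move=> xy; apply: eq_bigr => i _; rewrite !xy// ltnW. Qed.

Lemma action_shift e N k x : action e N (fun i => x i + intv R k) = action e N x.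
Proof. by apply: eq_bigr => i _; rewrite ts_S_per ts_G_per. Qed.

Lemma action_eps : exists2 M : R, 0 <= M &
  forall e e' N x, `|action e N x - action e' N x| <= N%:R * M * `|e - e'|.
Proof.
have [M HM] := ts_G_bound T.
have M0 : 0 <= M by apply: le_trans (HM 0).
exists M => // e e' N x.
rewrite /action -sumrB; apply: le_trans (ler_norm_sum _ _ _) _.
apply: (@le_trans _ _ (\sum_(i < N) M * `|e - e'|)); last first.
  by rewrite sumr_const card_ord -mulrA mulr_natl.
apply: ler_sum => i _; rewrite opprD addrACA subrr add0r -mulrBl normrM mulrC.
by rewrite ler_wpM2r.
Qed.

(** The subtracted multiple of the length makes room for the boundary term [U(x_0) - U(x_n)], which
    grows at most linearly. [D] is the same for all [|e| <= E], as needed for limits in [e]. *)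
Lemma action_coercive (E L B : R) N : 0 <= L ->
  exists2 D : R, 0 <= D & forall e x, `|e| <= E ->
    action e N x - L * \sum_(i < N) `|x i.+1 - x i| <= B ->
    forall i, (i < N)%N -> `|x i.+1 - x i| <= D.
Proof.
move=> L0; have [c [b [K [c0 b0 HS]]]] := S_coercive.
have [M HM] := ts_G_bound T.
have M0 : 0 <= M by apply: le_trans (HM 0).
pose k := K + `|E| * M; pose b' := b + L.
(* Completing the square, [- K'] bounds every summand from below. *)
pose K' := b' ^+ 2 / c + `|k|.
have low (t : R) : 0 <= t -> - K' <= c * t ^+ 2 - b' * t - k.
  move=> t0; have h1 : 0 <= (2 * c * t - b') ^+ 2 / (4 * c) by rewrite divr_ge0 ?sqr_ge0// mulr_ge0// ltW.
  have h2 : (2 * c * t - b') ^+ 2 / (4 * c) = c * t ^+ 2 - b' * t + b' ^+ 2 / (4 * c).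
    by have nz := lt0r_neq0 c0; field.
  have h3 : b' ^+ 2 / (4 * c) <= b' ^+ 2 / c.
    by rewrite ler_wpM2l ?sqr_ge0// lef_pV2 ?posrE ?mulr_gt0// ler_peMl ?(ltW c0)// ler1n.
  have h4 := ler_norm k; rewrite /K'; lra.
(* One summand above [Z] makes the total exceed [B] even if all the others equal [- K']. *)
pose Z := `|B| + N%:R * K'.
pose D := (b' + `|k| + `|Z| + 1) / c + 1.
have big (t : R) : D < t -> Z < c * t ^+ 2 - b' * t - k.
  move=> Dt; have kz : 0 <= `|k| + `|Z| by rewrite addr_ge0.
  have b'0 : 0 <= b' by rewrite addr_ge0.
  have t1 : 1 < t.
    apply: le_lt_trans Dt; rewrite lerDr divr_ge0 ?(ltW c0)//; rewrite /=; lra.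
  have h1 : b' + `|k| + `|Z| + 1 < c * t.
    rewrite mulrC -ltr_pdivrMr//; apply: le_lt_trans Dt; rewrite lerDl; lra.
  have h2 : `|k| + `|Z| + 1 <= t * (c * t - b').
    have : `|k| + `|Z| + 1 <= c * t - b' by lra.
    move=> h; apply: le_trans h _; rewrite ler_peMl ?(ltW t1)//; lra.
  have := ler_norm k; have := ler_norm Z; move: h2; rewrite expr2; lra.
have D0 : 0 <= D by rewrite addr_ge0// divr_ge0 ?(ltW c0)// /b' !addr_ge0.
exists D => // e x eE AB i iN; rewrite leNgt; apply/negP => /big hi.
have term j : c * `|x j.+1 - x j| ^+ 2 - b' * `|x j.+1 - x j| - k <=
    S (x j) (x j.+1) + e * G (x j) - L * `|x j.+1 - x j|.
  have h1 := HS (x j) (x j.+1).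
  have h2 : - (`|E| * M) <= e * G (x j).
    have : `|e * G (x j)| <= `|E| * M.
      by rewrite normrM ler_pM//; apply: le_trans eE (ler_norm _).
    by rewrite ler_norml => /andP[].
  rewrite /k /b'; lra.
have := AB; apply/negP; rewrite -ltNge mulr_sumr /action -sumrB.
rewrite (bigD1 (Ordinal iN))//=; apply: le_lt_trans (_ : Z - N%:R * K' < _).
  by rewrite /Z addrK ler_norm.
apply: (@lt_le_trans _ _ (c * `|x i.+1 - x i| ^+ 2 - b' * `|x i.+1 - x i| - k - N%:R * K')).
  by rewrite ltrD2r.
apply: lerD; first exact: term.
have K'0 : 0 <= K' by rewrite addr_ge0// divr_ge0 ?sqr_ge0// ltW.
apply: (@le_trans _ _ (\sum_(j < N | j != Ordinal iN) (- K'))).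
  rewrite sumrN lerN2 sumr_const -[K' *+ _]mulr_natl ler_wpM2r// ler_nat.
  by rewrite -[X in (_ <= X)%N]card_ord max_card.
by apply: ler_sum => j _; apply: le_trans (term j); apply: low.
Qed.

End Variational.

Section ContinuousReal.
Context {R : realType} {X Y : topologicalType}.
Implicit Types f g : X -> R.

Lemma continuousDr f g : continuous f -> continuous g -> continuous (fun x => f x + g x).
Proof. by move=> cf cg x; exact: (cvgD (cf x) (cg x)). Qed.

Lemma continuousNr f : continuous f -> continuous (fun x => - f x).
Proof. by move=> cf x; exact: (cvgN (cf x)). Qed.

Lemma continuous_mulc (k : R) f : continuous f -> continuous (fun x => k * f x).
Proof. by move=> cf x; exact: (cvgM (cvg_cst k) (cf x)). Qed.

Lemma continuous_compr (h : X -> Y) (f : Y -> R) : continuous h -> continuous f ->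
  continuous (fun x => f (h x)).
Proof. by move=> ch cf x; exact: (continuous_comp (ch x) (cf (h x))). Qed.

Lemma continuous_pairr (Z : topologicalType) (f : X -> Y) (g : X -> Z) :
  continuous f -> continuous g -> continuous (fun x => (f x, g x)).
Proof. by move=> cf cg x; exact: (cvg_pair (cf x) (cg x)). Qed.

End ContinuousReal.

Section BallContinuity.
Context {R : realType} {U W : normedModType R}.

Lemma continuous_ball (f : U -> R) (q : U) :
  (forall e : R, 0 < e -> exists2 r : R, 0 < r & forall h, `|h| < r -> `|f (q + h) - f q| < e) ->
  {for q, continuous f}.
Proof.
move=> H; apply/cvgrPdist_lt => e e0; have [r r0 Hr] := H e e0.
apply/nbhs_ballP; exists r => // w; rewrite -ball_normE /= => wr.
by have := Hr (w - q); rewrite subrKC !(distrC _ (f q)) (distrC w) => h; apply: h.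
Qed.

Lemma continuous_ball2 (f : U -> W -> R) q Q :
  (forall e : R, 0 < e -> exists2 r : R, 0 < r & forall u v, `|u| < r -> `|v| < r ->
    `|f (q + u) (Q + v) - f q Q| < e) ->
  {for (q, Q), continuous (fun z : U * W => f z.1 z.2)}.
Proof.
move=> H; apply/cvgrPdist_lt => e e0; have [r r0 Hr] := H e e0.
exists (ball q r, ball Q r); first by split; exact: nbhsx_ballx.
move=> [w w'] /=; rewrite -!ball_normE /= => -[h1 h2].
rewrite distrC in h1; rewrite distrC in h2.
by have := Hr _ _ h1 h2; rewrite !subrKC distrC.
Qed.

End BallContinuity.

Lemma gradient_continuous {R : realType} {d : nat} (f : 'rV[R]_d -> R) q c :
  gradient_at f q c -> {for q, continuous f}.
Proof.
move=> fc; apply: continuous_ball => e e0; have [r r0 H] := fc 1 ltr01.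
pose B := d%:R * `|c| + 1; have B0 : 0 < B by rewrite ltr_wpDl// mulr_ge0.
exists (Num.min r (e / B)); first by rewrite lt_min r0 divr_gt0.
move=> h; rewrite lt_min ltr_pdivlMr// => /andP[hr he].
have h1 := H h hr; have h2 := dot_bound c h.
rewrite -[X in `|X|](subrK (dot c h)).
apply: le_lt_trans (ler_normD _ _) _; apply: le_lt_trans (lerD h1 h2) _.
by rewrite -mulrDl addrC mulrC [_ * B]mulrC -/B mulrC.
Qed.

(** * Minimization of the action *)

Section Minimization.
Context {R : realType} {d : nat} (T : twist_system R d).
Local Notation V := 'rV[R]_d.
Local Notation conf := {ptws nat -> V}.
Local Notation S := (ts_S T).
Local Notation G := (ts_G T).
Local Notation dG := (ts_dG T).
Local Notation pm := (ts_p T).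
Local Notation Pm := (ts_P T).
Implicit Types (q Q p P h u v : V) (x y : nat -> V) (e : R) (k m : 'rV[int]_d).

Lemma S_continuous : continuous (fun z : V * V => S z.1 z.2).
Proof.
move=> -[q Q]; apply: continuous_ball2 => e e0.
have [r r0 H] := ts_S_diff T q Q ltr01.
pose B := d%:R * `|Pm q Q| + d%:R * `|pm q Q| + 2.
have B0 : 0 < B by rewrite ltr_wpDl// addr_ge0// mulr_ge0.
exists (Num.min r (e / (2 * B))); first by rewrite lt_min r0 divr_gt0// mulr_gt0.
move=> u v; rewrite !lt_min => /andP[u1 u2] /andP[v1 v2].
have h1 := H u v u1 v1.
have h2 := dot_bound (Pm q Q) v; have h3 := dot_bound (pm q Q) u.
have -> : S (q + u) (Q + v) - S q Q = (S (q + u) (Q + v) - S q Q -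
  (dot (Pm q Q) v - dot (pm q Q) u)) + (dot (Pm q Q) v - dot (pm q Q) u) by rewrite subrK.
apply: le_lt_trans (ler_normD _ _) _.
apply: le_lt_trans (lerD h1 (le_trans (ler_normB _ _) (lerD h2 h3))) _.
have Pn : d%:R * `|Pm q Q| + 1 <= B.
  have := mulr_ge0 (ler0n R d) (normr_ge0 (pm q Q)); rewrite /B; clear; lra.
have pn : d%:R * `|pm q Q| + 1 <= B.
  have := mulr_ge0 (ler0n R d) (normr_ge0 (Pm q Q)); rewrite /B; clear; lra.
move: u2 v2; rewrite !ltr_pdivlMr ?mulr_gt0// => u2 v2.
have := ler_wpM2r (normr_ge0 v) Pn; have := ler_wpM2r (normr_ge0 u) pn.
move: u2 v2; rewrite mul1r; clear; lra.
Qed.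

Lemma G_continuous : continuous G.
Proof. by move=> q; exact: gradient_continuous (ts_G_grad T q). Qed.

Lemma conf_eval_continuous (i : nat) : continuous (fun x : conf => x i).
Proof. exact: (@proj_continuous _ (fun=> V) i). Qed.

Lemma action_continuous e N : continuous (fun x : conf => action T e N x).
Proof.
elim: N => [|N IH].
  rewrite (_ : (fun x => _) = fun=> 0); first exact: cst_continuous.
  by apply/funext => x; rewrite /action big_ord0.
rewrite (_ : (fun x => _) = (fun x => action T e N x + (S (x N) (x N.+1) + e * G (x N)))); last first.
  by apply/funext => x; rewrite actionS.
apply: continuousDr; first exact: IH.
apply: continuousDr.
  apply: (@continuous_compr _ _ _ (fun x : conf => (x N, x N.+1)) (fun z : V * V => S z.1 z.2));
    last exact: S_continuous.
  by apply: continuous_pairr; exact: conf_eval_continuous.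
apply: continuous_mulc.
apply: (@continuous_compr _ _ _ (fun x : conf => x N) G); last exact: G_continuous.
exact: conf_eval_continuous.
Qed.

Lemma closed_ball_compact (rho : R) : compact [set v : V | `|v| <= rho].
Proof.
apply: bounded_closed_compact.
  by exists rho; split; [exact: num_real|move=> M rM v /= /le_trans; apply; exact: ltW].
apply: (@closed_comp _ _ (fun v : V => `|v|) [set t : R | t <= rho]); last exact: closed_le.
by move=> v _; exact: norm_continuous.
Qed.

(** Configurations are infinite sequences with the product topology, so that for every length
    compactness is Tychonoff's theorem. *)
Definition config_box (rho : R) := [set x : conf | forall i, `|x i| <= rho].

Lemma config_box_compact (rho : R) : compact (config_box rho).
Proof. exact: (@tychonoff nat (fun=> V) (fun=> _) (fun=> @closed_ball_compact rho)). Qed.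

Lemma chain_bound x N (D : R) : 0 <= D -> (forall i, (i < N)%N -> `|x i.+1 - x i| <= D) ->
  forall i, (i <= N)%N -> `|x i| <= `|x 0%N| + N%:R * D.
Proof.
move=> D0 H; have main i : (i <= N)%N -> `|x i| <= `|x 0%N| + i%:R * D.
  elim: i => [|i IH] iN; first by rewrite mul0r addr0.
  have := ler_normD (x i.+1 - x i) (x i); rewrite subrK => h; apply: le_trans h _.
  by rewrite -natr1 mulrDl mul1r addrA [leRHS]addrC; apply: lerD; [exact: H|exact: IH (ltnW iN)].
by move=> i iN; apply: le_trans (main i iN) _; rewrite lerD2l ler_wpM2r// ler_nat.
Qed.

(** Coercivity confines the competitors that do better than [x0] to a compact box, once the points
    past [N], on which nothing depends, are set to 0. [W] stands for a boundary term and [Z] for a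
    closed constraint that bounds the first point. *)
Lemma minimize e N (L rho0 : R) (W : conf -> R) (Z : set (nat -> V)) :
  0 <= L -> continuous W -> closed (Z : set conf) ->
  (forall x y, (forall i, (i <= N)%N -> x i = y i) -> Z x -> Z y /\ W y = W x) ->
  (forall x, Z x -> `|x 0%N| <= rho0) ->
  (forall x, - (L * \sum_(i < N) `|x i.+1 - x i|) <= W x) ->
  Z !=set0 ->
  exists x, Z x /\ forall y, Z y -> action T e N x + W x <= action T e N y + W y.
Proof.
move=> L0 cW cZ ZW Z0 Wlow [x0 Zx0].
pose B := action T e N x0 + W x0.
have [D D0 HD] := action_coercive T `|e| B N L0.
pose rho := `|rho0| + N%:R * D.
have rho_ge0 : 0 <= rho by rewrite addr_ge0// mulr_ge0.
pose tr x (i : nat) := if (i <= N)%N then x i else 0.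
have trE x i : (i <= N)%N -> tr x i = x i by rewrite /tr => ->.
have trZ x : Z x -> Z (tr x) /\ W (tr x) = W x by apply: ZW => i iN; rewrite trE.
have trA x : action T e N (tr x) = action T e N x.
  by apply: eq_action => i iN; rewrite trE.
have low y : Z y -> action T e N y + W y <= B -> config_box rho (tr y).
  move=> Zy yB i; rewrite /tr; case: ifP => [iN|_]; last by rewrite normr0.
  apply: le_trans (@chain_bound y N D D0 _ i iN) _; last first.
    by rewrite lerD2r; apply: le_trans (Z0 _ Zy) (ler_norm _).
  apply: (HD e y (lexx _)); apply: le_trans yB; rewrite lerD2l; exact: Wlow.
pose K := config_box rho `&` Z.
have cK : compact K by apply: compact_closedI => //; exact: config_box_compact.
have K0 : K !=set0.
  by exists (tr x0); split; [exact: low|exact: (trZ _ Zx0).1].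
have cf : {within K, continuous (fun x => action T e N x + W x)}.
  by apply: continuous_subspaceT; apply: continuousDr; [exact: action_continuous|exact: cW].
have [x xK xmin] := compact_EVT_min K0 cK cf.
move: xK; rewrite inE => -[_ Zx]; exists x; split => // y Zy.
have [yB|By] := leP (action T e N y + W y) B.
  have [Zty Wty] := trZ _ Zy.
  rewrite -(trA y) -Wty; apply: xmin; rewrite inE; split => //; exact: low.
apply: le_trans _ (ltW By); have [Ztx Wtx] := trZ _ Zx0.
rewrite /B -(trA x0) -Wtx; apply: xmin; rewrite inE; split => //; exact: low.
Qed.

Lemma closed_eval (i : nat) q : closed [set x : conf | x i = q].
Proof.
apply: (@closed_comp _ _ (fun x : conf => x i) [set q]); last first.
  by apply: accessible_closed_set1; exact/hausdorff_accessible/norm_hausdorff.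
by move=> v _; exact: conf_eval_continuous.
Qed.

Lemma min_fixed_ends e N q Q : (0 < N)%N -> exists x, [/\ x 0%N = q, x N = Q &
  forall y, y 0%N = q -> y N = Q -> action T e N x <= action T e N y].
Proof.
move=> N0.
have [||||||x [[x0 xN] xmin]] := @minimize e N 0 `|q| (fun=> 0)
    ([set x : conf | x 0%N = q] `&` [set x | x N = Q]) (lexx 0).
- exact: cst_continuous.
- by apply: closedI; exact: closed_eval.
- by move=> x y xy [/= x0 xN]; split => //; split => /=; rewrite -xy.
- by move=> x [/= -> _].
- by move=> x; rewrite mul0r oppr0.
- exists (fun i => if i == 0%N then q else Q); split => //=.
  by rewrite gtn_eqF.
- exists x; split => // y y0 yN; have := xmin y (conj y0 yN).
  by rewrite !addr0.
Qed.

(** The momentum with which the orbit of [Feps e] through [x i] and [x i.+1] leaves [x i];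
    [p_in x i] is the momentum with which the step from [x i.-1] arrives. Equality of the two at
    interior points is the discrete Euler-Lagrange equation. *)
Definition p_out e x i := pm (x i) (x i.+1) - e *: dG (x i).

Lemma p_outE e x i : p_out e x i = pm (x i) (x i.+1) - e *: dG (x i).
Proof. by []. Qed.

Definition p_in x i := Pm (x i.-1) (x i).

(** The linear part is summed over steps and not regrouped by points: induction on [N] then adds one
    term, and along an orbit the sum telescopes. *)
Lemma first_variation e N x (eta : R) : 0 < eta -> exists2 r : R, 0 < r &
  forall y, (forall i, (i <= N)%N -> `|y i - x i| < r) ->
  `|action T e N y - action T e N x -
    \sum_(i < N) (dot (p_in x i.+1) (y i.+1 - x i.+1) - dot (p_out e x i) (y i - x i))|
  <= eta * \sum_(i < N.+1) `|y i - x i|.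
Proof.
elim: N eta => [|N IH] eta eta0.
  exists 1 => // y _; rewrite /action !big_ord0 !subrr normr0.
  by apply: mulr_ge0; [exact: ltW|apply: sumr_ge0 => i _; exact: normr_ge0].
have e4 : 0 < eta / 4 by rewrite divr_gt0.
have [r1 r10 H1] := IH _ (divr_gt0 eta0 (ltr0n _ 2)).
have [r2 r20 H2] := ts_S_diff T (x N) (x N.+1) e4.
have e1 : 0 < `|e| + 1 by rewrite ltr_wpDl.
have [r3 r30 H3] := ts_G_grad T (x N) (divr_gt0 e4 e1).
exists (Num.min r1 (Num.min r2 r3)); first by rewrite !lt_min r10 r20.
move=> y yr.
have yr' i : (i <= N.+1)%N -> [/\ `|y i - x i| < r1, `|y i - x i| < r2 & `|y i - x i| < r3].
  by move=> /yr; rewrite !lt_min => /andP[-> /andP[-> ->]].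
have h1 : `|action T e N y - action T e N x -
    \sum_(i < N) (dot (p_in x i.+1) (y i.+1 - x i.+1) - dot (p_out e x i) (y i - x i))|
    <= eta / 2 * \sum_(i < N.+1) `|y i - x i|.
  by apply: H1 => i iN; have [] := yr' i (leqW iN).
have [_ b2 b3] := yr' N (leqnSn N); have [_ c2 _] := yr' N.+1 (leqnn _).
have h2 := H2 _ _ b2 c2; have h3 := H3 _ b3; rewrite !subrKC in h2 h3.
rewrite !actionS big_ord_recr [\sum_(i < N.+2) _]big_ord_recr /=.
set A := \sum_(i < N) _ in h1 *; set B := \sum_(i < N.+1) _ in h1 *.
set u := y N - x N in h2 h3 *; set v := y N.+1 - x N.+1 in h2 *.
have uB : `|u| <= B by rewrite /B big_ord_recr /= lerDr sumr_ge0.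
rewrite /p_out dotBl dotZl -/(p_in x N.+1) in h2 *; rewrite [p_in x N.+1]/(Pm _ _) /= in h2 *.
have -> : action T e N y + (S (y N) (y N.+1) + e * G (y N)) -
   (action T e N x + (S (x N) (x N.+1) + e * G (x N))) -
   (A + (dot (Pm (x N) (x N.+1)) v - (dot (pm (x N) (x N.+1)) u - e * dot (dG (x N)) u))) =
   (action T e N y - action T e N x - A) +
   (S (y N) (y N.+1) - S (x N) (x N.+1) - (dot (Pm (x N) (x N.+1)) v - dot (pm (x N) (x N.+1)) u)) +
   e * (G (y N) - G (x N) - dot (dG (x N)) u) by ring.
have h4 : `|e * (G (y N) - G (x N) - dot (dG (x N)) u)| <= eta / 4 * `|u|.
  rewrite normrM; apply: le_trans (ler_wpM2l (normr_ge0 e) h3) _.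
  rewrite mulrA ler_wpM2r//.
  by rewrite mulrA ler_pdivrMr// mulrC ler_pM2l// lerDl.
apply: le_trans (ler_normD _ _) _; apply: le_trans (lerD (ler_normD _ _) h4) _.
apply: le_trans (lerD (lerD h1 h2) (lexx _)) _.
rewrite -/v mulrDr.
have := mulr_ge0 (ltW eta0) (normr_ge0 v); have := ler_wpM2l (ltW eta0) uB.
clear; lra.
Qed.

Lemma sum_pick N (a : nat -> R) j : (j < N)%N -> \sum_(i < N) (if i == j :> nat then a i else 0) = a j.
Proof.
move=> jN; rewrite (bigD1 (Ordinal jN))//= eqxx big1 ?addr0// => i.
by rewrite -val_eqE /= => /negbTE ->.
Qed.

Definition upd x j h (i : nat) := if i == j then x i + h else x i.

Lemma updE x j h i : upd x j h i - x i = if i == j then h else 0.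
Proof. by rewrite /upd; case: ifP => _; [rewrite addrC addKr|rewrite subrr]. Qed.

(** Only the moved point contributes. The conditionals record that nothing arrives at the first
    point and nothing leaves the last one. *)
Lemma upd_variation e N x j (eta : R) : (j <= N)%N -> 0 < eta -> exists2 r : R, 0 < r &
  forall h, `|h| < r ->
  `|action T e N (upd x j h) - action T e N x -
    (dot (if (0 < j)%N then p_in x j else 0) h - dot (if (j < N)%N then p_out e x j else 0) h)|
  <= eta * `|h|.
Proof.
move=> jN eta0; have [r r0 H] := first_variation e N x eta0.
exists r => // h hr; have := H (upd x j h).
have -> : \sum_(i < N.+1) `|upd x j h i - x i| = `|h|.
  rewrite (eq_bigr (fun i : 'I_N.+1 => if i == j :> nat then `|h| else 0)); last first.
    by move=> i _; rewrite updE; case: ifP; rewrite ?normr0.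
  by rewrite (@sum_pick N.+1 (fun=> `|h|)).
rewrite sumrB.
have -> : \sum_(i < N) dot (p_out e x i) (upd x j h i - x i) =
    dot (if (j < N)%N then p_out e x j else 0) h.
  rewrite (eq_bigr (fun i : 'I_N => if i == j :> nat then dot (p_out e x i) h else 0)); last first.
    by move=> i _; rewrite updE; case: ifP; rewrite ?dot0r.
  case: ifP => jN'; first by rewrite (@sum_pick N (fun i => dot (p_out e x i) h)).
  rewrite dot0l big1// => i _; case: eqP => // ij; by rewrite -ij ltn_ord in jN'.
have -> : \sum_(i < N) dot (p_in x i.+1) (upd x j h i.+1 - x i.+1) =
    dot (if (0 < j)%N then p_in x j else 0) h.
  case: j jN => [|j] jN.
    by rewrite /= dot0l big1// => i _; rewrite updE dot0r.
  rewrite (eq_bigr (fun i : 'I_N => if i == j :> nat then dot (p_in x i.+1) h else 0)); last first.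
    by move=> i _; rewrite updE eqSS; case: ifP; rewrite ?dot0r.
  by rewrite (@sum_pick N (fun i => dot (p_in x i.+1) h)).
apply => i _; rewrite updE; case: ifP => // _; by rewrite normr0.
Qed.

Lemma orbit_of_EL e N x : (forall j, (0 < j < N)%N -> p_in x j = p_out e x j) ->
  (forall i, (i < N)%N -> iter i (Feps T e) (x 0%N, p_out e x 0%N) = (x i, p_out e x i)) /\
  ((0 < N)%N -> iter N (Feps T e) (x 0%N, p_out e x 0%N) = (x N, p_in x N)).
Proof.
move=> EL; have step i : Feps T e (x i, p_out e x i) = (x i.+1, p_in x i.+1).
  by apply/FepsP; split.
have H i : (i < N)%N -> iter i (Feps T e) (x 0%N, p_out e x 0%N) = (x i, p_out e x i).
  elim: i => // i IH iN; rewrite iterS IH ?(ltnW iN)// step EL//.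
split => //; case: N EL H => // N EL H _.
by rewrite iterS H// step.
Qed.

Lemma EL_of_orbit e (z : phase R d) : let x i := (iter i (Feps T e) z).1 in
  forall i, p_out e x i = (iter i (Feps T e) z).2 /\ p_in x i.+1 = (iter i.+1 (Feps T e) z).2.
Proof.
move=> x i; have := FepsP T e (x i) (iter i (Feps T e) z).2 (x i.+1) (iter i.+1 (Feps T e) z).2.
rewrite -!surjective_pairing => -[/(_ erefl)[-> ->] _].
by [].
Qed.

End Minimization.

(** * Calibrated parameters *)

Section Calibration.
Context {R : realType} {d : nat} (T : twist_system R d) (m : 'rV[int]_d) (n : nat).
Context (n_gt0 : (0 < n)%N).
Local Notation V := 'rV[R]_d.
Local Notation conf := {ptws nat -> V}.
Local Notation S := (ts_S T).
Local Notation G := (ts_G T).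
Local Notation dG := (ts_dG T).
Local Notation pm := (ts_p T).
Local Notation Pm := (ts_P T).
Local Notation mv := (intv R m).
Local Notation action := (action T).
Local Notation Fe := (Feps T).
Local Notation p_in := (p_in T).
Local Notation p_out := (p_out T).
Implicit Types (q Q p P h u v : V) (x y : nat -> V) (e a : R).

(** Stated on configurations, without a graph, so that it passes to limits in [e]. The bound on
    doubled configurations implies that [a] is the minimum for length [n], by appending a minimizer
    ([calibrated_le]). *)
Definition calibrated e a :=
  (forall q, exists x, [/\ x 0%N = q, x n = q + mv & action e n x = a]) /\
  (forall x, x (n + n)%N = x 0%N + mv + mv -> 2 * a <= action e (n + n) x).

Definition cat_config N x y (i : nat) := if (i < N)%N then x i else y (i - N)%N.

Lemma action_cat e N M x y : y 0%N = x N ->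
  action e (N + M) (cat_config N x y) = action e N x + action e M y.
Proof.
move=> yx; rewrite action_split; congr (_ + _).
  apply: eq_action => i iN; rewrite /cat_config; case: ltngtP iN => // -> _.
  by rewrite subnn.
by apply: eq_action => i iM; rewrite /cat_config ltnNge leq_addr /= addKn.
Qed.

Lemma cat_config_end N M x y : cat_config N x y (N + M) = y M.
Proof. by rewrite /cat_config ltnNge leq_addr /= addKn. Qed.

Lemma cat_config_start N x y : (0 < N)%N -> cat_config N x y 0%N = x 0%N.
Proof. by rewrite /cat_config => ->. Qed.

Lemma calibrated_le e a x : calibrated e a -> x n = x 0%N + mv -> a <= action e n x.
Proof.
move=> [Hmin H2] xn; have [y [y0 yn ya]] := Hmin (x n).
have := H2 (cat_config n x y); rewrite cat_config_end cat_config_start// yn -xn.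
move=> /(_ erefl); rewrite action_cat// ya; lra.
Qed.

Lemma lip_at_uniform (U W : normedModType R) (g : nat -> U -> W) (z : U) :
  (forall i, lip_at (g i) z) -> forall N, exists L r : R, [/\ 0 <= L, 0 < r &
    forall i w, (i <= N)%N -> `|w - z| < r -> `|g i w - g i z| <= L * `|w - z|].
Proof.
move=> H; elim=> [|N [L [r [L0 r0 HL]]]].
  have [L [r [L0 r0 HL]]] := H 0%N; exists L, r; split => // i w.
  by rewrite leqn0 => /eqP ->; exact: HL.
have [L' [r' [L'0 r'0 HL']]] := H N.+1.
exists (L + L'), (Num.min r r'); split; [exact: addr_ge0|by rewrite lt_min r0|].
move=> i w; rewrite leq_eqVlt lt_min => /orP[/eqP ->|iN] /andP[wr wr'].
  by apply: le_trans (HL' w wr') _; rewrite ler_wpM2r// lerDr.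
by apply: le_trans (HL i w iN wr) _; rewrite ler_wpM2r// lerDl.
Qed.

Lemma iter_Feps_lip e i z : lip_at (iter i (Fe e)) z.
Proof.
elim: i => [|i IH]; last by apply: lip_at_comp IH _; exact: Feps_lip.
by exists 1, 1; split => // w _; rewrite mul1r.
Qed.

Lemma fst_lip (z : phase R d) : lip_at (fun z : phase R d => z.1) z.
Proof. by exists 1, 1; split => // -[w1 w2] _; rewrite mul1r; case: z => z1 z2; exact: fst_norm_le. Qed.

(** Along an orbit the arriving and leaving momenta agree, so the first variation telescopes to its
    two ends. *)
Lemma orbit_variation e (z : phase R d) (x := fun i => (iter i (Fe e) z).1) (eta : R) : 0 < eta ->
  exists2 r : R, 0 < r & forall y, (forall i, (i <= n)%N -> `|y i - x i| < r) ->
  `|action e n y - action e n x - (dot (iter n (Fe e) z).2 (y n - x n) - dot z.2 (y 0%N - x 0%N))|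
  <= eta * \sum_(i < n.+1) `|y i - x i|.
Proof.
move=> eta0; have [r r0 H] := first_variation T e n x eta0.
exists r => // y /H; rewrite (eq_bigr (fun i : 'I_n =>
   (fun i => dot (iter i (Fe e) z).2 (y i - x i)) i.+1 -
   (fun i => dot (iter i (Fe e) z).2 (y i - x i)) i)); last first.
  by move=> i _; have [-> ->] := EL_of_orbit T e z i.
by rewrite -(big_mkord xpredT (fun i => dot (iter i.+1 (Fe e) z).2 (y i.+1 - x i.+1) -
  dot (iter i (Fe e) z).2 (y i - x i))) (telescope_sumr (fun i => dot (iter i (Fe e) z).2 (y i - x i))).
Qed.

Lemma EL_of_min e N x : (forall y, y 0%N = x 0%N -> y N = x N -> action e N x <= action e N y) ->
  forall j, (0 < j < N)%N -> p_in x j = p_out e x j.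
Proof.
move=> xmin j /andP[j0 jN]; apply/eqP; rewrite -subr_eq0; apply/eqP/dot_nonneg_small => eta eta0.
have [r r0 H] := upd_variation T e x (ltnW jN) eta0.
exists r => // h hr; have := H h hr; rewrite j0 jN -dotBl ler_norml => /andP[_ h1].
have u0 : upd x j h 0%N = x 0%N by rewrite /upd ltn_eqF.
have uN : upd x j h N = x N by rewrite /upd gtn_eqF.
by have := xmin (upd x j h) u0 uN; move: h1; clear; lra.
Qed.

(** The Lagrangian condition is replaced by a potential [U], and the Lipschitz condition by a local
    one: a form that limits of interpolated graphs can be shown to satisfy. *)
Definition torus_graph e (gamma : V -> V) (U : V -> R) :=
  [/\ forall q, gradient_at U q (gamma q),
      forall k q, gamma (q + intv R k) = gamma q,
      exists M : R, forall q, `|gamma q| <= M,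
      forall q, lip_at gamma q &
      forall q, iter n (Fe e) (q, gamma q) = (q + mv, gamma q)].

Lemma gradient_zero_const (f : V -> R) : (forall q, gradient_at f q 0) -> forall q q', f q = f q'.
Proof.
move=> H q q'; apply/eqP; rewrite -subr_eq0 -normr_le0.
have := @gradient_lipschitz R d f (fun=> 0) 0 H _ q q'; rewrite mulr0 mul0r; apply.
by move=> z; rewrite normr0.
Qed.

Lemma round_rv q : exists k : 'rV[int]_d, `|q + intv R k| <= 1.
Proof.
exists (\row_i - Num.floor (q 0 i)); apply: rv_norm_le => // i.
rewrite !mxE rmorphN /= ger0_norm ?subr_ge0 ?floor_le_tmp ?ge_floor//.
by rewrite lerBlDl ltW// -[X in _ + X]/(1%:~R) -intrD floorD1_gt.
Qed.

(** When [q] moves by [h], both ends of the orbit move by [h], and both end momenta are [gamma q]: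
    the two terms of the first variation cancel. *)
Lemma torus_action_const e gamma U : torus_graph e gamma U ->
  forall q q', action e n (fun i => (iter i (Fe e) (q, gamma q)).1) =
               action e n (fun i => (iter i (Fe e) (q', gamma q')).1).
Proof.
move=> [gU gper gM glip gn].
pose x q i := (iter i (Fe e) (q, gamma q)).1.
apply: (@gradient_zero_const (fun q => action e n (x q))) => q eta eta0.
have xlip i : lip_at (fun q => x q i) q.
  apply: (@lip_at_comp _ _ _ _ (fun q => iter i (Fe e) (q, gamma q)) (fun z => z.1)); last exact: fst_lip.
  apply: (@lip_at_comp _ _ _ _ (fun q => (q, gamma q) : phase R d)); last exact: iter_Feps_lip.
  have [L [r [L0 r0 H]]] := glip q; exists (1 + L), r; split => //; first exact: addr_ge0.
  move=> w wr; apply: pair_norm_le => /=.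
    by rewrite mulrDl mul1r lerDl mulr_ge0.
  by rewrite mulrDl mul1r; apply: le_trans (H w wr) _; rewrite lerDr.
have [L [r [L0 r0 HL]]] := lip_at_uniform xlip n.
have c0 : 0 < n.+1%:R * L + 1 by rewrite ltr_wpDl// mulr_ge0.
have [s s0 Hs] := orbit_variation e (q, gamma q) (divr_gt0 eta0 c0).
have L1 : 0 < L + 1 by rewrite ltr_wpDl.
exists (Num.min r (s / (L + 1))); first by rewrite lt_min r0 divr_gt0.
move=> h; rewrite lt_min ltr_pdivlMr// => /andP[hr hs].
have hE : q + h - q = h by rewrite addrC addKr.
have xh i : (i <= n)%N -> `|x (q + h) i - x q i| <= L * `|h|.
  by move=> iN; have := HL i (q + h) iN; rewrite hE; exact.
have := Hs (x (q + h)); rewrite dot0l subr0 gn /=.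
have -> : x (q + h) n = q + h + mv by rewrite /x gn.
have -> : q + h + mv - (q + mv) = h by rewrite opprD addrACA subrr addr0.
rewrite -[x (q + h) 0%N]/(q + h) hE subrr subr0 => H.
apply: le_trans (H _) _.
  move=> i iN; apply: le_lt_trans (xh i iN) _; apply: le_lt_trans hs.
  by rewrite mulrC ler_wpM2l// lerDl.
have : \sum_(i < n.+1) `|x (q + h) i - x q i| <= n.+1%:R * L * `|h|.
  apply: (@le_trans _ _ (\sum_(i < n.+1) L * `|h|)).
    by apply: ler_sum => i _; apply: xh; rewrite -ltnS.
  by rewrite sumr_const card_ord -mulrA mulr_natl.
move=> h1; apply: le_trans (ler_wpM2l _ h1) _; first by rewrite divr_ge0// ltW.
rewrite mulrA ler_wpM2r// mulrAC ler_pdivrMr// ler_pM2l// lerDl//.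
Qed.

(** The ends of the minimizer of the corrected action are free, so the first-order condition also
    holds at [x_0] and puts the initial momentum on the graph. The minimum is therefore [a - kap], a
    lower bound for all configurations that is added over the two halves of a doubled one. *)
Lemma torus_calibrated e gamma U : torus_graph e gamma U -> exists a, calibrated e a /\
  forall q, action e n (fun i => (iter i (Fe e) (q, gamma q)).1) = a.
Proof.
move=> tg; have [gU gper [M gM] glip gn] := tg.
have M0 : 0 <= M by apply: le_trans (gM 0).
have Ulip := gradient_lipschitz gU gM.
pose x q i := (iter i (Fe e) (q, gamma q)).1.
pose a := action e n (x 0).
have xa q : action e n (x q) = a by exact: torus_action_const tg _ _.
have xn q : x q n = q + mv by rewrite /x gn.
(* [U] may fail to be periodic when the graph has nonzero mean, but its increment over an integer
   vector does not depend on the base point. *)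
have Ushift k q : U (q + intv R k) - U q = U (intv R k) - U 0.
  have := @gradient_zero_const (fun q => U (q + intv R k) - U q).
  move=> H; rewrite (H _ q 0) ?add0r// => z eta eta0.
  have e2 : 0 < eta / 2 by rewrite divr_gt0.
  have [r1 r10 H1] := gU (z + intv R k) _ e2; have [r2 r20 H2] := gU z _ e2.
  exists (Num.min r1 r2); first by rewrite lt_min r10.
  move=> h; rewrite lt_min => /andP[/H1 h1 /H2 h2]; rewrite dot0l subr0.
  rewrite gper in h1; rewrite (addrAC z h).
  have -> : U (z + intv R k + h) - U (z + h) - (U (z + intv R k) - U z) =
     (U (z + intv R k + h) - U (z + intv R k) - dot (gamma z) h) -
     (U (z + h) - U z - dot (gamma z) h) by ring.
  by apply: le_trans (ler_normB _ _) _; move: h1 h2; clear; lra.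
pose kap := U mv - U 0.
pose W (y : conf) : R := U (y 0%N) - U (y n).
have Ucont : continuous U by move=> q; exact: gradient_continuous (gU q).
have cU i : continuous (fun y : conf => U (y i)).
  by move=> y; exact: (continuous_comp (@conf_eval_continuous R d i y) (Ucont _)).
have [|||||||y [_ ymin]] := @minimize R d T e n (d%:R * M) 1 W [set y : conf | `|y 0%N| <= 1].
- exact: mulr_ge0.
- by apply: continuousDr; [exact: cU|apply: continuousNr; exact: cU].
- apply: (@closed_comp _ _ (fun y : conf => y 0%N) [set v : V | `|v| <= 1]).
    by move=> v _; exact: conf_eval_continuous.
  by apply: compact_closed; [exact: norm_hausdorff|exact: closed_ball_compact].
- by move=> y y' yy' /= y1; rewrite -(yy' 0%N)//; split => //; rewrite /W !yy'.
- by [].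
- move=> y; rewrite lerNl /W opprB; apply: le_trans (ler_norm _) _.
  apply: le_trans (Ulip _ _) _; rewrite ler_wpM2l ?mulr_ge0//.
  have -> : y n - y 0%N = \sum_(i < n) (y i.+1 - y i).
    by rewrite -(big_mkord xpredT (fun i => y i.+1 - y i)) telescope_sumr.
  exact: ler_norm_sum.
- by exists (fun=> 0); rewrite /= normr0.
(* Integer translations change neither the action nor [W], so the constraint [|y 0| <= 1] costs
   nothing. *)
have {}ymin y' : action e n y + W y <= action e n y' + W y'.
  have [k k1] := round_rv (y' 0%N).
  have := ymin (fun i => y' i + intv R k) k1; rewrite action_shift => h.
  apply: le_trans h _; rewrite lerD2l /W.
  have := Ushift k (y' 0%N); have := Ushift k (y' n); clear; lra.
(* At [j = 0] the derivative of the boundary term takes the place of the arriving momentum. *)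
have EL j : (j < n)%N -> (if (0 < j)%N then p_in y j else gamma (y 0%N)) = p_out e y j.
  move=> jn; apply/eqP; rewrite -subr_eq0; apply/eqP/dot_nonneg_small => eta eta0.
  have e2 : 0 < eta / 2 by rewrite divr_gt0.
  have [r1 r10 H1] := upd_variation T e y (ltnW jn) e2.
  have [r2 r20 H2] := gU (y 0%N) _ e2.
  exists (Num.min r1 r2); first by rewrite lt_min r10.
  move=> h; rewrite lt_min => /andP[/H1 h1 /H2 h2].
  have := ymin (upd y j h); rewrite /W.
  have -> : upd y j h n = y n by rewrite /upd gtn_eqF.
  rewrite jn in h1; case: j jn h1 {H1} => [|j] jn h1.
    have -> : upd y 0 h 0%N = y 0%N + h by [].
    move: h1 h2; rewrite /= dot0l sub0r (dotBl (gamma _)) !ler_norml => /andP[_ h1] /andP[_ h2].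
    by move: h1 h2; clear; lra.
  have -> : upd y j.+1 h 0%N = y 0%N by [].
  move: h1; rewrite /= (dotBl (p_in y _)) ler_norml => /andP[_ h1].
  have := mulr_ge0 (ltW e2) (normr_ge0 h); move: h1; clear; lra.
have [orb1 orb2] := @orbit_of_EL R d T e n y (fun j => ltac:(move=> /andP[j0 jn]; have := EL j jn; rewrite j0; exact)).
have out0 : p_out e y 0 = gamma (y 0%N) by rewrite -(EL 0%N).
have yx i : (i <= n)%N -> y i = x (y 0%N) i.
  rewrite leq_eqVlt => /orP[/eqP ->|iN]; rewrite /x -out0; first by rewrite orb2.
  by rewrite orb1.
have ya : action e n y = a by rewrite -(xa (y 0%N)); exact: eq_action.
have Wy : W y = - kap.
  rewrite /W (yx n)// xn /kap -(Ushift m (y 0%N)) -/mv; clear; lra.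
exists a; split; last exact: xa.
split; first by move=> q; exists (x q); rewrite xn xa.
move=> y' y'n; rewrite action_split.
have h1 := ymin y'; have h2 := ymin (fun i => y' (n + i)%N).
rewrite ya Wy /W /= addn0 y'n in h1 h2.
have h3 := Ushift m (y' 0%N); have h4 := Ushift m (y' 0%N + mv).
move: h1 h2 h3 h4; rewrite /kap; clear; lra.
Qed.

(** The action is Lipschitz in [e] uniformly in the configuration, so the values at parameters near
    [e] lie in pairwise intersecting intervals, and a common point is the value at [e]. The
    minimizers at [e] come from [min_fixed_ends], not from a limit. *)
Lemma calibrated_closed e :
  (forall eta : R, 0 < eta -> exists e' a, `|e' - e| < eta /\ calibrated e' a) ->
  exists a, calibrated e a.
Proof.
move=> H; have [M M0 HM] := action_eps T.
pose K := n%:R * M; have K0 : 0 <= K by rewrite mulr_ge0.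
pose ek (k : nat) : R := k.+1%:R^-1.
have /choice[f Hf] : forall k : nat, exists ea : R * R, `|ea.1 - e| < ek k /\ calibrated ea.1 ea.2.
  move=> k; have [e' [a Ha]] := H (ek k) (ltac:(by rewrite invr_gt0)).
  by exists (e', a).
have Af k x : `|action e n x - action (f k).1 n x| <= K * ek k.
  apply: le_trans (HM _ _ _ _) _; rewrite ler_wpM2l// distrC ltW//.
  by have [] := Hf k.
have low k l : (f k).2 - K * ek k <= (f l).2 + K * ek l.
  have [_ [ck _]] := Hf k; have [_ [cl _]] := Hf l.
  have [x [x0 xn xa]] := cl 0.
  have := calibrated_le (Hf k).2 (x := x); rewrite x0 xn => /(_ erefl) h.
  have := Af k x; have := Af l x; rewrite xa !ler_norml => /andP[_ h2] /andP[h3 _].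
  by move: h h2 h3; clear; lra.
have [a Ha] := interval_choice 0%N low.
have small (u w B : R) : (forall k, u <= w + B * ek k) -> u <= w.
  move=> h; apply/ler_addgt0Pr => eta eta0.
  pose k := Num.truncn (`|B| / eta).
  apply: le_trans (h k) _; rewrite lerD2l /ek ler_pdivrMr//.
  apply: le_trans (ler_norm B) _; rewrite mulrC -ler_pdivrMr//; exact: ltW (truncnS_gt _).
exists a; split.
- move=> q; have [x [x0 xn xmin]] := @min_fixed_ends R d T e n q (q + mv) n_gt0.
  exists x; split => //; apply/le_anti/andP; split.
    apply: (@small _ _ (2 * K)) => k; have [_ [ck _]] := Hf k.
    have [y [y0 yn ya]] := ck q; apply: le_trans (xmin y y0 yn) _.
    have := Af k y; have /andP[h2 _] := Ha k; rewrite ya ler_norml => /andP[_ h1].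
    by move: h1 h2; clear; lra.
  apply: (@small _ _ (2 * K)) => k.
  have h := calibrated_le (Hf k).2 (x := x); rewrite x0 xn in h; have {}h := h erefl.
  have := Af k x; have /andP[h2 h3] := Ha k; rewrite ler_norml => /andP[h1 _].
  by move: h h1 h2 h3; clear; lra.
- move=> x xn; apply: (@small _ _ (4 * K)) => k.
  have [_ [_ ck]] := Hf k; have h := ck x xn.
  rewrite !action_split in h *.
  have := Af k x; have := Af k (fun i => x (n + i)%N).
  have /andP[h2 h3] := Ha k; rewrite !ler_norml => /andP[h1 _] /andP[h4 _].
  by move: h h1 h2 h3 h4; clear; lra.
Qed.

End Calibration.

(** * Growth of the action and nondegeneracy of minimizers *)

Section Nondegeneracy.
Context {R : realType} {d : nat} (T : twist_system R d) (m : 'rV[int]_d) (n : nat).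
Context (n_gt0 : (0 < n)%N).
Local Notation V := 'rV[R]_d.
Local Notation conf := {ptws nat -> V}.
Local Notation S := (ts_S T).
Local Notation G := (ts_G T).
Local Notation dG := (ts_dG T).
Local Notation pm := (ts_p T).
Local Notation Pm := (ts_P T).
Local Notation mv := (intv R m).
Local Notation action := (action T).
Local Notation Fe := (Feps T).
Local Notation p_in := (p_in T).
Local Notation p_out := (p_out T).
Local Notation calibrated := (calibrated T m n).
Implicit Types (q Q p P h u v : V) (x y : nat -> V) (e a : R).

Lemma action_first e x h : action e n (upd x 0 h) = action e n x +
  (S (x 0%N + h) (x 1%N) - S (x 0%N) (x 1%N)) + e * (G (x 0%N + h) - G (x 0%N)).
Proof.
rewrite -(prednK n_gt0) -add1n !action_split !actionE !big_ord1.
have -> : \sum_(i < n.-1) (S (upd x 0 h (1 + i)) (upd x 0 h (1 + i.+1)) + e * G (upd x 0 h (1 + i)))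
  = \sum_(i < n.-1) (S (x (1 + i)%N) (x (1 + i.+1)%N) + e * G (x (1 + i)%N)) by [].
have -> : upd x 0 h (@ord0 0) = x 0%N + h by [].
have -> : upd x 0 h (@ord0 0).+1 = x 1%N by [].
rewrite /=; ring.
Qed.

Lemma action_last e x h : action e n (upd x n h) = action e n x +
  (S (x n.-1) (x n + h) - S (x n.-1) (x n)).
Proof.
have -> : action e n (upd x n h) = action e n.-1.+1 (upd x n h) by rewrite prednK.
have -> : action e n x = action e n.-1.+1 x by rewrite prednK.
rewrite !actionS (eq_action T e (N := n.-1) (x := upd x n h) (y := x)); last first.
  by move=> i iN; rewrite /upd ltn_eqF// -(ltn_predK n_gt0) ltnS.
rewrite prednK// /upd eqxx ltn_eqF ?ltn_predL//; ring.
Qed.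

Definition minimizer e a q x := [/\ x 0%N = q, x n = q + mv & action e n x = a].

(* [x] is followed by the translate by [m] of [xb] whose first point is moved to [x n]; as the doubled
   configuration has action at least [2 * a], the action of [x] is bounded below. *)
Lemma right_ext e a q xb : calibrated e a -> minimizer e a q xb ->
  exists B r : R, [/\ 0 <= B, 0 < r & forall x, x 0%N = q -> `|x n - (q + mv)| < r ->
    a + dot (p_out e xb 0) (x n - (q + mv)) - B * `|x n - (q + mv)| ^+ 2 <= action e n x].
Proof.
move=> cal [xb0 xbn xba]; have [B B0 HB] := S_left T.
have [B' [r [B'0 r0 HB']]] := G_second T q.
exists (B + `|e| * B'), r; split => //; first by rewrite addr_ge0// mulr_ge0.
move=> x x0; set D := x n - (q + mv) => Dr.
pose y := fun i => upd xb 0 D i + mv.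
have ya : action e n y <= a - dot (p_out e xb 0) D + (B + `|e| * B') * `|D| ^+ 2.
  rewrite action_shift action_first xba xb0.
  have h1 := HB q (xb 1%N) D; have := HB' D Dr => h2.
  have h3 : e * (G (q + D) - G q - dot (dG q) D) <= `|e| * (B' * `|D| ^+ 2).
    apply: le_trans (ler_norm _) _; rewrite normrM ler_wpM2l//.
  rewrite /p_out xb0 dotBl dotZl; move: h1 h3; clear; lra.
have [_ H2] := cal; have := H2 (cat_config n x y).
rewrite cat_config_end cat_config_start// action_cat; last first.
  by rewrite /y /upd /= xb0 /D addrAC subrKC.
have -> : y n = x 0%N + mv + mv by rewrite /y /upd gtn_eqF// xbn x0.
by move=> /(_ erefl); move: ya; clear; lra.
Qed.

Lemma minimizer_EL e a q x : calibrated e a -> minimizer e a q x ->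
  forall j, (0 < j < n)%N -> p_in x j = p_out e x j.
Proof.
move=> cal [x0 xn xa]; apply: EL_of_min => y y0 yn; rewrite xa.
by apply: (calibrated_le n_gt0 cal); rewrite yn y0 xn x0.
Qed.

(** When the last point moves by [h], the action of [x] changes at first order by the arriving
    momentum paired with [h], while [right_ext] bounds it below with the leaving momentum of [xb]
    instead. Hence orbits of minimizers close up, and the momentum at [q] is the same for all of
    them. *)
Lemma minimizer_momentum e a q x xb : calibrated e a -> minimizer e a q x -> minimizer e a q xb ->
  p_in x n = p_out e xb 0.
Proof.
move=> cal mx mxb; have [x0 xn xa] := mx.
have [B [r [B0 r0 H]]] := right_ext cal mxb.
apply/eqP; rewrite -subr_eq0; apply/eqP/dot_nonneg_small => eta eta0.
have e2 : 0 < eta / 2 by rewrite divr_gt0.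
have [r1 r10 H1] := upd_variation T e x (leqnn n) e2.
have B1 : 0 < B + 1 by rewrite ltr_wpDl.
exists (Num.min r1 (Num.min r (eta / 2 / (B + 1)))); first by rewrite !lt_min r10 r0 divr_gt0.
move=> h; rewrite !lt_min => /andP[/H1 h1 /andP[hr hB]].
have un : upd x n h n - (q + mv) = h by rewrite /upd eqxx xn addrC addKr.
have := H (upd x n h); rewrite un => /(_ _ hr) h2.
have {}h2 := h2 (ltac:(by rewrite /upd ltn_eqF)).
move: h1; rewrite n_gt0 ltnn dot0l subr0 xa ler_norml => /andP[_ h1].
have h3 : B * `|h| ^+ 2 <= eta / 2 * `|h|.
  rewrite expr2 mulrA ler_wpM2r//; apply: le_trans (ler_wpM2l B0 (ltW hB)) _.
  rewrite mulrA ler_pdivrMr// mulrC ler_wpM2l ?lerDl// ltW//.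
rewrite dotBl; move: h1 h2 h3; clear; lra.
Qed.

Lemma minimizer_orbit e a q x : calibrated e a -> minimizer e a q x ->
  (forall i, (i <= n)%N -> (iter i (Fe e) (q, p_out e x 0)).1 = x i) /\
  iter n (Fe e) (q, p_out e x 0) = (q + mv, p_out e x 0).
Proof.
move=> cal mx; have [x0 xn xa] := mx.
have [ob1 ob2] := orbit_of_EL (minimizer_EL cal mx).
rewrite x0 in ob1 ob2; have := ob2 n_gt0; rewrite xn (minimizer_momentum cal mx mx) => {}ob2.
split=> // i; rewrite leq_eqVlt => /orP[/eqP ->|/ob1 ->//]; by rewrite ob2 xn.
Qed.

Lemma minimizer_unique e a q x xb : calibrated e a -> minimizer e a q x -> minimizer e a q xb ->
  p_out e x 0 = p_out e xb 0.
Proof.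
by move=> cal mx mxb; rewrite -(minimizer_momentum cal mxb mx) -(minimizer_momentum cal mxb mxb).
Qed.

(** The bound [right_ext] is applied to [x] with its last point moved by [- tau *: dl], a move that
    by [S_right] changes the action by at most [- tau * dot (p_in x n) dl] up to second order. An
    arriving momentum other than that of the minimizer therefore costs action. *)
Lemma growth e a q xb : calibrated e a -> minimizer e a q xb ->
  exists B r : R, [/\ 0 <= B, 0 < r & forall x (tau : R), x 0%N = q ->
    let D := x n - (q + mv) in let dl := p_in x n - p_out e xb 0 in
    0 < tau -> `|D| + tau * `|dl| < r ->
    a + dot (p_out e xb 0) D + tau * `|dl| ^+ 2 - B * (`|D| + tau * `|dl|) ^+ 2
      - B * (tau * `|dl|) ^+ 2 <= action e n x].
Proof.
move=> cal mx; have [B [r [B0 r0 H]]] := right_ext cal mx.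
have [B' B'0 HB'] := S_right T.
exists (B + B'), r; split => //; first exact: addr_ge0.
move=> x tau x0 D dl tau0 Dr.
have h1 := HB' (x n.-1) (x n) (- (tau *: dl)).
have un : upd x n (- (tau *: dl)) n - (q + mv) = D - tau *: dl by rewrite /upd eqxx addrAC.
have ntd : `|tau *: dl| = tau * `|dl| by rewrite normrZ gtr0_norm.
have Dt : `|D - tau *: dl| <= `|D| + tau * `|dl| by rewrite -ntd ler_normB.
have := H (upd x n (- (tau *: dl))); rewrite un action_last.
move=> /(_ (ltac:(by rewrite /upd ltn_eqF)) (le_lt_trans Dt Dr)).
rewrite normrN ntd dotNr dotZr in h1.
rewrite dotBr dotZr => h2.
have h3 : (B + B') * (`|D| + tau * `|dl|) ^+ 2 >= B * `|D - tau *: dl| ^+ 2.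
  apply: ler_pM => //; first by rewrite lerDl.
  by rewrite ler_pXn2r ?nnegrE// addr_ge0// mulr_ge0// ltW.
have h4 : (B + B') * (tau * `|dl|) ^+ 2 >= B' * (tau * `|dl|) ^+ 2.
  by rewrite ler_wpM2r ?sqr_ge0// lerDr.
have h5 : tau * `|dl| ^+ 2 <= tau * (dot (p_in x n) dl - dot (p_out e xb 0) dl).
  by rewrite -dotBl ler_wpM2l ?(ltW tau0)// dot_ge.
move: h1 h2 h3 h4 h5; rewrite /p_in; clear; lra.
Qed.

(* Along the orbits from [(q, p + s v)] the final point moves by [o(s)] and the final momentum by a
   multiple of [s], so the action exceeds its linear part by [o(s^2)], which contradicts [growth]. *)
Lemma nondegenerate_real e a q xb v (c L : R) : calibrated e a -> minimizer e a q xb -> 0 < c ->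
  (forall eta : R, 0 < eta -> exists2 r : R, 0 < r & forall s t : R, `|s| < r -> `|t| < r ->
     `|(iter n (Fe e) (q, p_out e xb 0 + t *: v)).1 - (iter n (Fe e) (q, p_out e xb 0 + s *: v)).1|
       <= eta * `|t - s|) ->
  (exists2 r : R, 0 < r & forall s : R, `|s| < r ->
     c * `|s| <= `|(iter n (Fe e) (q, p_out e xb 0 + s *: v)).2 - p_out e xb 0| <= L * `|s|) ->
  False.
Proof.
move=> cal mx c0 Hq [r2 r20 Hp]; have [B [r [B0 r0 Hg]]] := growth cal mx.
set pb := p_out e xb 0 in Hq Hp Hg.
have [xb0 xbn xba] := mx; have [ob1 ob2] := minimizer_orbit cal mx; rewrite -/pb in ob1 ob2.
pose z (s : R) : phase R d := (q, pb + s *: v).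
pose x (s : R) i := (iter i (Fe e) (z s)).1.
have L0 : 0 <= L.
  have h : `|r2 / 2| < r2 by rewrite gtr0_norm ?divr_gt0// ltr_pdivrMr// ltr_pMr// ltr1n.
  have /andP[_ h2] := Hp _ h; have h3 := le_trans (normr_ge0 _) h2.
  by rewrite -(pmulr_lge0 _ (_ : 0 < `|r2 / 2|))// gtr0_norm ?divr_gt0.
pose C := d%:R * L + B * (1 + L) ^+ 2 + B * L ^+ 2.
have C0 : 0 <= C by apply: addr_ge0; [apply: addr_ge0|]; apply: mulr_ge0; rewrite ?sqr_ge0 ?ler0n.
(* By this choice the gain [tau * (c * s1)^2] exceeds the total error [C * tau^2 * s1^2]. The rate
   [eta = tau^2] of the end point, chosen below, is small enough to fit in that error. *)
pose tau := Num.min 1 (c ^+ 2 / (C + 1)).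
have C1 : 0 < C + 1 by rewrite ltr_wpDl.
have tau0 : 0 < tau by rewrite lt_min ltr01 divr_gt0// exprn_gt0.
have tau1 : tau <= 1 by rewrite ge_min lexx.
have tauC : tau * (C + 1) <= c ^+ 2 by rewrite -ler_pdivlMr// ge_min lexx orbT.
pose eta := tau ^+ 2; have eta0 : 0 < eta by rewrite exprn_gt0.
have [r1 r10 Hr1] := Hq eta eta0.
pose s1 := Num.min (r1 / 2) (Num.min (r2 / 2) (r / (2 * (eta + tau * L + 1)))).
have k0 : 0 < 2 * (eta + tau * L + 1).
  by rewrite mulr_gt0// ltr_wpDl// addr_ge0 ?(ltW eta0)// mulr_ge0// ltW.
have s10 : 0 < s1 by rewrite !lt_min !divr_gt0.
have s1r1 : s1 < r1.
  by apply: (@le_lt_trans _ _ (r1 / 2)); [by rewrite ge_min lexx|by rewrite ltr_pdivrMr// ltr_pMr// ltr1n].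
have s1r2 : s1 < r2.
  apply: (@le_lt_trans _ _ (r2 / 2)); [by rewrite !ge_min lexx !orbT|by rewrite ltr_pdivrMr// ltr_pMr// ltr1n].
have s1r : s1 * (2 * (eta + tau * L + 1)) <= r.
  by rewrite -ler_pdivlMr// !ge_min lexx !orbT.
have inr (s rr : R) : s1 < rr -> 0 <= s <= s1 -> `|s| < rr.
  by move=> h /andP[sp ss]; rewrite ger0_norm//; exact: le_lt_trans ss h.
have z0 : z 0 = (q, pb) by rewrite /z scale0r addr0.
have zlip s : lip_at z s.
  exists `|v|, 1; split => // t _; apply: pair_norm_le; rewrite /= ?subrr ?normr0.
    by rewrite mulr_ge0.
  by rewrite opprD addrACA subrr add0r -scalerBl normrZ mulrC.
(* The slope of [f] is the deviation of the final momentum from [pb], of size at most [L * s1],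
   paired with the displacement rate of the end point, at most [eta]. *)
pose f s := action e n (x s) - dot pb (x s n).
have fbound : `|f s1 - f 0| <= d%:R * (L * s1) * eta * (s1 - 0).
  apply: dini_lipschitz => [|s ss e1 e10]; first exact: ltW.
  have xlip i : lip_at (fun s => x s i) s.
    apply: (@lip_at_comp _ _ _ _ (fun s => iter i (Fe e) (z s)) (fun z => z.1)); last exact: fst_lip.
    apply: (@lip_at_comp _ _ _ _ z); [exact: zlip|exact: iter_Feps_lip].
  have [K [rK [K0 rK0 HK]]] := lip_at_uniform xlip n.
  have K1 : 0 < n.+1%:R * K + 1 by rewrite ltr_wpDl// mulr_ge0.
  have [ro ro0 Ho] := orbit_variation T n e (z s) (divr_gt0 e10 K1).
  have K2 : 0 < K + 1 by rewrite ltr_wpDl.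
  exists (Num.min rK (ro / (K + 1))); first by rewrite lt_min rK0 divr_gt0.
  move=> t tt; rewrite lt_min ltr_pdivlMr// => /andP[tK to].
  have hK i : (i <= n)%N -> `|x t i - x s i| <= K * `|t - s| by move=> iN; exact: HK.
  have ho := Ho (x t); rewrite -/(x s n) in ho.
  have {}ho := ho (ltac:(move=> i iN; apply: le_lt_trans (hK i iN) _; apply: le_lt_trans to;
    by rewrite mulrC ler_wpM2l// lerDl)).
  have hx0 : x t 0%N - (iter 0 (Fe e) (z s)).1 = 0 by rewrite /x /= subrr.
  rewrite hx0 dot0r subr0 in ho.
  have hsum : \sum_(i < n.+1) `|x t i - (iter i (Fe e) (z s)).1| <= n.+1%:R * K * `|t - s|.
    apply: (@le_trans _ _ (\sum_(i < n.+1) K * `|t - s|)).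
      by apply: ler_sum => i _; apply: hK; rewrite -ltnS.
    by rewrite sumr_const card_ord -mulrA mulr_natl.
  have h1 : e1 / (n.+1%:R * K + 1) * \sum_(i < n.+1) `|x t i - (iter i (Fe e) (z s)).1| <= e1 * `|t - s|.
    apply: le_trans (ler_wpM2l _ hsum) _; first by rewrite divr_ge0// ltW.
    by rewrite mulrA ler_wpM2r// mulrAC ler_pdivrMr// ler_pM2l// lerDl.
  have h2 : `|dot ((iter n (Fe e) (z s)).2 - pb) (x t n - x s n)| <= d%:R * (L * s1) * eta * `|t - s|.
    apply: le_trans (dot_bound _ _) _; rewrite -[leRHS]mulrA; apply: ler_pM => //.
    + rewrite ler_wpM2l//; have /andP[_ h3] := Hp s (inr _ _ s1r2 ss).
      apply: le_trans h3 _; rewrite ler_wpM2l//; case/andP: ss => sp ss; by rewrite ger0_norm.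
    + by have := Hr1 s t (inr _ _ s1r1 ss) (inr _ _ s1r1 tt).
  have -> : f t - f s = (action e n (x t) - action e n (x s) - dot (iter n (Fe e) (z s)).2 (x t n - x s n))
      + dot ((iter n (Fe e) (z s)).2 - pb) (x t n - x s n).
    by rewrite /f (dotBl (iter _ _ _).2) !dotBr; ring.
  apply: le_trans (ler_normD _ _) _; rewrite mulrDl addrC; apply: lerD => //.
  exact: le_trans ho h1.
have f0 : f 0 = a - dot pb (q + mv).
  rewrite /f /x z0 ob2; congr (_ - _); rewrite -xba; apply: eq_action => i iN; exact: ob1.
have Ds : `|x s1 n - (q + mv)| <= eta * s1.
  have := Hr1 0 s1; rewrite normr0 gtr0_norm// subr0 gtr0_norm// => /(_ r10 s1r1).
  by rewrite scale0r addr0 ob2.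
have pin : p_in (x s1) n = (iter n (Fe e) (z s1)).2.
  by have [_] := EL_of_orbit T e (z s1) n.-1; rewrite prednK.
have s1s : 0 <= s1 <= s1 by rewrite (ltW s10) lexx.
have /andP[dl1 dl2] := Hp s1 (inr _ _ s1r2 s1s).
rewrite -/(z s1) -pin (gtr0_norm s10) in dl1 dl2.
have tdl : tau * `|p_in (x s1) n - pb| <= tau * (L * s1) by rewrite ler_wpM2l// ltW.
have := Hg (x s1) tau erefl tau0.
have -> : `|x s1 n - (q + mv)| + tau * `|p_in (x s1) n - pb| < r.
  apply: le_lt_trans (lerD Ds tdl) _; apply: lt_le_trans s1r.
  have := mulr_gt0 s10 eta0; have := mulr_ge0 (mulr_ge0 (ltW tau0) L0) (ltW s10); move: s10; clear; lra.
move=> /(_ isT) hg.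
have h1 : tau * (c * s1) ^+ 2 <= tau * `|p_in (x s1) n - pb| ^+ 2.
  by rewrite ler_wpM2l ?(ltW tau0)// ler_pXn2r// nnegrE// mulr_ge0// ltW.
have h2 : B * (`|x s1 n - (q + mv)| + tau * `|p_in (x s1) n - pb|) ^+ 2 <= B * (eta * s1 + tau * (L * s1)) ^+ 2.
  rewrite ler_wpM2l// ler_pXn2r ?nnegrE ?addr_ge0 ?mulr_ge0 ?(ltW tau0) ?(ltW s10) ?(ltW eta0)//.
  exact: lerD.
have h3 : B * (tau * `|p_in (x s1) n - pb|) ^+ 2 <= B * (tau * (L * s1)) ^+ 2.
  by rewrite ler_wpM2l// ler_pXn2r ?nnegrE ?mulr_ge0 ?(ltW tau0) ?(ltW s10).
have h4 : eta * s1 + tau * (L * s1) <= tau * (1 + L) * s1.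
  rewrite mulrA -mulrDl ler_wpM2r ?(ltW s10)// mulrDr mulr1 lerD2r /eta expr2 ler_piMr// ltW//.
have h5 : B * (eta * s1 + tau * (L * s1)) ^+ 2 <= B * (tau * (1 + L) * s1) ^+ 2.
  by rewrite ler_wpM2l// ler_pXn2r ?nnegrE ?addr_ge0 ?mulr_ge0 ?addr_ge0 ?(ltW tau0) ?(ltW s10) ?(ltW eta0).
move: fbound; rewrite f0 subr0 ler_norml /f => /andP[_ fb].
have key : tau * (c * s1) ^+ 2 <= tau ^+ 2 * s1 ^+ 2 * C.
  rewrite /C; move: hg fb h1 h2 h3 h5; rewrite dotBr /eta; clear.
  move: (dot _ _) (dot _ _) (action _ _ _) => ? ? ?.
  move: (tau * _) (B * _) (B * _) => ? ? ?.
  rewrite !exprMn; lra.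
have : tau * s1 ^+ 2 * (c ^+ 2 - tau * C) <= 0.
  by move: key; rewrite exprMn; clear; lra.
apply/negP; rewrite -ltNge; apply: mulr_gt0; first by rewrite mulr_gt0// exprn_gt0.
move: tauC tau0; clear; lra.
Qed.

End Nondegeneracy.

(** * Compactness of minimizers and the bound on the gradient of G *)

Section Compactness.
Context {R : realType} {d : nat} (T : twist_system R d) (m : 'rV[int]_d) (n : nat).
Context (n_gt0 : (0 < n)%N).
Local Notation V := 'rV[R]_d.
Local Notation conf := {ptws nat -> V}.
Local Notation S := (ts_S T).
Local Notation G := (ts_G T).
Local Notation dG := (ts_dG T).
Local Notation pm := (ts_p T).
Local Notation Pm := (ts_P T).
Local Notation mv := (intv R m).
Local Notation action := (action T).
Local Notation Fe := (Feps T).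
Local Notation p_in := (p_in T).
Local Notation p_out := (p_out T).
Local Notation calibrated := (calibrated T m n).
Local Notation minimizer := (minimizer T m n).
Implicit Types (q Q p P h u v : V) (x y : nat -> V) (e a : R).

Lemma small_of_inv (u w B : R) : (forall k : nat, u <= w + B * k.+1%:R^-1) -> u <= w.
Proof.
move=> h; apply/ler_addgt0Pr => eta eta0.
have Hk (k : nat) : `|B| / eta < k.+1%:R -> B * k.+1%:R^-1 <= eta.
  move=> hk; rewrite ler_pdivrMr//; apply: le_trans (ler_norm B) _.
  by rewrite mulrC -ler_pdivrMr// ltW.
by apply: le_trans (h (Num.truncn (`|B| / eta))) _; rewrite lerD2l; apply: Hk; exact: truncnS_gt.
Qed.

(** One cluster point serves for all continuous [f] at once, so that no subsequence is extracted. *)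
Lemma conf_cluster (xs : nat -> conf) (rho : R) : (forall k, config_box rho (xs k)) ->
  exists x : conf, forall (f : conf -> R) (B : R), continuous f ->
    (forall k, f (xs k) <= B * k.+1%:R^-1) -> f x <= 0.
Proof.
move=> xsK.
have [|x [_ cx]] := @config_box_compact R d rho (xs @ \oo) _; first by exists 0%N => // k _; exact: xsK.
exists x => f B cf fB; apply: (@small_of_inv _ _ `|B|) => N; rewrite add0r.
pose A := [set y : conf | f y <= `|B| * N.+1%:R^-1].
have cA : closed A.
  by apply: (@closed_comp _ _ f [set t : R | t <= _]); [move=> z _; exact: cf|exact: closed_le].
apply: cA => U Ux; apply: (cx A U _ Ux).
exists N => // k /= Nk; rewrite /A /=; apply: le_trans (fB k) _.
apply: (@le_trans _ _ (`|B| * k.+1%:R^-1)); first by rewrite ler_wpM2r ?invr_ge0// ler_norm.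
by rewrite ler_wpM2l// lef_pV2 ?posrE// ler_nat ltnS.
Qed.

Lemma lip_at_continuous (U W : normedModType R) (f : U -> W) z : lip_at f z -> {for z, continuous f}.
Proof.
move=> [L [r [L0 r0 H]]]; apply/cvgrPdist_lt => e e_gt0.
have L1 : 0 < L + 1 by rewrite ltr_wpDl.
apply/nbhs_ballP; exists (Num.min r (e / (L + 1))); first by rewrite /= lt_min r0 divr_gt0.
move=> w; rewrite -ball_normE /= lt_min distrC ltr_pdivlMr// => /andP[w1 w2].
rewrite distrC; apply: le_lt_trans (H w w1) _; apply: le_lt_trans w2.
by rewrite mulrC ler_wpM2l// lerDl.
Qed.

Lemma ball_bounded (W : normedModType R) (f : V -> W) (rho : R) : continuous f ->
  exists K : R, forall q, `|q| <= rho -> `|f q| <= K.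
Proof.
move=> cf; have cK : compact (f @` [set v : V | `|v| <= rho]).
  by apply: continuous_compact; [exact: continuous_subspaceT|exact: closed_ball_compact].
have [M [_ HM]] := compact_bounded cK; exists (M + 1) => q qr.
by apply: (HM (M + 1)); [rewrite ltrDl|exists q].
Qed.

Lemma periodic_bounded (W : normedModType R) (f : V -> W) : continuous f ->
  (forall k q, f (q + intv R k) = f q) -> exists K : R, forall q, `|f q| <= K.
Proof.
move=> cf fper; have [K HK] := ball_bounded 1 cf; exists K => q.
by have [k /HK] := round_rv q; rewrite fper.
Qed.

Lemma norm_near (W : normedModType R) (w w0 : W) (t : R) : `|w - w0| < t -> t <= 1 -> `|w| <= `|w0| + 1.
Proof.
move=> h1 h2; rewrite -[w](subrK w0).
by apply: le_trans (ler_normD _ _) _; rewrite addrC lerD2l; exact: le_trans (ltW h1) h2.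
Qed.

(** Otherwise minimizers at parameters and points tending to [e0] and [q0], with momenta away from
    that of [x0], would cluster at a minimizer for [e0] and [q0], against [minimizer_unique]. *)
Lemma minimizer_close e0 a0 q0 x0 (eta : R) : 0 < eta -> calibrated e0 a0 -> minimizer e0 a0 q0 x0 ->
  exists2 r : R, 0 < r & forall e a q x, `|e - e0| < r -> `|q - q0| < r ->
    calibrated e a -> minimizer e a q x -> `|p_out e x 0 - p_out e0 x0 0| < eta.
Proof.
move=> eta0 cal0 mx0; have [x00 x0n x0a] := mx0.
apply: contrapT => bad.
have {}bad (k : nat) : exists exx : R * R * V * (nat -> V), let: (e, a, q, x) := exx in
   [/\ `|e - e0| < k.+1%:R^-1, `|q - q0| < k.+1%:R^-1, calibrated e a, minimizer e a q x &
     eta <= `|p_out e x 0 - p_out e0 x0 0|].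
  apply/not_existsP => nb; apply: bad; exists k.+1%:R^-1; first by rewrite invr_gt0.
  move=> e a q x h1 h2 h3 h4; rewrite ltNge; apply/negP => h5.
  by apply: (nb (e, a, q, x)).
have [f Hf] := choice bad.
pose ek k := (f k).1.1.1; pose ak k := (f k).1.1.2; pose qk k := (f k).1.2.
(* The points past [n] are set to 0 so that the sequences stay in one box. *)
pose xk k i := if (i <= n)%N then (f k).2 i else 0.
have {}Hf k : [/\ `|ek k - e0| < k.+1%:R^-1, `|qk k - q0| < k.+1%:R^-1, calibrated (ek k) (ak k),
    minimizer (ek k) (ak k) (qk k) (xk k) & eta <= `|p_out (ek k) (xk k) 0 - p_out e0 x0 0|].
  move: (Hf k); rewrite /ek /ak /qk /xk; case: (f k) => [[[e a] q] x] /= [h1 h2 h3 [h4 h5 h6] h7].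
  split => //; last by rewrite !p_outE /= n_gt0.
  split => //=; first by rewrite leqnn.
  by rewrite -h6; apply: eq_action => i ->.
have [M M0 HM] := action_eps T.
have k1 (k : nat) : k.+1%:R^-1 <= 1 :> R by rewrite invf_le1// ler1n.
have ekE k : `|ek k| <= `|e0| + 1.
  have [h1 _ _ _ _] := Hf k; exact: (@norm_near R^o) h1 (k1 k).
have akE k : ak k <= a0 + n%:R * M * k.+1%:R^-1.
  have [h1 _ c _ _] := Hf k; have := calibrated_le n_gt0 c (x := x0); rewrite x00 => /(_ x0n) h2.
  have := HM (ek k) e0 n x0; rewrite x0a ler_norml => /andP[_ h3].
  have h4 : n%:R * M * `|ek k - e0| <= n%:R * M * k.+1%:R^-1.
    by rewrite ler_wpM2l ?mulr_ge0// ltW.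
  by apply: le_trans h2 _; rewrite -lerBlDl; exact: le_trans h3 h4.
have nM : 0 <= n%:R * M by rewrite mulr_ge0.
have akE1 k : ak k <= a0 + n%:R * M.
  by apply: le_trans (akE k) _; rewrite lerD2l ler_piMr.
have [D D0 HD] := action_coercive T (`|e0| + 1) (a0 + n%:R * M) n (lexx 0).
have box k : config_box (`|q0| + 1 + n%:R * D) (xk k).
  have [_ h2 _ [y0 yn ya] _] := Hf k.
  have q1 : `|qk k| <= `|q0| + 1.
    exact: norm_near h2 (k1 k).
  move=> i; have [iN|iN] := leqP i n.
    apply: le_trans (@chain_bound _ _ (xk k) n D D0 _ i iN) _; last by rewrite lerD2r y0.
    by apply: (HD (ek k) (xk k)); [exact: ekE|rewrite mul0r subr0 ya].
  rewrite /xk leqNgt iN normr0 !addr_ge0// mulr_ge0//.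
have [x Hx] := conf_cluster box.
have ev i : continuous (fun y : conf => y i) by exact: conf_eval_continuous.
have nrm (g : conf -> V) : continuous g -> continuous (fun y : conf => `|g y| : R).
  by move=> cg y; apply: (continuous_comp (cg y)); exact: norm_continuous.
have xq : x 0%N = q0.
  apply/eqP; rewrite -subr_eq0 -normr_le0; apply: (Hx (fun y : conf => `|y 0%N - q0|) 1).
    apply: (nrm (fun y => y 0%N - q0)) => y; exact: (cvgB (ev 0%N y) (cvg_cst q0)).
  by move=> k; have [_ h2 _ [-> _ _] _] := Hf k; rewrite mul1r ltW.
have xn : x n = q0 + mv.
  apply/eqP; rewrite -subr_eq0 -normr_le0; apply: (Hx (fun y : conf => `|y n - (q0 + mv)|) 1).
    apply: (nrm (fun y => y n - (q0 + mv))) => y; exact: (cvgB (ev n y) (cvg_cst (q0 + mv))).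
  move=> k; have [_ h2 _ [_ -> _] _] := Hf k.
  by rewrite opprD addrACA subrr addr0 mul1r ltW.
have xa : action e0 n x = a0.
  apply/le_anti/andP; split; last by apply: (calibrated_le n_gt0 cal0); rewrite xq xn.
  rewrite -subr_le0; apply: (Hx (fun y : conf => action e0 n y - a0) (2 * (n%:R * M))).
    apply: continuousDr; [exact: action_continuous|exact: cst_continuous].
  move=> k; have [h1 _ _ [_ _ ya] _] := Hf k.
  have := HM e0 (ek k) n (xk k); rewrite ya (distrC e0) => h3.
  have h4 : n%:R * M * `|ek k - e0| <= n%:R * M * k.+1%:R^-1 by rewrite ler_wpM2l// ltW.
  have h5 := le_trans (ler_norm _) (le_trans h3 h4).
  rewrite lerBlDl in h5; rewrite lerBlDl; apply: le_trans h5 _.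
  apply: le_trans (lerD (akE k) (lexx _)) _.
  have -> : 2 * (n%:R * M) = n%:R * M + n%:R * M by rewrite mulr_natl mulr2n.
  by rewrite -addrA mulrDl.
have dGc : continuous dG by move=> z; exact/lip_at_continuous/ts_dG_lip.
have cp : continuous (fun y : conf => p_out e0 y 0 : V).
  have c1 : continuous (fun y : conf => (y 0%N, y 1%N) : V * V) by exact: continuous_pairr (ev 0%N) (ev 1%N).
  have c2 : continuous (fun y : conf => pm (y 0%N) (y 1%N)).
    by move=> y; exact: (continuous_comp (c1 y) (@ts_p_cont _ _ T (y 0%N, y 1%N))).
  have c3 : continuous (fun y : conf => e0 *: dG (y 0%N)).
    move=> y; exact: (continuous_comp (continuous_comp (ev 0%N y) (dGc _)) (@scaler_continuous _ _ e0 _)).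
  move=> y; exact: (cvgB (c2 y) (c3 y)).
have [K HK] : exists K : R, forall k, `|dG (qk k)| <= K.
  have [K HK] := ball_bounded (`|q0| + 1) dGc; exists K => k; apply: HK.
  have [_ h2 _ _ _] := Hf k.
  exact: norm_near h2 (k1 k).
suff : eta - `|p_out e0 x 0 - p_out e0 x0 0| <= 0.
  have -> : p_out e0 x 0 = p_out e0 x0 0 by apply: (minimizer_unique n_gt0 cal0 _ mx0).
  by rewrite subrr normr0 subr0 leNgt eta0.
apply: (Hx (fun y : conf => eta - `|p_out e0 y 0 - p_out e0 x0 0|) K).
  apply: continuousDr; first exact: cst_continuous.
  apply: continuousNr; apply: (nrm (fun y => p_out e0 y 0 - p_out e0 x0 0)) => y.
  exact: (cvgB (cp y) (cvg_cst (p_out e0 x0 0))).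
move=> k; have [h1 _ _ [y0 _ _] h5] := Hf k.
have E : p_out (ek k) (xk k) 0 = p_out e0 (xk k) 0 - (ek k - e0) *: dG (qk k).
  by rewrite !p_outE y0 scalerBl opprB addrA subrK.
rewrite E addrAC in h5.
have h6 := le_trans h5 (ler_normB _ _).
have h7 : `|(ek k - e0) *: dG (qk k)| <= K * k.+1%:R^-1.
  by rewrite normrZ mulrC ler_pM// ltW.
by rewrite lerBlDl; apply: le_trans h6 _; rewrite lerD2l.
Qed.

(* Moving the middle point of a doubled minimizer by an integer vector [k] shows that
   [e * dot (dG q) k] is at most a multiple of [|k|^2], with a constant independent of [e]. *)
Lemma calibrated_gradient : exists B : R, forall e a q i, calibrated e a ->
  `|e| * `|dG q 0 i| <= B.
Proof.
have [B B0 HB] := S_right T; have [B' B'0 HB'] := S_left T.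
exists (B + B') => e a q i cal.
have [xb mxb] : exists xb, minimizer e a q xb by have [+ _] := cal; apply.
have [xb0 xbn xba] := mxb; have pE := minimizer_momentum n_gt0 cal mxb mxb.
have main (k : 'rV[int]_d) : e * dot (dG q) (intv R k) <= (B + B') * `|intv R k| ^+ 2.
  pose h := intv R k; pose y := fun i => upd xb 0 h i + mv.
  have [_ H2] := cal; have := H2 (cat_config n (upd xb n h) y).
  rewrite cat_config_end cat_config_start// action_cat; last first.
    by rewrite /y /upd !eqxx xb0 xbn addrAC.
  have -> : y n = upd xb n h 0%N + mv + mv by rewrite /y /upd gtn_eqF// ltn_eqF// xbn xb0.
  move=> /(_ erefl); rewrite action_shift action_first// action_last// xba xb0.
  have h1 := HB (xb n.-1) (xb n) h; have h2 := HB' q (xb 1%N) h.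
  have gp : G (q + h) = G q by rewrite ts_G_per.
  move: h1 h2; rewrite gp subrr mulr0 -[Pm _ _]/(p_in xb n) pE !p_outE xb0 dotBl dotZl -/h.
  clear; lra.
pose k : 'rV[int]_d := delta_mx 0 i.
have kE : intv R k = delta_mx 0 i.
  by apply/rowP => j; rewrite !mxE eqxx /=; case: (j == i).
have kNE : intv R (- k) = - delta_mx 0 i by rewrite -kE; apply/rowP => j; rewrite !mxE rmorphN.
have nk : `|delta_mx 0 i : V| <= 1.
  apply: rv_norm_le => // j; rewrite mxE eqxx /=; case: eqP => _; by rewrite ?normr1 ?normr0.
have := main k; have := main (- k); rewrite kE kNE normrN dotNr !dot_delta => h1 h2.
have h3 : (B + B') * `|delta_mx 0 i : V| ^+ 2 <= B + B'.
  rewrite ler_piMr ?addr_ge0// expr_le1//.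
by rewrite -normrM ler_norml; move: h1 h2 h3; clear; lra.
Qed.

Lemma G_constant : (forall A : R, exists e a, A < `|e| /\ calibrated e a) ->
  forall q q', G q = G q'.
Proof.
move=> H; apply: gradient_zero_const => q eta eta0.
have -> : 0 = dG q; last exact: ts_G_grad.
have [B HB] := calibrated_gradient.
apply/rowP => i; rewrite mxE; apply/esym/eqP; rewrite -normr_le0 leNgt; apply/negP => g0.
have [e [a [eA cal]]] := H (B / `|dG q 0 i|).
by have := HB e a q i cal; apply/negP; rewrite -ltNge -ltr_pdivrMr.
Qed.

End Compactness.

(** * Analytic continuation in the parameter *)

Section Interpolation.
Context {R : realType}.
Local Notation C := (Cfield R).

Definition clampr (rho t : R) : R := Num.max (- rho) (Num.min rho t).

Lemma clampr_le rho t : 0 <= rho -> `|clampr rho t| <= rho.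
Proof.
by move=> r0; rewrite ler_norml /clampr le_max lexx /= ge_max ge_min lexx /= andbT; move: r0; lra.
Qed.

Lemma clampr_id rho t : `|t| <= rho -> clampr rho t = t.
Proof.
by rewrite ler_norml /clampr => /andP[t1 t2]; rewrite (min_idPr t2) (max_idPr t1).
Qed.

Lemma max_lip (a s t : R) : `|Num.max a s - Num.max a t| <= `|s - t|.
Proof.
have h1 := ler_norm (s - t); have h2 := ler_norm (t - s); rewrite distrC in h2.
rewrite ler_norml /Num.max; case: (ltP a s); case: (ltP a t); move: h1 h2; clear; lra.
Qed.

Lemma min_lip (a s t : R) : `|Num.min a s - Num.min a t| <= `|s - t|.
Proof.
have h1 := ler_norm (s - t); have h2 := ler_norm (t - s); rewrite distrC in h2.
rewrite ler_norml /Num.min; case: (ltP a s); case: (ltP a t); move: h1 h2; clear; lra.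
Qed.

Lemma clampr_lip rho s t : `|clampr rho s - clampr rho t| <= `|s - t|.
Proof. exact: le_trans (max_lip _ _ _) (min_lip _ _ _). Qed.

(** A retraction of the plane onto a square. Composition with it makes a function known on a disc
    continuous on the whole plane, as [interp_error] asks, without changing it on the square. *)
Definition clampc (rho : R) (w : C) : C := cx (clampr rho (cre w)) (clampr rho (cim w)).

Lemma clampc_nr rho w : 0 <= rho -> nr (clampc rho w) <= 2 * rho.
Proof.
move=> r0; apply: le_trans (nr_le _) _; rewrite mulr_natl mulr2n.
by apply: lerD; rewrite /clampc !creimE; exact: clampr_le.
Qed.

Lemma clampc_lip rho w z : nr (clampc rho w - clampc rho z) <= 2 * nr (w - z).
Proof.
apply: le_trans (nr_le _) _; rewrite mulr_natl mulr2n !creimE.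
apply: lerD; apply: le_trans (clampr_lip _ _ _) _; first by rewrite -creB cre_le.
by rewrite -cimB cim_le.
Qed.

Lemma clampc_id rho w : `|cre w| <= rho -> `|cim w| <= rho -> clampc rho w = w.
Proof. by move=> w1 w2; rewrite /clampc !clampr_id// -cxE. Qed.

(** Each factor of the error product is at most 1/2: point and nodes are within [r0 / 36] of the
    centre, so [2 * |z - a| <= r0 / 9], while [r0 / 4 - r0 / 36 = 2 * r0 / 9]. The clamp at [r0 / 3]
    has values of modulus at most [2 * r0 / 3] and fixes the square of half-side [r0 / 4]. *)
Lemma interp_disc (r0 M w0 : R) (f : C -> C) (s : seq R) (z : R) (c : R -> R) : 0 < r0 ->
  (forall w : C, nr (w - rc w0) < r0 -> differentiable f w /\ nr (f w) <= M) ->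
  `|z| <= r0 / 36 -> (forall a, a \in s -> `|a| <= r0 / 36) -> uniq s -> z \notin s ->
  (forall g, interp s g z = \sum_(a <- s) rc (c a) * g (rc a)) ->
  nr (f (rc (w0 + z)) - \sum_(a <- s) rc (c a) * f (rc (w0 + a))) <= M * 2^-1 ^+ size s.
Proof.
move=> r00 fM zr sr us zs cE.
pose rho := r0 / 3; have rho0 : 0 <= rho by rewrite divr_ge0// ltW.
pose g (w : C) : C := f (rc w0 + clampc rho w).
have gin (w : C) : nr (rc w0 + clampc rho w - rc w0) < r0.
  rewrite addrC addKr; apply: le_lt_trans (clampc_nr _ rho0) _; rewrite /rho; move: r00; clear; lra.
have grc (a : R) : `|a| <= r0 / 36 -> g (rc a) = f (rc (w0 + a)).
  move=> ar; rewrite /g clampc_id ?rcD// !creimE ?normr0//; apply: le_trans ar _.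
  rewrite /rho; move: r00; clear; lra.
have M0 : 0 <= M.
  have [_] := fM (rc w0) (ltac:(by rewrite subrr nr0)); apply: le_trans; exact: nr_ge0.
have dlr : r0 / 36 < r0 / 4 by move: r00; clear; lra.
have := @interp_error R (r0 / 4) (r0 / 36) z s g M [::] dlr zr sr us zs isT (fun _ _ => isT).
rewrite cE grc// (eq_big_seq (fun a => rc (c a) * f (rc (w0 + a)))); last first.
  by move=> a /sr /grc ->.
move=> H; apply: le_trans (H _ _ _) _.
- move=> w; apply/continuous_nrP => e e0.
  have cf : {for rc w0 + clampc rho w, continuous f}.
    by apply: differentiable_continuousf; have [] := fM _ (gin w).
  have /continuous_nrP /(_ e e0)[dd dd0 Hd] := cf.
  exists (dd / 2); first by rewrite divr_gt0.
  move=> y yw; apply: Hd; rewrite opprD addrACA subrr add0r.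
  by apply: le_lt_trans (clampc_lip _ _ _) _; move: yw; clear; lra.
- move=> w [w1 w2] _; rewrite -!ler_norml in w1 w2.
  have r43 : r0 / 4 < rho by rewrite /rho; move: r00; clear; lra.
  have df : differentiable f (rc w0 + w).
    apply: (proj1 (fM (rc w0 + w) _)); rewrite addrC addKr; apply: le_lt_trans (nr_le _) _.
    by move: w1 w2 r00; clear; lra.
  have dg : differentiable (fun y : C => f (rc w0 + y)) w.
    apply: (@differentiable_compf C C C C (fun y : C => rc w0 + y) f w _ df).
    exact: (@differentiable_addv C C C (fun=> rc w0) (fun y => y) w (differentiable_cstf _ _) (differentiable_idf _)).
  apply: near_eq_differentiable dg; apply/near_nrP; exists (rho - r0 / 4); first by rewrite subr_gt0.
  move=> y yw; rewrite /g clampc_id//.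
    rewrite -[y](subrK w) creD; apply: le_trans (ler_normD _ _) _.
    by have := cre_le (y - w); move: w1 yw; clear; lra.
  rewrite -[y](subrK w) cimD; apply: le_trans (ler_normD _ _) _.
  by have := cim_le (y - w); move: w2 yw; clear; lra.
- by move=> w _; have [] := fM _ (gin w).
rewrite ler_wpM2l//.
elim: s sr {us zs cE H} => [|a s IH] sr; first by rewrite big_nil expr0.
rewrite big_cons exprS; apply: ler_pM.
- by rewrite divr_ge0 ?mulr_ge0// subr_ge0 ltW.
- by apply: prodr_ge0 => b _; rewrite divr_ge0 ?mulr_ge0// subr_ge0 ltW.
- rewrite ler_pdivrMr ?subr_gt0//.
  have := sr a (mem_head _ _); have := ler_normB z a; move: zr r00; clear; lra.
- by apply: IH => b bs; apply: sr; rewrite inE bs orbT.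
Qed.

End Interpolation.

Section Projections.
Context {K : numFieldType} {A B W : normedModType K}.

Lemma linear_fst_map : linear (fun z : (A * B)%type => z.1). Proof. by []. Qed.
Lemma linear_snd_map : linear (fun z : (A * B)%type => z.2). Proof. by []. Qed.

Lemma differentiable_fstf (x : (A * B)%type) : differentiable (fun z : (A * B)%type => z.1) x.
Proof.
pose L : {linear (A * B)%type -> A} := HB.pack (fun z : (A * B)%type => z.1)
  (GRing.isLinear.Build _ _ _ _ _ linear_fst_map).
apply: (@linear_differentiable _ _ _ L) => z; exact: cvg_fst.
Qed.

Lemma diff_fstf (x : (A * B)%type) : 'd (fun z : (A * B)%type => z.1) x = (fun z => z.1) :> (A * B -> A).
Proof.
pose L : {linear (A * B)%type -> A} := HB.pack (fun z : (A * B)%type => z.1)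
  (GRing.isLinear.Build _ _ _ _ _ linear_fst_map).
apply: (@diff_lin _ _ _ L) => z; exact: cvg_fst.
Qed.

Lemma differentiable_sndf (x : (A * B)%type) : differentiable (fun z : (A * B)%type => z.2) x.
Proof.
pose L : {linear (A * B)%type -> B} := HB.pack (fun z : (A * B)%type => z.2)
  (GRing.isLinear.Build _ _ _ _ _ linear_snd_map).
apply: (@linear_differentiable _ _ _ L) => z; exact: cvg_snd.
Qed.

Lemma differentiable_rv_of d (F : W -> 'rV[K]_d) x :
  (forall i, differentiable (fun y => F y 0 i : K) x) -> differentiable F x.
Proof.
move=> dF; have -> : F = \sum_(i < d) (fun y => F y 0 i *: delta_mx 0 i).
  by apply/funext => y; rewrite fct_sumE -row_sum_delta.
by apply: differentiable_sum => i; exact: differentiableZl.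
Qed.

Lemma differentiable_mulv (f g : W -> K) x :
  differentiable f x -> differentiable g x -> differentiable (fun y => f y * g y) x.
Proof. exact: differentiableM. Qed.

Lemma differentiable_scalev d (k : W -> K) (F : W -> 'rV[K]_d) x :
  differentiable k x -> (forall i, differentiable (fun y => F y 0 i : K) x) ->
  differentiable (fun y => k y *: F y) x.
Proof.
move=> dk dF; apply: differentiable_rv_of => i.
rewrite (_ : (fun y => _) = (fun y => k y * F y 0 i)); first exact: differentiable_mulv.
by apply/funext => y; rewrite mxE.
Qed.

End Projections.

(** * The complexified dynamics *)

Section ComplexDynamics.
Context {R : realType} {d : nat} (T : twist_system R d).
Local Notation C := (Cfield R).
Local Notation VC := 'rV[C]_d.
Local Notation V := 'rV[R]_d.

Definition cFeps (e : C) (z : phase C d) : phase C d := ts_cF T (z.1, z.2 + e *: ts_cdG T z.1).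

(** The inverse of [cFeps e]. Its differentiability yields lower Lipschitz bounds for the iterates
    in [defect_kernel_real]. *)
Definition cFepsi (e : C) (z : phase C d) : phase C d :=
  ((ts_cFi T z).1, (ts_cFi T z).2 - e *: ts_cdG T (ts_cFi T z).1).

Lemma cFepsK e : cancel (cFeps e) (cFepsi e).
Proof. by case=> q p; rewrite /cFepsi /cFeps ts_cFK /= addrK. Qed.

Lemma iter_cFepsK k e : cancel (iter k (cFeps e)) (iter k (cFepsi e)).
Proof. by elim: k => [//|k IH] z; rewrite iterSr iterS cFepsK IH. Qed.

Lemma cFepsE e z : cFeps (rc e) (complexify2 z) = complexify2 (Feps T e z).
Proof.
rewrite /cFeps /= ts_cdGE -complexifyZ -complexifyD.
exact: (ts_cFE T (z.1, z.2 + e *: ts_dG T z.1)).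
Qed.

Lemma iter_cFepsE k e z : iter k (cFeps (rc e)) (complexify2 z) = complexify2 (iter k (Feps T e) z).
Proof. by elim: k => [//|k IH]; rewrite !iterS IH cFepsE. Qed.

Lemma differentiable_cFepsi e z : differentiable (cFepsi e) z.
Proof.
have dFi := ts_cFi_diff T z.
have d1 : differentiable (fun z => (ts_cFi T z).1) z.
  exact: (differentiable_compf dFi (differentiable_fstf _)).
have d2 : differentiable (fun z => (ts_cFi T z).2) z.
  exact: (differentiable_compf dFi (differentiable_sndf _)).
apply: differentiable_pairf; first exact: d1.
apply: differentiable_subf; first exact: d2.
apply: differentiable_scalef.
exact: (@differentiable_compf _ _ _ _ (fun z => (ts_cFi T z).1) (ts_cdG T) z d1 (ts_cdG_diff T _)).
Qed.

Lemma differentiable_iter_cFepsi k e z : differentiable (iter k (cFepsi e)) z.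
Proof.
elim: k => [|k IH]; first exact: differentiable_idf.
exact: (@differentiable_compf _ _ _ _ (iter k (cFepsi e)) (cFepsi e) z IH (differentiable_cFepsi _ _)).
Qed.

(** The parameter is one of the variables, so that a single use of the implicit function theorem
    gives holomorphy in [e] and Lipschitz dependence on [q]. *)
Definition flow k (w : ((C * VC) * VC)%type) : phase C d := iter k (cFeps w.1.1) (w.1.2, w.2).

Lemma differentiable_flow k w : differentiable (flow k) w.
Proof.
have p1 : differentiable (fun w : ((C * VC) * VC)%type => w.1) w by exact: differentiable_fstf.
have pe : differentiable (fun w : ((C * VC) * VC)%type => w.1.1) w.
  exact: (@differentiable_compf _ _ _ _ (fun w : ((C * VC) * VC)%type => w.1) (fun w => w.1) w p1 (differentiable_fstf _)).
have pq : differentiable (fun w : ((C * VC) * VC)%type => w.1.2) w.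
  exact: (@differentiable_compf _ _ _ _ (fun w : ((C * VC) * VC)%type => w.1) (fun w => w.2) w p1 (differentiable_sndf _)).
have pp : differentiable (fun w : ((C * VC) * VC)%type => w.2) w by exact: differentiable_sndf.
elim: k => [|k IH]; first by apply: differentiable_pairf; [exact: pq|exact: pp].
have i1 : differentiable (fun w => (flow k w).1) w.
  exact: (differentiable_compf IH (differentiable_fstf _)).
have i2 : differentiable (fun w => (flow k w).2) w.
  exact: (differentiable_compf IH (differentiable_sndf _)).
have ig : differentiable (fun w => ts_cdG T (flow k w).1) w.
  exact: (@differentiable_compf _ _ _ _ (fun w => (flow k w).1) (ts_cdG T) w i1 (ts_cdG_diff T _)).
apply: (@differentiable_compf _ _ _ _ (fun w => ((flow k w).1, (flow k w).2 + w.1.1 *: ts_cdG T (flow k w).1)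
  : phase C d) (ts_cF T) w _ (ts_cF_diff T _)).
apply: differentiable_pairf; first exact: i1.
apply: differentiable_addv; first exact: i2.
apply: differentiable_scalev; first exact: pe.
by move=> i; exact: (differentiable_rv _ ig).
Qed.

Lemma flowE k e z : flow k (rc e, complexify z.1, complexify z.2) = complexify2 (iter k (Feps T e) z).
Proof. exact: iter_cFepsE. Qed.

End ComplexDynamics.

(** * The holomorphic branch of initial momenta *)

Section Branch.
Context {R : realType} {d : nat} (T : twist_system R d) (m : 'rV[int]_d) (n : nat).
Context (n_gt0 : (0 < n)%N).
Local Notation C := (Cfield R).
Local Notation VC := 'rV[C]_d.
Local Notation V := 'rV[R]_d.
Local Notation mv := (intv R m).
Local Notation Fe := (Feps T).
Local Notation p_out := (p_out T).
Local Notation calibrated := (calibrated T m n).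
Local Notation minimizer := (minimizer T m n).
Local Notation flow := (flow T n).
Implicit Types (q Q p P h u v : V) (x y : nat -> V) (e a : R).

(** Only the position is asked to return to its translate by [m]: these are as many equations as
    there are unknown momenta, as the implicit function theorem wants. *)
Definition defect (w : ((C * VC) * VC)%type) : VC := (flow w).1 - w.1.2 - complexify mv.

Lemma differentiable_defect w : differentiable defect w.
Proof.
have p1 : differentiable (fun w : ((C * VC) * VC)%type => w.1) w by exact: differentiable_fstf.
apply: differentiable_subf; last exact: differentiable_cstf.
apply: differentiable_subf.
  exact: (differentiable_compf (@differentiable_flow R d T n w) (differentiable_fstf _)).
exact: (@differentiable_compf _ _ _ _ (fun w : ((C * VC) * VC)%type => w.1) (fun w => w.2) w p1 (differentiable_sndf _)).
Qed.

Lemma defectE e q p : defect (rc e, complexify q, complexify p) =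
  complexify ((iter n (Fe e) (q, p)).1 - q - mv).
Proof. by rewrite /defect (flowE T n e (q, p)) /= -!complexifyB. Qed.

Lemma pairBr (A B : zmodType) (a : A) (b b' : B) : (a, b) - (a, b') = (0, b - b').
Proof. by rewrite -[LHS]/(a - a, b - b') subrr. Qed.

Lemma nr_pair0 (A B : normedModType C) (b : B) : nr ((0, b) : (A * B)%type) = nr b.
Proof.
apply/le_anti/andP; split; first by apply: nr_pair_le; rewrite ?nr0 ?nr_ge0.
rewrite -le_rc -!nrE; exact: snd_norm_le.
Qed.

(** For [u] in the kernel, the end position moves by [o(s)] when the momentum moves by [s u]. The
    iterate has a locally Lipschitz inverse, so the end momentum has to move at a definite rate, the
    situation excluded by [nondegenerate_real]. *)
Lemma defect_kernel_real e a q x u : calibrated e a -> minimizer e a q x ->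
  'd defect (rc e, complexify q, complexify (p_out e x 0)) (0, complexify u) = 0 -> u = 0.
Proof.
move=> cal mx; set pb := p_out e x 0; set z0 := (rc e, _, _) => ker.
apply/eqP; rewrite -normr_eq0; apply/negPn/negP => nu0.
have {}nu0 : 0 < `|u| by rewrite lt_def nu0 normr_ge0.
have [_ orb] := minimizer_orbit n_gt0 cal mx; rewrite -/pb in orb.
pose Fn (s : R) := iter n (Fe e) (q, pb + s *: u).
have F0 : Fn 0 = (q + mv, pb) by rewrite /Fn scale0r addr0 orb.
have first_small (eta : R) : 0 < eta -> exists2 r : R, 0 < r & forall s t : R, `|s| < r -> `|t| < r ->
     `|(Fn t).1 - (Fn s).1| <= eta * `|t - s|.
  (* Strict differentiability is used because the bound is wanted between any two small parameters
     [s] and [t]. *)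
  move=> eta0; have [r r0 H] := strict_differentiable z0 differentiable_defect (divr_gt0 eta0 nu0).
  exists (r / `|u|); first by rewrite divr_gt0.
  pose w (s : R) : ((C * VC) * VC)%type := (rc e, complexify q, complexify (pb + s *: u)).
  have wB s t : w t - w s = (0, rc (t - s) *: complexify u).
    rewrite pairBr -complexifyB opprD addrACA subrr add0r -scalerBl complexifyZ//.
  have w0 : z0 = w 0 by rewrite /w scale0r addr0.
  have wr s : `|s| < r / `|u| -> nr (w s - z0) < r.
    by rewrite w0 wB nr_pair0 nrZ nr_rc nr_complexify subr0 ltr_pdivlMr.
  move=> s t /wr sr /wr tr; have := H _ _ tr sr.
  rewrite wB nr_pair0 nrZ nr_rc nr_complexify.
  have -> : 'd defect z0 (0, rc (t - s) *: complexify u) = 0.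
    have -> : ((0 : (C * VC)%type), rc (t - s) *: complexify u) = rc (t - s) *: (0, complexify u).
      by rewrite -[RHS]/(rc (t - s) *: (0 : (C * VC)%type), rc (t - s) *: complexify u) scaler0.
    by rewrite linearZ ker /= scaler0.
  rewrite subr0 !defectE -complexifyB nr_complexify.
  rewrite -/(Fn t) -/(Fn s) subrBB subrr subr0.
  by have -> : eta / `|u| * (`|t - s| * `|u|) = eta * `|t - s| by have nz := lt0r_neq0 nu0; field.
have wn s : `|(q, pb + s *: u) - (q, pb)| = `|s| * `|u|.
  rewrite pairBr addrC addKr; apply/le_anti/andP; split.
    by apply: pair_norm_le; rewrite ?normr0 ?mulr_ge0// normrZ.
  by rewrite -normrZ; exact: snd_norm_le.
have [L1 [r1 [L10 r10 HL1]]] := iter_Feps_lip T e n (q, pb).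
have [L2 [r2 [L20 r20 HL2]]] := differentiable_lipschitz
  (@differentiable_iter_cFepsi R d T n (rc e) (complexify2 (q + mv, pb))).
have L2p : 0 < L2 + 1 by rewrite ltr_wpDl.
(* The whole displacement grows at a rate of at least [|u| / (L2 + 1)], that is [2 * c], of which
   the position takes at most [c]. *)
pose c := `|u| / (2 * (L2 + 1)).
have c0 : 0 < c by rewrite divr_gt0// mulr_gt0.
have [r3 r30 H3] := first_small _ c0.
apply: (@nondegenerate_real R d T m n n_gt0 e a q x u c (L1 * `|u|) cal mx c0 first_small).
have k1 : 0 < L1 + 1 by rewrite ltr_wpDl.
exists (Num.min (r1 / `|u|) (Num.min r3 (r2 / (L1 + 1) / `|u|))).
  by rewrite !lt_min r30 !divr_gt0.
move=> s; rewrite !lt_min !ltr_pdivlMr// => /and3P[s1 s3 s2]; rewrite -/pb -/(Fn s).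
have h1 : `|Fn s - (q + mv, pb)| <= L1 * (`|s| * `|u|).
  by have := HL1 (q, pb + s *: u); rewrite wn orb; apply.
have h2 : `|s| * `|u| <= L2 * `|Fn s - (q + mv, pb)|.
  have := HL2 (complexify2 (Fn s)); rewrite -complexify2B nr_complexify2.
  rewrite -F0 -!iter_cFepsE !iter_cFepsK -complexify2B nr_complexify2 scale0r addr0 wn; apply.
  rewrite F0; apply: le_lt_trans h1 _; apply: le_lt_trans s2.
  by rewrite mulrC ler_wpM2l ?mulr_ge0// lerDl.
have h3 := H3 0 s; rewrite normr0 F0 subr0 in h3; have {}h3 := h3 r30 s3.
have h4 : `|Fn s - (q + mv, pb)| <= `|(Fn s).1 - (q + mv)| + `|(Fn s).2 - pb|.
  by case: (Fn s) => a1 a2; apply: pair_norm_le; rewrite /= ?lerDl ?lerDr.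
apply/andP; split; last first.
  rewrite -mulrA [`|u| * _]mulrC; apply: le_trans h1; case: (Fn s) => a1 a2; exact: snd_norm_le.
have h5 := le_trans h2 (ler_wpM2l L20 (le_trans h4 (lerD h3 (lexx _)))).
have h6 : c * (2 * (L2 + 1)) = `|u| by rewrite /c divfK// gt_eqF// mulr_gt0.
rewrite -(ler_pM2l L2p).
have h7 := mulr_ge0 (ltW c0) (normr_ge0 s).
have h8 := mulr_ge0 L20 (normr_ge0 ((Fn s).2 - pb)).
move: h5; rewrite -h6; move: h7 (normr_ge0 ((Fn s).2 - pb)); clear; lra.
Qed.

(** [defect] is real at real points, hence so are its difference quotients in real directions. *)
Lemma derivative_real e q p u i :
  cim ('d defect (rc e, complexify q, complexify p) (0, complexify u) 0 i : C) = 0.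
Proof.
set z0 := (rc e, _, _); set D := 'd defect z0 _.
apply/eqP; rewrite -normr_le0; apply/ler_addgt0Pr => eta eta0; rewrite add0r.
have u1 : 0 < `|u| + 1 by rewrite ltr_wpDl.
have [r r0 H] := differentiable_nr (differentiable_defect z0) (divr_gt0 eta0 u1).
pose t := r / (2 * (`|u| + 1)); have t0 : 0 < t by rewrite divr_gt0// mulr_gt0.
have tn : nr ((0, rc t *: complexify u) : ((C * VC) * VC)%type) = t * `|u|.
  by rewrite nr_pair0 nrZ nr_rc nr_complexify gtr0_norm.
have tr : t * `|u| < r.
  apply: (@le_lt_trans _ _ (r / 2)); last by rewrite ltr_pdivrMr// ltr_pMr// ltr1n.
  rewrite /t mulrAC ler_pdivrMr ?mulr_gt0// mulrA divfK// ler_wpM2l ?(ltW r0)// lerDl//.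
have := H (0, rc t *: complexify u); rewrite tn => /(_ tr).
have -> : 'd defect z0 (0, rc t *: complexify u) = rc t *: D.
  have -> : ((0 : (C * VC)%type), rc t *: complexify u) = rc t *: (0, complexify u).
    by rewrite -[RHS]/(rc t *: (0 : (C * VC)%type), rc t *: complexify u) scaler0.
  by rewrite linearZ.
have -> : z0 + (0, rc t *: complexify u) = (rc e, complexify q, complexify (p + t *: u)).
  by rewrite -[LHS]/((rc e, complexify q) + 0, complexify p + rc t *: complexify u) addr0 complexifyD complexifyZ.
rewrite !defectE -complexifyB; move: (_ - _ : V) => w h.
have wE : (complexify w - rc t *: D) 0 i = rc (w 0 i) - rc t * D 0 i by rewrite !mxE.
have := le_trans (cim_le _) (le_trans (rv_nr_ge _ i) h).
rewrite wE !creimE mul0r addr0 sub0r normrN normrM (gtr0_norm t0) => h1.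
rewrite -(ler_pM2l t0); apply: le_trans h1 _; rewrite mulrCA ler_wpM2l ?(ltW t0)//.
by rewrite mulrAC ler_pdivrMr// ler_wpM2l ?(ltW eta0)// lerDl.
Qed.

(* The differential is real on real vectors, so its complex kernel is spanned by real vectors. *)
Lemma defect_kernel e a q x (v : VC) : calibrated e a -> minimizer e a q x ->
  'd defect (rc e, complexify q, complexify (p_out e x 0)) (0, v) = 0 -> v = 0.
Proof.
move=> cal mx ker.
pose vr : V := \row_i cre (v 0 i : C); pose vi : V := \row_i cim (v 0 i : C).
have vE : v = complexify vr + cx 0 1 *: complexify vi.
  apply/rowP => i; rewrite !mxE; apply: ceqP; rewrite !creimE; ring.
have kr := @defect_kernel_real e a q x vr cal mx; have ki := @defect_kernel_real e a q x vi cal mx.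
have dr := @derivative_real e q (p_out e x 0) vr; have di := @derivative_real e q (p_out e x 0) vi.
move: ker kr ki dr di; move: ('d defect _) => D ker kr ki dr di.
have Dlin : D (0, v) = D (0, complexify vr) + cx 0 1 *: D (0, complexify vi).
  rewrite {1}vE -linearZ -linearD; congr (D _).
  rewrite -[RHS]/(0 + cx 0 1 *: (0 : (C * VC)%type), complexify vr + cx 0 1 *: complexify vi).
  by rewrite scaler0 addr0.
rewrite Dlin in ker.
have vr0 : vr = 0.
  apply: kr; apply/rowP => i; have := congr1 (fun w : VC => cre (w 0 i : C)) ker.
  rewrite !mxE !creimE di mul0r mul1r subr0 addr0 => h.
  by apply: ceqP; [exact: h|exact: dr].
have vi0 : vi = 0.
  apply: ki; apply/rowP => i; have := congr1 (fun w : VC => cim (w 0 i : C)) ker.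
  rewrite !mxE !creimE dr mul0r mul1r !add0r => h.
  by apply: ceqP; [exact: h|exact: di].
rewrite vE vr0 vi0; apply/rowP => i; rewrite !mxE; apply: ceqP; rewrite !creimE; ring.
Qed.

(** One number [r] serves as radius in [e] and in [q] and, through [r^-1], as bound and Lipschitz
    constant. The property then persists when [r] decreases, as the compactness argument of
    [uniform_branch] requires. *)
Definition branch_at e0 (r : R) (q0 : V) := exists H : C -> V -> VC, [/\
  forall (w : C) q i, nr (w - rc e0) < r -> `|q - q0| < r -> differentiable (fun w => H w q 0 i : C) w,
  forall (w : C) q, nr (w - rc e0) < r -> `|q - q0| < r ->
    nr (H w q) <= r^-1 /\ nr (flow (w, complexify q, H w q)) <= r^-1,
  forall (w : C) q q', nr (w - rc e0) < r -> `|q - q0| < r -> `|q' - q0| < r ->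
    nr (H w q - H w q') <= r^-1 * `|q - q'| &
  forall e a q x, `|e - e0| < r -> `|q - q0| < r -> calibrated e a -> minimizer e a q x ->
    H (rc e) q = complexify (p_out e x 0)].

Lemma branch_at_near e0 r r' q0 q : 0 < r' -> r' <= r / 2 -> `|q - q0| < r / 2 ->
  branch_at e0 r q0 -> branch_at e0 r' q.
Proof.
move=> r'0 r'r qr [H [H1 H2 H3 H4]]; exists H.
have rr : r' <= r by move: r'0 r'r; lra.
have r0 : 0 < r by apply: lt_le_trans rr.
have inr' (w : C) : nr (w - rc e0) < r' -> nr (w - rc e0) < r by move/lt_le_trans; apply.
have inq q' : `|q' - q| < r' -> `|q' - q0| < r.
  move=> h; have -> : q' - q0 = (q' - q) + (q - q0) by rewrite subrKA.
  by apply: le_lt_trans (ler_normD _ _) _; move: h qr r'r; clear; lra.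
have ri : r^-1 <= r'^-1 by rewrite lef_pV2.
split.
- by move=> w q' i wr qr'; apply: H1; [exact: inr'|exact: inq].
- move=> w q' wr qr'; have [h1 h2] := H2 w q' (inr' w wr) (inq _ qr').
  by split; apply: le_trans ri.
- move=> w q1 q2 wr qr1 qr2; apply: le_trans (H3 w _ _ (inr' w wr) (inq _ qr1) (inq _ qr2)) _.
  by rewrite ler_wpM2r.
- move=> e a q' x er qr'; apply: H4; [exact: lt_le_trans er rr|exact: inq].
Qed.

(** The implicit function theorem applies at the minimizer through [q0] by [defect_kernel]. By
    [minimizer_close] the minimizers for nearby calibrated parameters have momenta in the ball where
    the zero of [defect] is unique, so the branch passes through them. *)
Lemma exists_branch e0 a0 q0 : calibrated e0 a0 -> exists2 r : R, 0 < r & branch_at e0 r q0.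
Proof.
move=> cal; have [x0 mx0] : exists x, minimizer e0 a0 q0 x by have [+ _] := cal; apply.
pose pb := p_out e0 x0 0; pose z0 : (C * VC)%type := (rc e0, complexify q0).
have defect0 e a q x : calibrated e a -> minimizer e a q x ->
    defect (rc e, complexify q, complexify (p_out e x 0)) = 0.
  move=> c mx; rewrite defectE (minimizer_orbit n_gt0 c mx).2 /=.
  rewrite addrAC addrK addrC addNr; apply/rowP => i; rewrite complexifyE !mxE//.
have ker0 (v : VC) : 'd defect (rc e0, complexify q0, complexify pb) (0, v) = 0 -> v = 0.
  exact: defect_kernel cal mx0.
have [r1 [rho [L [h [r10 rho0 h1 h2 [h3 h4]]]]]] := implicit_function differentiable_defect
  (defect0 _ _ _ _ cal mx0) ker0.
rewrite -/pb -/z0 in h1 h2 h3 h4.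
have [r2 r20 close] := minimizer_close n_gt0 rho0 cal mx0.
have [L3 [r3 [L30 r30 H3]]] := differentiable_lipschitz (differentiable_flow T n (z0, complexify pb)).
have hz0 : h z0 = complexify pb.
  by apply/esym/h2; rewrite ?subrr ?nr0//; exact: defect0 cal mx0.
pose B := (L3 * r3 + nr (flow (z0, complexify pb))) + (rho + nr (complexify pb)) + `|L|.
have B1' : L3 * r3 + nr (flow (z0, complexify pb)) <= B.
  by rewrite /B -addrA lerDl !addr_ge0 ?nr_ge0// ltW.
have B2' : rho + nr (complexify pb) <= B.
  by rewrite /B addrAC lerDr !addr_ge0 ?nr_ge0 ?mulr_ge0// ltW.
have B0 : 0 <= B by rewrite !addr_ge0 ?nr_ge0 ?mulr_ge0// ltW.
have B1 : 0 < B + 1 by rewrite ltr_wpDl.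
have L1 : 0 < `|L| + 1 by rewrite ltr_wpDl.
pose r := Num.min (Num.min r1 r2) (Num.min (r3 / (`|L| + 1)) (B + 1)^-1).
have r0 : 0 < r by rewrite !lt_min r10 r20 invr_gt0 B1 divr_gt0.
have rr1 : r <= r1 by rewrite !ge_min lexx.
have rr2 : r <= r2 by rewrite !ge_min lexx orbT.
have rr3 : r * (`|L| + 1) <= r3 by rewrite -ler_pdivlMr// !ge_min lexx !orbT.
have rB : B <= r^-1.
  apply: (@le_trans _ _ (B + 1)); first by rewrite lerDl.
  by rewrite -[leLHS]invrK lef_pV2 ?posrE ?invr_gt0// !ge_min lexx !orbT.
have zr (w : C) q (t : R) : nr (w - rc e0) < t -> `|q - q0| < t -> nr ((w, complexify q) - z0) < t.
  by move=> wr qr; apply: nr_pair_lt => //; rewrite -complexifyB nr_complexify.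
have zr1 (w : C) q : nr (w - rc e0) < r -> `|q - q0| < r -> nr ((w, complexify q) - z0) < r1.
  by move=> wr qr; apply: zr; exact: lt_le_trans rr1.
exists r => //; exists (fun w q => h (w, complexify q)); split.
- move=> w q i wr qr.
  apply: (@differentiable_compf _ _ _ _ (fun w : C => (w, complexify q)) (fun z => h z 0 i : C) w).
    by apply: differentiable_pairf; [exact: differentiable_idf|exact: differentiable_cstf].
  by apply: h4; exact: zr1.
- move=> w q wr qr; have [_ hp] := h1 _ (zr1 w q wr qr).
  split; apply: le_trans rB.
    apply: le_trans B2'; rewrite -[h _](subrK (complexify pb)).
    by apply: le_trans (nrD _ _) _; rewrite lerD2r ltW.
  have wz : nr ((w, complexify q, h (w, complexify q)) - (z0, complexify pb)) < r3.
    have zz := zr w q r wr qr.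
    apply: nr_pair_lt.
      apply: lt_le_trans zz _; apply: le_trans rr3; rewrite ler_peMr ?(ltW r0)// lerDr//.
    rewrite -hz0; have := h3 _ z0 (zr1 w q wr qr); rewrite subrr nr0 => /(_ r10) hl.
    apply: le_lt_trans hl _; apply: lt_le_trans rr3.
    have LL := ler_norm L; have nz := nr_ge0 ((w, complexify q) - z0).
    have := ler_wpM2r nz LL; have := ler_wpM2l (normr_ge0 L) (ltW zz).
    move: r0; clear; lra.
  apply: le_trans B1'; rewrite -[flow (w, _, _)](subrK (flow (z0, complexify pb))).
  apply: le_trans (nrD _ _) _; rewrite lerD2r; apply: le_trans (H3 _ wz) _.
  by rewrite ler_wpM2l// ltW.
- move=> w q q' wr qr q'r; apply: le_trans (h3 _ _ (zr1 w q wr qr) (zr1 w q' wr q'r)) _.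
  rewrite pairBr nr_pair0 -complexifyB nr_complexify ler_wpM2r//.
  apply: le_trans (ler_norm L) (le_trans _ rB); rewrite /B lerDr !addr_ge0 ?nr_ge0 ?mulr_ge0// ltW//.
- move=> e a q x er qr c mx; apply/esym/h2.
  + by apply: zr1 => //; rewrite -rcB nr_rc.
  + rewrite -complexifyB nr_complexify; apply: (close e a q x) => //; exact: lt_le_trans rr2.
  + exact: defect0 c mx.
Qed.

(** Compactness of the unit ball, which contains an integer translate of every point. *)
Lemma uniform_branch e0 a0 : calibrated e0 a0 ->
  exists2 r : R, 0 < r & forall q, `|q| <= 1 -> branch_at e0 r q.
Proof.
move=> cal.
pose P (k : nat) q := branch_at e0 k.+1%:R^-1 q.
have /compact_near_coveringP/(_ nat \oo P _) := @closed_ball_compact R d 1.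
case=> [q _|N _ HN]; last by exists N.+1%:R^-1; [rewrite invr_gt0|move=> q; exact: (HN N (leqnn N))].
have [r r0 Hr] := exists_branch q cal.
have r2 : 0 < r / 2 by rewrite divr_gt0.
exists (ball q (r / 2), [set k | k.+1%:R^-1 <= r / 2]).
  split; first exact: nbhsx_ballx.
  exists (Num.truncn (r / 2)^-1) => // k /= hk.
  rewrite invf_ple ?posrE// ltW//; apply: lt_le_trans (truncnS_gt _) _.
  by rewrite ler_nat ltnS.
move=> [q' k] /= [qq kr]; apply: branch_at_near Hr => //.
by move: qq; rewrite -ball_normE /= distrC.
Qed.

End Branch.

(** * Combinations and limits of gradients *)

Section GradientLimits.
Context {R : realType} {d : nat}.
Local Notation V := 'rV[R]_d.
Implicit Types (f g : V -> R) (q h c : V).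

Lemma gradient_add f g q c c' : gradient_at f q c -> gradient_at g q c' ->
  gradient_at (fun q => f q + g q) q (c + c').
Proof.
move=> Hf Hg eta eta0; have e2 : 0 < eta / 2 by rewrite divr_gt0.
have [r1 r10 H1] := Hf _ e2; have [r2 r20 H2] := Hg _ e2.
exists (Num.min r1 r2); first by rewrite lt_min r10.
move=> h; rewrite lt_min => /andP[/H1 h1 /H2 h2].
have -> : f (q + h) + g (q + h) - (f q + g q) - dot (c + c') h =
  (f (q + h) - f q - dot c h) + (g (q + h) - g q - dot c' h) by rewrite dotDl; ring.
by apply: le_trans (ler_normD _ _) _; move: h1 h2; clear; lra.
Qed.

Lemma gradient_scale (k b : R) f q c : gradient_at f q c ->
  gradient_at (fun q => k * (f q - b)) q (k *: c).
Proof.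
move=> Hf eta eta0; have k1 : 0 < `|k| + 1 by rewrite ltr_wpDl.
have [r r0 H] := Hf _ (divr_gt0 eta0 k1); exists r => // h /H h1.
have -> : k * (f (q + h) - b) - k * (f q - b) - dot (k *: c) h = k * (f (q + h) - f q - dot c h).
  by rewrite dotZl; ring.
rewrite normrM; apply: le_trans (ler_wpM2l (normr_ge0 k) h1) _.
rewrite mulrA ler_wpM2r// mulrA ler_pdivrMr// mulrC ler_wpM2l ?(ltW eta0)//.
by rewrite lerDl.
Qed.

Lemma gradient_const (b : R) q : gradient_at (fun=> b) q 0.
Proof. by move=> eta eta0; exists 1 => // h _; rewrite subrr dot0l subr0 normr0 mulr_ge0// ltW. Qed.

(** The potentials are normalized at 0 so that their combinations vanish there, as [gradient_limit]
    requires. *)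
Lemma gradient_lincomb (s : seq R) (k : R -> R) (u : R -> V -> R) (g : R -> V -> V) q :
  (forall a, a \in s -> gradient_at (u a) q (g a q)) ->
  gradient_at (fun q => \sum_(a <- s) k a * (u a q - u a 0)) q (\sum_(a <- s) k a *: g a q).
Proof.
elim: s => [|a s IH] H.
  rewrite big_nil (_ : (fun q => _) = fun=> 0); first exact: gradient_const.
  by apply/funext => z; rewrite big_nil.
rewrite big_cons (_ : (fun q => _) = fun q => k a * (u a q - u a 0) + \sum_(a <- s) k a * (u a q - u a 0)).
  apply: gradient_add; first by apply: gradient_scale; apply: H; rewrite mem_head.
  by apply: IH => b bs; apply: H; rewrite inE bs orbT.
by apply/funext => z; rewrite big_cons.
Qed.

Lemma rv_complete (u : nat -> V) (b : nat -> R) :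
  (forall k l, `|u k - u l| <= b k + b l) -> exists v, forall k, `|u k - v| <= b k.
Proof.
move=> H; have b0 k : 0 <= b k by have := le_trans (normr_ge0 _) (H k k); clear; lra.
have /choice[f Hf] : forall i, exists t : R, forall k, u k 0 i - b k <= t <= u k 0 i + b k.
  move=> i; apply: (@interval_choice R nat (fun k => u k 0 i - b k) (fun k => u k 0 i + b k) 0%N) => k l.
  have := rv_norm_ge (u k - u l) i; rewrite !mxE => h1; have := le_trans h1 (H k l).
  by rewrite ler_norml => /andP[_]; clear; lra.
exists (\row_i f i) => k; apply: rv_norm_le => // i; rewrite !mxE.
by have := Hf i k; rewrite ler_norml; clear; lra.
Qed.

(** Uniform closeness of the gradients makes the differences [U k - U l] Lipschitz with small
    constants. As all potentials vanish at 0 they converge, and the Lipschitz bounds pass to the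
    limit. *)
Lemma gradient_limit (U : nat -> V -> R) (g : nat -> V -> V) (gamma : V -> V) (B : R) : 0 <= B ->
  (forall k q, gradient_at (U k) q (g k q)) -> (forall k, U k 0 = 0) ->
  (forall k q, `|g k q - gamma q| <= B * k.+1%:R^-1) ->
  exists W, forall q, gradient_at W q (gamma q).
Proof.
move=> B0 HU U0 Hg.
pose b (k : nat) : R := B * k.+1%:R^-1.
have lip k l q h : `|(U k (q + h) - U l (q + h)) - (U k q - U l q)| <= d%:R * (b k + b l) * `|h|.
  have := @gradient_lipschitz R d (fun q => U k q + -1 * (U l q - 0)) (fun q => g k q + -1 *: g l q)
    (b k + b l) (fun z => gradient_add (HU k z) (gradient_scale (-1) 0 (HU l z))).
  move=> /(_ _ (q + h) q); rewrite (addrC q h) addrK !subr0 !mulN1r; apply=> z.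
  rewrite scaleN1r; have -> : g k z - g l z = (g k z - gamma z) - (g l z - gamma z).
    by rewrite opprB addrA subrK.
  by apply: le_trans (ler_normB _ _) _; apply: lerD; exact: Hg.
have /choice[W HW] : forall q, exists w : R, forall k,
   U k q - d%:R * b k * `|q| <= w <= U k q + d%:R * b k * `|q|.
  move=> q; apply: (@interval_choice R nat (fun k => U k q - d%:R * b k * `|q|) (fun k => U k q + d%:R * b k * `|q|) 0%N) => k l.
  have := lip k l 0 q; rewrite add0r !U0 subrr subr0 ler_norml => /andP[_].
  by rewrite mulrDr mulrDl; clear; lra.
have limit k q h : `|(U k (q + h) - W (q + h)) - (U k q - W q)| <= d%:R * b k * `|h|.
  apply: (@small_of_inv _ _ _ (d%:R * B * (`|h| + `|q + h| + `|q|))) => l.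
  have h1 := lip k l q h; have h2 := HW (q + h) l; have h3 := HW q l.
  have -> : d%:R * b k * `|h| + d%:R * B * (`|h| + `|q + h| + `|q|) / l.+1%:R =
     d%:R * b k * `|h| + d%:R * b l * `|h| + d%:R * b l * `|q + h| + d%:R * b l * `|q|.
    by rewrite /b; ring.
  move: h1 h2 h3; rewrite mulrDr mulrDl !ler_norml; clear; lra.
exists W => q eta eta0; pose N := d%:R * B + d%:R * B.
have N0 : 0 <= N by rewrite addr_ge0 ?mulr_ge0.
have e2 : 0 < eta / 2 by rewrite divr_gt0.
have [k kN] : exists k : nat, N * k.+1%:R^-1 <= eta / 2.
  exists (Num.truncn (N / (eta / 2))); rewrite ler_pdivrMr// mulrC -ler_pdivrMr//.
  exact/ltW/truncnS_gt.
have [r r0 Hr] := HU k q _ e2; exists r => // h hr.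
have h1 := Hr h hr; have h2 := limit k q h.
have h3 : `|dot (g k q - gamma q) h| <= d%:R * b k * `|h|.
  by apply: le_trans (dot_bound _ _) _; rewrite ler_wpM2r// ler_wpM2l//; exact: Hg.
have -> : W (q + h) - W q - dot (gamma q) h = (U k (q + h) - U k q - dot (g k q) h) -
   ((U k (q + h) - W (q + h)) - (U k q - W q)) + dot (g k q - gamma q) h by rewrite dotBl; ring.
apply: le_trans (ler_normD _ _) _; apply: le_trans (lerD (ler_normB _ _) h3) _.
have h4 : d%:R * b k * `|h| + d%:R * b k * `|h| <= eta / 2 * `|h|.
  by rewrite -mulrDl ler_wpM2r//; move: kN; rewrite /N mulrDl /b !mulrA.
move: h1 h2 h4; clear; lra.
Qed.

Lemma half_pow_le (k : nat) : (2^-1 : R) ^+ k <= k.+1%:R^-1.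
Proof.
rewrite exprVn lef_pV2 ?posrE ?exprn_gt0// -natrX ler_nat; exact: ltn_expl.
Qed.

End GradientLimits.

(** * Extension of invariant tori near an accumulation point *)

Section Continuation.
Context {R : realType} {d : nat} (T : twist_system R d) (m : 'rV[int]_d) (n : nat).
Context (n_gt0 : (0 < n)%N).
Local Notation C := (Cfield R).
Local Notation VC := 'rV[C]_d.
Local Notation V := 'rV[R]_d.
Local Notation mv := (intv R m).
Local Notation Fe := (Feps T).
Local Notation p_out := (p_out T).
Local Notation calibrated := (calibrated T m n).
Local Notation minimizer := (minimizer T m n).
Local Notation torus_graph := (torus_graph T m n).
Local Notation flow := (flow T n).
Implicit Types (q Q p P h u v : V) (x y : nat -> V) (e a : R).

Definition good e := exists gamma U, torus_graph e gamma U.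

Lemma torus_minimizer e gamma U : torus_graph e gamma U -> exists a, calibrated e a /\
  forall q, exists2 x, minimizer e a q x & p_out e x 0 = gamma q.
Proof.
move=> tg; have [a [cal xa]] := torus_calibrated n_gt0 tg; exists a; split => // q.
have [_ _ _ _ gn] := tg.
exists (fun i => (iter i (Fe e) (q, gamma q)).1); first by split => //; rewrite gn.
by have [-> _] := EL_of_orbit T e (q, gamma q) 0.
Qed.

Lemma nr_small (W : normedModType C) (v : W) (B : R) : (forall k : nat, nr v <= B * k.+1%:R^-1) -> v = 0.
Proof.
move=> H; apply/eqP; rewrite -nr_eq0; apply/eqP/le_anti; rewrite nr_ge0 andbT.
by apply: (@small_of_inv _ _ _ B) => k; rewrite add0r.
Qed.

(** Each new node is closer to 0 than the earlier ones and than a nonzero [z], hence distinct from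
    them; for [z = 0] the condition [a != 0] suffices. *)
Lemma good_nodes e0 (z dl : R) : 0 < dl ->
  (forall eta : R, 0 < eta -> exists a : R, [/\ a != 0, `|a| < eta & good (e0 + a)]) ->
  forall k, exists s : seq R, [/\ size s = k, uniq s, z \notin s &
    forall a, a \in s -> `|a| <= dl /\ good (e0 + a)].
Proof.
move=> dl0 H; suff main k : exists s : seq R, [/\ size s = k, uniq s, z \notin s &
    forall a, a \in s -> [/\ a != 0, `|a| <= dl & good (e0 + a)]].
  move=> k; have [s [h1 h2 h3 h4]] := main k; exists s; split => // a /h4[]//.
elim: k => [|k [s [s1 s2 s3 s4]]]; first by exists [::].
pose eta := \big[Num.min/Num.min dl (if z == 0 then dl else `|z|)]_(a <- s) `|a|.
have [eta0 [etadl etaz]] : 0 < eta /\ (eta <= dl /\ (z != 0 -> eta <= `|z|)).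
  rewrite /eta; elim: s s4 {s1 s2 s3 eta} => [|a s IH] s4.
    rewrite big_nil lt_min dl0 ge_min lexx; split.
      by case: eqVneq => // z0; rewrite normr_gt0.
    by split=> // /negbTE ->; rewrite ge_min lexx orbT.
  have [|i1 [i2 i3]] := IH; first by move=> b bs; apply: s4; rewrite inE bs orbT.
  have [a0 _ _] := s4 a (mem_head _ _).
  rewrite big_cons lt_min normr_gt0 a0 i1 !ge_min i2 orbT; split => //; split=> // z0.
  by rewrite i3 ?orbT.
have etas a : a \in s -> eta <= `|a|.
  by move=> as_; rewrite /eta; elim: s as_ {s1 s2 s3 s4 eta eta0 etadl etaz} => // b s IH;
    rewrite inE big_cons ge_min => /orP[/eqP ->|/IH ->]; rewrite ?lexx ?orbT.
have [a [a0 aeta ga]] := H eta eta0.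
have anotin : a \notin s by apply/negP => /etas; rewrite leNgt aeta.
exists (a :: s); split; rewrite /= ?s1 ?s2 ?anotin//.
  rewrite inE negb_or s3 andbT; apply/negP => /eqP za.
  by move: aeta; rewrite -za ltNge etaz// za.
move=> b; rewrite inE => /orP[/eqP ->|/s4//]; split => //.
exact: le_trans (ltW aeta) etadl.
Qed.

Lemma iter_Feps_per e k q p N : iter N (Fe e) (q + intv R k, p) =
  ((iter N (Fe e) (q, p)).1 + intv R k, (iter N (Fe e) (q, p)).2).
Proof. by elim: N => [//|N IH]; rewrite !iterS IH Feps_per -surjective_pairing. Qed.

(** Interpolation at [k] nodes has an error of at most [M / 2^k] at [e0 + z], with [M] independent
    of [q] for the momenta. The interpolated graphs [app k] are gradients and therefore converge
    uniformly to a gradient. *)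
Lemma good_extends e0 :
  (forall eta : R, 0 < eta -> exists a : R, [/\ a != 0, `|a| < eta & good (e0 + a)]) ->
  exists2 r : R, 0 < r & forall z, `|z| <= r -> good (e0 + z).
Proof.
move=> acc.
have [a0 cal0] : exists a, calibrated e0 a.
  apply: calibrated_closed => // eta /acc[a [_ aeta [gamma [U tg]]]].
  have [b [cal _]] := torus_minimizer tg.
  by exists (e0 + a), b; split => //; rewrite addrC addKr.
have [r r0 Hbr] := uniform_branch n_gt0 cal0.
exists (r / 36); first by rewrite divr_gt0.
move=> z zr.
have /choice[g Hg] : forall a, exists gU : (V -> V) * (V -> R), good (e0 + a) -> torus_graph (e0 + a) gU.1 gU.2.
  move=> a; have [[gamma [U tg]]|ng] := pselect (good (e0 + a)); first by exists (gamma, U).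
  by exists (fun=> 0, fun=> 0).
have /choice[s Hs] := good_nodes z (divr_gt0 r0 (ltr0n _ 36) : 0 < r / 36) acc.
have /choice[c Hc] : forall k, exists c : R -> R, forall f, interp (s k) f z = \sum_(a <- s k) rc (c a) * f (rc a).
  by move=> k; apply: interp_linear; have [] := Hs k.
pose app k q := \sum_(a <- s k) c k a *: (g a).1 q.
have snode k a : a \in s k -> [/\ `|a| <= r / 36, `|e0 + a - e0| < r & torus_graph (e0 + a) (g a).1 (g a).2].
  move=> ask; have [_ _ _ /(_ a ask)[ar ga]] := Hs k; split; [exact: ar| |exact: Hg].
  by rewrite addrC addKr; apply: le_lt_trans ar _; rewrite ltr_pdivrMr// ltr_pMr// ltr1n.
have appE k q i : rc (app k q 0 i) = \sum_(a <- s k) rc (c k a) * rc ((g a).1 q 0 i).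
  rewrite /app; elim: (s k) => [|a l IH]; first by rewrite !big_nil mxE.
  by rewrite !big_cons !mxE rcD rcM IH.
have decay (f : C -> C) (M : R) : 0 <= M ->
    (forall w : C, nr (w - rc e0) < r -> differentiable f w /\ nr (f w) <= M) ->
    forall k, nr (f (rc (e0 + z)) - \sum_(a <- s k) rc (c k a) * f (rc (e0 + a))) <= M * k.+1%:R^-1.
  move=> M0 fM k; have [sk us zs sr] := Hs k.
  have sr' a : a \in s k -> `|a| <= r / 36 by move=> /sr[].
  apply: le_trans (interp_disc r0 fM zr sr' us zs (Hc k)) _.
  by rewrite ler_wpM2l// sk half_pow_le.
have ri0 : 0 <= r^-1 by rewrite invr_ge0 ltW.
have node_branch (H : C -> V -> VC) q0 (H4 : forall e a q x, `|e - e0| < r -> `|q - q0| < r ->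
    calibrated e a -> minimizer e a q x -> H (rc e) q = complexify (p_out e x 0)) k a q :
    a \in s k -> `|q - q0| < r -> H (rc (e0 + a)) q = complexify ((g a).1 q).
  move=> /snode[_ ar /torus_minimizer[b [cal /(_ q)[x mx <-]]]] qr.
  exact: H4 cal mx.
(* Only [q0] in the unit ball is treated, where the radius [r] is uniform; other points are reached
   by the periodicity of [app k]. *)
have key q0 : `|q0| <= 1 -> exists H : C -> V -> VC, [/\
   forall k q, `|q - q0| < r -> nr (H (rc (e0 + z)) q - complexify (app k q)) <= r^-1 * k.+1%:R^-1,
   forall q, `|q - q0| < r -> nr (H (rc (e0 + z)) q) <= r^-1,
   forall q q', `|q - q0| < r -> `|q' - q0| < r ->
     nr (H (rc (e0 + z)) q - H (rc (e0 + z)) q') <= r^-1 * `|q - q'| &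
   flow (rc (e0 + z), complexify q0, H (rc (e0 + z)) q0) = (complexify (q0 + mv), H (rc (e0 + z)) q0)].
  move=> q01; have [H [H1 H2 H3 H4]] := Hbr q0 q01.
  have zin : nr (rc (e0 + z) - rc e0) < r.
    by rewrite -rcB nr_rc addrC addKr; apply: le_lt_trans zr _; rewrite ltr_pdivrMr// ltr_pMr// ltr1n.
  have q0r : `|q0 - q0| < r by rewrite subrr normr0.
  exists H; split.
  - move=> k q qr; apply: rv_nr_le; first by rewrite mulr_ge0 ?invr_ge0// ltW.
    move=> i; have := decay (fun w => H w q 0 i) r^-1 ri0.
    have -> : (H (rc (e0 + z)) q - complexify (app k q)) 0 i = H (rc (e0 + z)) q 0 i - rc (app k q 0 i).
      by rewrite !mxE.
    rewrite appE => /(_ _ k); rewrite (eq_big_seq (fun a => rc (c k a) * rc ((g a).1 q 0 i))).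
      apply=> w wr; split; first exact: H1.
      by apply: le_trans (rv_nr_ge _ _) _; have [] := H2 w q wr qr.
    by move=> a ask; rewrite (node_branch H q0 H4 k a q ask qr) complexifyE.
  - by move=> q qr; have [] := H2 _ q zin qr.
  - by move=> q q' qr q'r; exact: H3.
  have dpt (w : C) : nr (w - rc e0) < r ->
      differentiable (fun w : C => (w, complexify q0, H w q0) : ((C * VC) * VC)%type) w.
    move=> wr; apply: differentiable_pairf.
      by apply: differentiable_pairf; [exact: differentiable_idf|exact: differentiable_cstf].
    by apply: differentiable_rv_of => i; exact: H1.
  have dflow (w : C) : nr (w - rc e0) < r -> differentiable (fun w : C => flow (w, complexify q0, H w q0)) w.
    move=> wr; exact: (@differentiable_compf _ _ _ _ (fun w : C => (w, complexify q0, H w q0) : ((C * VC) * VC)%type)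
      flow w (dpt w wr) (differentiable_flow _ _ _)).
  have nodes k a : a \in s k -> flow (rc (e0 + a), complexify q0, H (rc (e0 + a)) q0) =
      (complexify (q0 + mv), H (rc (e0 + a)) q0).
    move=> ask; rewrite (node_branch H q0 H4 k a q0 ask q0r).
    by have [_ _ [_ _ _ _ gn]] := snode k a ask; rewrite (flowE T n _ (q0, _)) gn.
  (* The identity theorem in quantitative form: all interpolants of [f] are 0, so the error bound
     applies to [f] itself. *)
  have vanish (f : C -> C) (M : R) : 0 <= M ->
    (forall w : C, nr (w - rc e0) < r -> differentiable f w /\ nr (f w) <= M) ->
    (forall k a, a \in s k -> f (rc (e0 + a)) = 0) -> f (rc (e0 + z)) = 0.
    move=> M0 fM f0; apply: (@nr_small _ _ M) => k; have := decay f M M0 fM k.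
    by rewrite big_seq big1 ?subr0// => a /f0 ->; rewrite mulr0.
  have M0 (v : VC) : 0 <= r^-1 + nr v by rewrite addr_ge0 ?nr_ge0.
  have r20 : 0 <= r^-1 + r^-1 by rewrite addr_ge0.
  rewrite [LHS]surjective_pairing; congr pair; apply/eqP; rewrite -subr_eq0; apply/eqP/rowP => i.
    rewrite [RHS]mxE.
    apply: (@vanish (fun w : C => ((flow (w, complexify q0, H w q0)).1 - complexify (q0 + mv)) 0 i) _ (M0 (complexify (q0 + mv)))).
      move=> w wr; split.
        apply: differentiable_rv; apply: differentiable_subf; last exact: differentiable_cstf.
        exact: (differentiable_compf (dflow w wr) (differentiable_fstf _)).
      apply: le_trans (rv_nr_ge _ _) _; apply: le_trans (nrB _ _) _; rewrite lerD2r.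
      have [_] := H2 w q0 wr q0r; apply: le_trans; rewrite -le_rc -!nrE; case: (flow _) => ? ?; exact: fst_norm_le.
    by move=> k a /nodes ->; rewrite subrr mxE.
  rewrite [RHS]mxE.
  apply: (@vanish (fun w : C => ((flow (w, complexify q0, H w q0)).2 - H w q0) 0 i) _ r20).
    move=> w wr; split.
      apply: differentiable_rv; apply: differentiable_subf.
        exact: (differentiable_compf (dflow w wr) (differentiable_sndf _)).
      by apply: differentiable_rv_of => j; exact: H1.
    apply: le_trans (rv_nr_ge _ _) _; apply: le_trans (nrB _ _) _; have [h1 h2] := H2 w q0 wr q0r.
    apply: lerD h1; apply: le_trans h2; rewrite -le_rc -!nrE; case: (flow _) => ? ?; exact: snd_norm_le.
  by move=> k a /nodes ->; rewrite subrr mxE.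
pose b (k : nat) : R := r^-1 * k.+1%:R^-1.
have app_per k kk q : app k (q + intv R kk) = app k q.
  rewrite /app; apply: eq_big_seq => a ask; have [_ _ [_ gper _ _ _]] := snode k a ask.
  by rewrite gper.
have app_cauchy q k l : `|app k q - app l q| <= b k + b l.
  have [kk /key[H [HA _ _ _]]] := round_rv q.
  have qr : `|q + intv R kk - (q + intv R kk)| < r by rewrite subrr normr0.
  have hk := HA k _ qr; have hl := HA l _ qr; rewrite app_per in hk; rewrite app_per in hl.
  rewrite -nr_complexify complexifyB; apply: le_trans (nr_distD (H (rc (e0 + z)) (q + intv R kk)) _ _) _.
  by rewrite nr_dist; exact: lerD.
have /choice[gamma Hgam] : forall q, exists v, forall k, `|app k q - v| <= b k.
  by move=> q; apply: rv_complete => k l; exact: app_cauchy.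
have gper kk q : gamma (q + intv R kk) = gamma q.
  apply/eqP; rewrite -subr_eq0 -normr_le0.
  apply: (@small_of_inv _ _ _ (r^-1 + r^-1)) => k; rewrite add0r mulrDl.
  rewrite -(subrKA (app k q)); apply: le_trans (ler_normD _ _) _; apply: lerD; last exact: Hgam.
  by rewrite distrC -(app_per k kk); exact: Hgam.
(* At the real parameter [e0 + z] the complex branch is a limit of real vectors, hence real. *)
have HE q0 (H : C -> V -> VC) : (forall k q, `|q - q0| < r ->
    nr (H (rc (e0 + z)) q - complexify (app k q)) <= r^-1 * k.+1%:R^-1) ->
    forall q, `|q - q0| < r -> H (rc (e0 + z)) q = complexify (gamma q).
  move=> HA q qr; apply/eqP; rewrite -subr_eq0; apply/eqP/(@nr_small _ _ (r^-1 + r^-1)) => k.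
  apply: le_trans (nr_distD (complexify (app k q)) _ _) _; rewrite mulrDl; apply: lerD; first exact: HA.
  by rewrite -complexifyB nr_complexify; exact: Hgam.
have inr q : `|q - q| < r by rewrite subrr normr0.
have [W HW] : exists W, forall q, gradient_at W q (gamma q).
  apply: (@gradient_limit R d (fun k q => \sum_(a <- s k) c k a * ((g a).2 q - (g a).2 0)) app gamma r^-1) => //.
  - move=> k q; apply: (@gradient_lincomb _ _ (s k) (c k) (fun a => (g a).2) (fun a => (g a).1) q) => a ask; have [_ _ [gU _ _ _ _]] := snode k a ask.
    exact: gU.
  - by move=> k; rewrite big1// => a _; rewrite subrr mulr0.
exists gamma, W; split => //.
- exists r^-1 => q; have [kk k1] := round_rv q; have [H [HA HB _ _]] := key _ k1.
  by have := HB _ (inr _); rewrite (HE _ _ HA _ (inr _)) nr_complexify gper.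
- move=> q; have [kk k1] := round_rv q; have [H [HA _ HC _]] := key _ k1.
  exists r^-1, r; split => // w wr.
  have wr' : `|w + intv R kk - (q + intv R kk)| < r by rewrite opprD addrACA subrr addr0.
  have := HC _ _ wr' (inr _); rewrite !(HE _ _ HA _ _)// -complexifyB nr_complexify !gper.
  by rewrite opprD addrACA subrr addr0.
- move=> q; have [kk k1] := round_rv q; have [H [HA _ _ HD]] := key _ k1.
  move: HD; rewrite (HE _ _ HA _ (inr _)) (flowE T n _ (q + intv R kk, gamma (q + intv R kk))) gper.
  rewrite iter_Feps_per => -[/complexify_inj h1 /complexify_inj h2].
  rewrite [LHS]surjective_pairing h2; congr pair.
  by apply: (addIr (intv R kk)); rewrite h1 addrAC.
Qed.

End Continuation.

(** * Unboundedness of the good parameters and rigidity *)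

Section Core.
Context {R : realType} {d : nat} (T : twist_system R d) (m : 'rV[int]_d) (n : nat).
Context (n_gt0 : (0 < n)%N).
Local Notation good := (good T m n).
Implicit Types (e a t s : R).

Definition limit_of_good e := forall eta : R, 0 < eta -> exists a : R, [/\ a != 0, `|a| < eta & good (e + a)].

Lemma good_unbounded e0 : limit_of_good e0 -> forall A : R, exists e, A < `|e| /\ good e.
Proof.
move=> acc0 A; apply: contrapT => bad.
have bnd e : good e -> `|e| <= A.
  by move=> ge; rewrite leNgt; apply/negP => Ae; apply: bad; exists e.
pose E := [set t : R | e0 <= t /\ forall s, e0 <= s <= t -> good s].
have [r0 r00 Hr0] := good_extends n_gt0 acc0.
have E0 : E (e0 + r0).
  split=> [|s /andP[s1 s2]]; first by rewrite lerDl ltW.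
  by rewrite -(subrKC e0 s); apply: Hr0; rewrite ger0_norm ?subr_ge0// lerBlDl.
have hsE : has_sup E.
  split; first by exists (e0 + r0).
  exists A => t [et Ht]; apply: le_trans (ler_norm t) (bnd _ _).
  by apply: Ht; rewrite et lexx.
pose tau := sup E.
have tau0 : e0 < tau.
  apply: (@lt_le_trans _ _ (e0 + r0)); first by rewrite ltrDl.
  exact: sup_upper_bound.
have acct : limit_of_good tau.
  move=> eta eta0; pose b := Num.min eta (tau - e0).
  have b0 : 0 < b by rewrite lt_min eta0 subr_gt0.
  have b2 : 0 < b / 2 by rewrite divr_gt0.
  have [t [et Ht] tt] := sup_adherent b2 hsE.
  have bt : b <= tau - e0 by rewrite ge_min lexx orbT.
  have be : b <= eta by rewrite ge_min lexx.
  exists (- (b / 2)); split; first by rewrite oppr_eq0 gt_eqF.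
    by rewrite normrN gtr0_norm//; move: be eta0 b0; clear; lra.
  apply: Ht; move: tt bt b0; rewrite -/tau; clear; lra.
have [r r1 Hr] := good_extends n_gt0 acct.
have [t [et Ht] tt] := sup_adherent r1 hsE.
have : E (tau + r).
  split=> [|s /andP[s1 s2]]; first by move: r1 tau0; clear; lra.
  have [st|ts] := leP s t; first by apply: Ht; rewrite s1 st.
  rewrite -(subrKC tau s); apply: Hr; rewrite ler_norml.
  by move: tt ts s2; rewrite -/tau; clear; lra.
by move=> /(sup_upper_bound hsE); rewrite -/tau leNgt ltrDl r1.
Qed.

Lemma exists_limit_of_good : infinite_set [set e | good e] -> (exists A : R, forall e, good e -> `|e| <= A) ->
  exists e, limit_of_good e.
Proof.
move=> inf [A HA].
have [|e He] := @infinite_bounded_limit_point_nonempty R [set e | good e] inf.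
  exists A; split; first exact: num_real.
  by move=> x Ax e /= /HA h; apply: le_trans h (ltW Ax).
exists e => eta eta0; have [y [ye gy yb]] := He (ball e eta) (nbhsx_ballx e _ eta0).
exists (y - e); split; first by rewrite subr_eq0.
  by move: yb; rewrite -ball_normE /= distrC.
by rewrite subrKC.
Qed.

Lemma rigidity : infinite_set [set e | good e] -> forall q q', ts_G T q = ts_G T q'.
Proof.
move=> inf; apply: (@G_constant R d T m n n_gt0) => A.
suff [e [Ae [gamma [U tg]]]] : exists e, A < `|e| /\ good e.
  by have [a [cal _]] := torus_calibrated n_gt0 tg; exists e, a.
(* The assumption [bad] bounds the good parameters; being infinitely many, they accumulate
   somewhere, and [good_unbounded] then contradicts [bad]. *)
apply: contrapT => bad; apply: (bad).
suff [e0 acc] : exists e, limit_of_good e by exact: good_unbounded acc A.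
apply: exists_limit_of_good => //; exists A => e ge; rewrite leNgt; apply/negP => Ae.
by apply: bad; exists e.
Qed.

End Core.

(** * Twist systems from symplectic twist maps *)

Section Lifts.
Local Open Scope quotient_scope.
Context {R : realType} {d : nat}.
Local Notation V := 'rV[R]_d.
Implicit Types (f : annulus R d -> annulus R d) (F : phase R d -> phase R d).

Lemma int_small (x : R) : x \is a Num.int -> `|x| < 1 -> x = 0.
Proof.
move=> /intrP[k ->]; rewrite -intr_norm ltrz1 => h.
have -> : k = 0 by move: h; case: k => // -[].
by [].
Qed.

(** Along a line the function is locally constant, so its derivative is 0 and the mean value theorem
    applies. *)
Lemma int_valued_const (X : normedModType R) (c : X -> R) : continuous c ->
  (forall x, c x \is a Num.int) -> forall x y, c x = c y.
Proof.
move=> cc cint x y; pose phi (t : R) := c (x + t *: (y - x)).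
have cphi : continuous phi.
  move=> t; apply: (@continuous_comp _ _ _ (fun t : R => x + t *: (y - x)) c); last exact: cc.
  by apply: cvgD; [exact: cvg_cst|exact: scalel_continuous].
have dphi (t : R) : is_derive t 1 phi 0.
  apply: is_derive_small => e e0.
  have /cvgrPdist_lt/(_ 1 ltr01)/nbhs_ballP[r /= r0 Hr] := cphi t.
  exists r => // h hr; rewrite mulr0 subr0.
  have := Hr (t + h); rewrite -ball_normE /= opprD addrA subrr sub0r normrN => /(_ hr).
  rewrite distrC => /int_small ->; first by rewrite normr0 mulr_ge0// ltW.
  by rewrite /phi rpredB// cint.
have [t _] := mean_value 0 1 dphi.
rewrite /phi mul0r scale0r addr0 scale1r subrKC => /eqP; rewrite subr_eq0 => /eqP ->.
by [].
Qed.

Lemma pi_torusP (x y : V) : \pi_(torus R d) x = \pi_(torus R d) y <->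
  exists k : 'rV[int]_d, x = y + intv R k.
Proof.
split=> [/eqmodP/forallP H|[k ->]].
  exists (\row_i Num.floor ((x - y) 0 i)); apply/rowP => i; rewrite !mxE.
  have /intrP[k kE] := H i; move: kE; rewrite !mxE => kE.
  by rewrite kE intrKfloor -kE addrC subrK.
by apply/eqmodP/forallP => i; rewrite addrC addKr !mxE intr_int.
Qed.

(** The coordinates of [A - B] are continuous and integer-valued. The space [X] is arbitrary so that
    the parameter of a family of lifts may be one of the variables. *)
Lemma lifts_differ (X : normedModType R) (A B : X -> V) : continuous A -> continuous B ->
  (forall x, \pi_(torus R d) (A x) = \pi_(torus R d) (B x)) ->
  exists k : 'rV[int]_d, forall x, A x = B x + intv R k.
Proof.
move=> cA cB AB; have [k k0] := (pi_torusP _ _).1 (AB 0); exists k => x.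
apply/rowP => i; rewrite [RHS]mxE; suff -> : intv R k 0 i = A x 0 i - B x 0 i by rewrite subrKC.
have cAB : continuous (fun x => A x 0 i - B x 0 i).
  have cc (D : X -> V) : continuous D -> continuous (fun x => D x 0 i : R).
    by move=> cD z; apply: (@continuous_comp _ _ _ D (fun v : V => v 0 i)); [exact: cD|exact: coord_continuous].
  by move=> z; apply: cvgB; exact: cc.
rewrite (@int_valued_const _ _ cAB _ x 0).
  by rewrite k0 [X in _ = X - _]mxE addrAC subrr add0r.
move=> z; have [k' ->] := (pi_torusP _ _).1 (AB z).
by rewrite [X in X - _]mxE addrAC subrr add0r mxE intr_int.
Qed.

(** Each hypothesis on [f] comes with a lift of its own; this is what brings them to a common
    one. *)
Lemma is_lift_eq f F F' : is_lift f F -> is_lift f F' ->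
  exists k : 'rV[int]_d, forall x, F' x = ((F x).1 + intv R k, (F x).2).
Proof.
move=> [cF HF] [cF' HF'].
have H x : annulus_pi (F' x) = annulus_pi (F x) by rewrite HF HF'.
have [|||k Hk] := @lifts_differ (phase R d) (fun x => (F' x).1) (fun x => (F x).1).
- by move=> x; apply: (continuous_comp (cF' x)); exact: cvg_fst.
- by move=> x; apply: (continuous_comp (cF x)); exact: cvg_fst.
- by move=> x; have [] := H x.
exists k => x; rewrite -Hk; have := H x; rewrite /annulus_pi => -[_ <-].
exact: surjective_pairing.
Qed.

End Lifts.

(** * Momenta as functions of the end positions *)

Section TwistLift.
Context {R : realType} {d : nat} (f : annulus R d -> annulus R d).
Local Notation V := 'rV[R]_d.

(** [p] and [P] are read off the inverse of the twist chart. The chart controls the position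
    component of [F]; the momentum component is differentiable because it is shared with a C^1 lift
    of [f], from which [F] differs by a translation in position. *)
Lemma twist_lift_momenta F S : annulus_C1 f -> twist_lift f F S ->
  exists p P : V -> V -> V, [/\
    forall q y Q Y, F (q, y) = (Q, Y) <-> y = p q Q /\ Y = P q Q,
    forall x : phase R d, differentiable (fun x : phase R d => p x.1 x.2) x,
    forall x : phase R d, differentiable (fun x : phase R d => P x.1 x.2) x &
    forall (x : phase R d) u v,
      'd (S : phase R d -> R^o) x (u, v) = dot (P x.1 x.2) v - dot (p x.1 x.2) u].
Proof.
move=> [F1 [liftF1 [F1d _]]] [liftF Fper [[chd _] [g [gK Kg [gd _]]]] [Sd _ dS]].
have [k Hk] := is_lift_eq liftF liftF1.
have F2E : (fun x => (F x).2) = (fun x => (F1 x).2) by apply/funext => x; rewrite Hk.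
have F2d x : differentiable (fun x => (F x).2) x.
  by rewrite F2E; exact: (differentiable_compf (F1d x) (differentiable_sndf _)).
have F11d x : differentiable (fun x => (F x).1) x.
  exact: (differentiable_compf (chd x) (differentiable_sndf _)).
have g1 x : (g x).1 = x.1 by rewrite -[in RHS](Kg x).
have g2 x : (F (g x)).1 = x.2 by rewrite -[in RHS](Kg x).
exists (fun q Q => (g (q, Q)).2), (fun q Q => (F (g (q, Q))).2).
have gE x : g (x.1, x.2) = g x by rewrite -surjective_pairing.
split.
- move=> q y Q Y; split=> [E|[-> ->]].
    have gq : g (q, Q) = (q, y) by rewrite -[RHS]gK /twist_chart /= E.
    by rewrite gq E.
  have -> : (q, (g (q, Q)).2) = g (q, Q) by rewrite [RHS]surjective_pairing g1.
  by rewrite [LHS]surjective_pairing g2.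
- move=> x; rewrite (_ : (fun x => _) = fun x => (g x).2); last by apply/funext => y; rewrite gE.
  exact: (differentiable_compf (gd x) (differentiable_sndf _)).
- move=> x; rewrite (_ : (fun x => _) = fun x => (F (g x)).2); last by apply/funext => y; rewrite gE.
  exact: (@differentiable_compf _ _ _ _ g (fun x => (F x).2) x (gd x) (F2d _)).
- move=> x u v; rewrite gE.
  pose h : phase R d := 'd g x (u, v).
  have chh : 'd (twist_chart F) (g x) h = (u, v).
    have := diff_comp (gd x) (chd (g x)) => /(congr1 (fun D => D (u, v))) /= <-.
    have -> : twist_chart F \o g = idfun by apply/funext => y; exact: Kg.
    by rewrite diff_lin// => ? //.
  have chE : 'd (twist_chart F) (g x) h = (h.1, 'd (fun x => (F x).1) (g x) h).
    have e1 : 'd (fun y : phase R d => (y.1, (F y).1)) (g x) h =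
        ('d (fun y : phase R d => y.1) (g x) h, 'd (fun y : phase R d => (F y).1) (g x) h).
      exact: (congr1 (fun D : phase R d -> phase R d => D h) (diff_pair (differentiable_fstf (g x)) (F11d (g x)))).
    have e2 : 'd (fun y : phase R d => y.1) (g x) h = h.1.
      exact: (congr1 (fun D : phase R d -> V => D h) (diff_fstf (g x))).
    exact: (etrans e1 (congr1 (fun w => (w, 'd (fun y : phase R d => (F y).1) (g x) h)) e2)).
  have e3 y w : twist_chart F (g x) = y -> 'd (twist_chart F) (g x) h = w ->
      'd (S \o twist_chart F : phase R d -> R^o) (g x) h = 'd (S : phase R d -> R^o) y w.
    by move=> <- <-; exact: (congr1 (fun D : phase R d -> R^o => D h) (diff_comp (chd (g x)) (Sd _))).
  have e4 := e3 x (u, v) (Kg x) chh.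
  have [e5 e6] := etrans (esym chE) chh.
  exact: (etrans (esym e4) (etrans (dS (g x) h)
    (f_equal2 (fun a b => dot (F (g x)).2 a - dot (g x).2 b) e6 e5))).
Qed.

End TwistLift.

(** * Integrated forms of the bounds on second derivatives *)

Section SecondDifferences.
Context {R : realType} {d : nat}.
Local Notation V := 'rV[R]_d.
Implicit Types (S : phase R d -> R) (M : phase R d -> V) (x : phase R d) (u v : V).

Lemma is_derive_line (phi : phase R d -> R^o) (x v : phase R d) (t : R) : (forall y, differentiable phi y) ->
  is_derive t 1 (fun t : R => phi (x + t *: v) : R) ('d phi (x + t *: v) v).
Proof.
move=> dphi; pose g (t : R) : R := phi (x + t *: v).
have E : (fun h : R => h^-1 *: ((g \o shift t) (h *: 1) - g t)) =
   (fun h : R => h^-1 *: ((phi \o shift (x + t *: v)) (h *: v) - phi (x + t *: v))).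
  apply/funext => h; congr (_ *: (phi _ - _)).
  by rewrite /= -[h%:A]/(h * 1) mulr1 scalerDl addrCA.
have dv := @diff_derivable R (phase R d) R^o phi (x + t *: v) v (dphi _).
split.
  rewrite /derivable -/g E; exact: dv.
by rewrite -(deriveE _ (dphi _)) /derive -E.
Qed.

Lemma linear_dir_q (L : {linear phase R d -> R^o}) u :
  L (dir_q u) = \sum_(i < d) u 0 i * L (dir_q (delta_mx 0 i)).
Proof.
have lin : linear (fun u => L (dir_q u) : R^o).
  move=> a v w; rewrite -linearP; congr (L _).
  by rewrite -[RHS]/(a *: v + w, a *: 0 + 0) scaler0 addr0.
pose LL : {linear V -> R^o} := HB.pack (fun u => L (dir_q u) : R^o) (GRing.isLinear.Build _ _ _ _ _ lin).
rewrite {1}[u]row_sum_delta -[LHS]/(LL _) linear_sum; apply: eq_bigr => i _.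
by rewrite linearZ.
Qed.

Lemma linear_dir_Q (L : {linear phase R d -> R^o}) u :
  L (dir_Q u) = \sum_(i < d) u 0 i * L (dir_Q (delta_mx 0 i)).
Proof.
have lin : linear (fun u => L (dir_Q u) : R^o).
  move=> a v w; rewrite -linearP; congr (L _).
  by rewrite -[RHS]/(a *: 0 + 0, a *: v + w) scaler0 addr0.
pose LL : {linear V -> R^o} := HB.pack (fun u => L (dir_Q u) : R^o) (GRing.isLinear.Build _ _ _ _ _ lin).
rewrite {1}[u]row_sum_delta -[LHS]/(LL _) linear_sum; apply: eq_bigr => i _.
by rewrite linearZ.
Qed.

(** The hypothesis on [a] holds for both [dir_q] and [dir_Q]. [M] is the partial gradient of [S] in
    the variable selected by [b]; it will be [P] or [- p]. *)
Lemma second_diff_line S (a b : V -> phase R d) M x u (t : R) j :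
  (forall (L : {linear phase R d -> R^o}) u, L (a u) = \sum_(i < d) u 0 i * L (a (delta_mx 0 i))) ->
  (forall y, differentiable M y) ->
  (forall y j, 'D_(b (delta_mx 0 j)) (S : phase R d -> R^o) y = M y 0 j) ->
  is_derive t 1 (fun t : R => M (x + t *: a u) 0 j) ((u *m second_diff S a b (x + t *: a u)) 0 j).
Proof.
move=> aL dM HM.
have dMj y : differentiable (fun y => M y 0 j : R^o) y.
  by apply: (@differentiable_compf _ _ _ _ M (fun v : V => v 0 j : R^o)); [exact: dM|exact: differentiable_coord].
have := @is_derive_line (fun y => M y 0 j) x (a u) t dMj.
rewrite aL mxE; congr is_derive; apply: eq_bigr => i _; congr (_ * _).
have sE y : second_diff S a b y i j = 'D_(a (delta_mx 0 i)) (fun y => M y 0 j : R^o) y.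
  by rewrite mxE (_ : (fun y => _) = (fun y => M y 0 j)); last by apply/funext => z; exact: HM.
by rewrite sE; exact: esym (deriveE _ (dMj _)).
Qed.

Lemma mx_norm_entry m n (A : 'M[R]_(m, n)) i j : `|A i j| <= `|A|.
Proof.
suff : `|A i j| <= mx_norm A by [].
by rewrite mx_normE -[leLHS]nngE num_le; exact: (le_bigmax _ _ (i, j)).
Qed.

Lemma second_diff_lipschitz S (a b : V -> phase R d) M (B : R) x u :
  (forall (L : {linear phase R d -> R^o}) u, L (a u) = \sum_(i < d) u 0 i * L (a (delta_mx 0 i))) ->
  (forall y, differentiable M y) ->
  (forall y j, 'D_(b (delta_mx 0 j)) (S : phase R d -> R^o) y = M y 0 j) ->
  (forall y, `|second_diff S a b y| <= B) ->
  `|M (x + a u) - M x| <= d%:R * B * `|u|.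
Proof.
move=> aL dM HM HB; have B0 : 0 <= B by apply: le_trans (HB x).
apply: rv_norm_le => [|j]; first by rewrite !mulr_ge0.
have := mean_value 0 1 (fun t => @second_diff_line S a b M x u t j aL dM HM).
rewrite scale0r addr0 scale1r => -[c _].
have -> : M (x + a u) 0 j - M x 0 j = (M (x + a u) - M x) 0 j by rewrite !mxE.
move=> ->; rewrite subr0 mulr1 mxE; apply: le_trans (ler_norm_sum _ _ _) _.
apply: (@le_trans _ _ (\sum_(i < d) B * `|u|)); last by rewrite sumr_const card_ord -mulrA mulr_natl.
apply: ler_sum => i _; rewrite normrM mulrC ler_pM//; last exact: rv_norm_ge.
exact: le_trans (mx_norm_entry _ _ _) (HB _).
Qed.

(** The mean value theorem on the segment from [q'] to [q], for the component of [M] along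
    [q - q']. *)
Lemma second_diff_monotone S (b : V -> phase R d) M (al : R) q q' Q :
  (forall y, differentiable M y) ->
  (forall y j, 'D_(b (delta_mx 0 j)) (S : phase R d -> R^o) y = M y 0 j) ->
  (forall y v, dot (v *m second_diff S (@dir_q R d) b y) v <= - al * dot v v) ->
  dot (M (q, Q) - M (q', Q)) (q - q') <= - al * dot (q - q') (q - q').
Proof.
move=> dM HM Hal; pose w := q - q'; pose x : phase R d := (q', Q).
pose phi (t : R) := dot (M (x + t *: dir_q w)) w.
have dphi (t : R) : is_derive t 1 phi (dot (w *m second_diff S (@dir_q R d) b (x + t *: dir_q w)) w).
  have H j := @second_diff_line S (@dir_q R d) b M x w t j linear_dir_q dM HM.
  have -> : phi = \sum_(j < d) (fun t : R => w 0 j *: (M (x + t *: dir_q w) 0 j : R)).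
    by apply/funext => s; rewrite fct_sumE; apply: eq_bigr => j _; rewrite mulrC.
  have -> : dot (w *m second_diff S (@dir_q R d) b (x + t *: dir_q w)) w =
      \sum_(j < d) w 0 j *: ((w *m second_diff S (@dir_q R d) b (x + t *: dir_q w)) 0 j : R).
    by apply: eq_bigr => j _; rewrite mulrC.
  apply: is_derive_sum => j; have Hj := H j; exact: is_deriveZ.
have := mean_value 0 1 dphi; rewrite /phi scale0r addr0 scale1r subr0 => -[c _]; rewrite mulr1.
have -> : x + dir_q w = (q, Q).
  by rewrite -[LHS]/(q' + w, Q + 0) addr0 /w subrKC.
by rewrite -dotBl => ->; exact: Hal.
Qed.

Lemma sup_norm_bound (A B : phase R d -> 'M[R]_d) : (sup_norm A + sup_norm B < +oo)%E ->
  exists K : R, forall x, `|A x| <= K /\ `|B x| <= K.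
Proof.
have ub (D : phase R d -> 'M[R]_d) x : (`|D x|%:E <= sup_norm D)%E.
  by apply: ereal_sup_ubound; exists x.
have pos (D : phase R d -> 'M[R]_d) : (0 <= sup_norm D)%E.
  by apply: le_trans (ub D 0); rewrite lee_fin.
move: (ub A) (ub B) (pos A) (pos B).
case: (sup_norm A) => [r| |] // HA; case: (sup_norm B) => [s| |] // HB r0 s0 _.
rewrite lee_fin in r0; rewrite lee_fin in s0.
exists (r + s) => x; have := HA x; have := HB x; rewrite !lee_fin => h1 h2.
by split; [apply: le_trans h2 _; rewrite lerDl|apply: le_trans h1 _; rewrite lerDr].
Qed.

End SecondDifferences.

(** * The potential and its complex gradient *)

Section Potential.
Local Open Scope quotient_scope.
Context {R : realType} {d : nat} (G : torus R d -> R).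
Local Notation C := (Cfield R).
Local Notation VC := 'rV[C]_d.
Local Notation V := 'rV[R]_d.
Context (g : VC -> C^o) (g_hol : holomorphic g).
Context (gE : forall x : V, g (complexify x) = real_complex R (G (\pi x))).
Local Notation Gq := (fun q : V => G (\pi_(torus R d) q)).

Definition complex_gradient (z : VC) : VC := \row_i ('d g z (delta_mx 0 i) : C).

Definition real_gradient (q : V) : V := \row_i cre (complex_gradient (complexify q) 0 i).

Lemma differentiable_complex_gradient z : differentiable complex_gradient z.
Proof.
apply: differentiable_rv_of => i.
rewrite (_ : (fun z => _) = (fun z => 'd g z (delta_mx 0 i) : C)); last by apply/funext => w; rewrite mxE.
exact: (@differentiable_partial R VC g (delta_mx 0 i) g_hol).
Qed.

Lemma increment_small q (eta : R) : 0 < eta -> exists2 r : R, 0 < r & forall h : V, `|h| < r ->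
  nr (rc (Gq (q + h) - Gq q) - 'd g (complexify q) (complexify h) : C) <= eta * `|h|.
Proof.
move=> eta0; have [r r0 H] := differentiable_nr (g_hol (complexify q)) eta0.
exists r => // h hr; have := H (complexify h); rewrite nr_complexify => /(_ hr).
by rewrite -complexifyD !gE rcB.
Qed.

(** The increments of [g] between real points are real, hence so is its differential in real
    directions. *)
Lemma complex_gradient_real q : complex_gradient (complexify q) = complexify (real_gradient q).
Proof.
apply/rowP => i; rewrite complexifyE [real_gradient q 0 i]mxE; set D := complex_gradient _ 0 i.
suff h : cim D = 0 by apply: ceqP; rewrite !creimE.
have -> : D = 'd g (complexify q) (complexify (delta_mx 0 i)).
  rewrite /D mxE; congr ('d _ _ _); apply/rowP => j; rewrite complexifyE !mxE.
  by case: (j == i); rewrite ?andbT ?andbF.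
set u : V := delta_mx 0 i; have u1 : 0 < `|u| + 1 by rewrite ltr_wpDl.
apply/eqP; rewrite -normr_le0; apply/ler_addgt0Pr => eta eta0; rewrite add0r.
have [r r0 H] := increment_small q (divr_gt0 eta0 u1).
pose t := r / (2 * (`|u| + 1)); have t0 : 0 < t by rewrite divr_gt0// mulr_gt0.
have tn : `|t *: u| = t * `|u| by rewrite normrZ gtr0_norm.
have tr : t * `|u| < r.
  apply: (@le_lt_trans _ _ (r / 2)); last by rewrite ltr_pdivrMr// ltr_pMr// ltr1n.
  rewrite /t mulrAC ler_pdivrMr ?mulr_gt0// mulrA divfK// ler_wpM2l ?(ltW r0)// lerDl//.
have DL : 'd g (complexify q) (rc t *: complexify u) = rc t * 'd g (complexify q) (complexify u) :> C.
  by rewrite linearZ.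
have := H (t *: u); rewrite tn complexifyZ DL => /(_ tr) h1.
have := le_trans (cim_le _) h1; move: ('d g _ _) => DD.
rewrite !creimE mul0r addr0 sub0r normrN normrM (gtr0_norm t0) => h2.
rewrite -(ler_pM2l t0); apply: le_trans h2 _; rewrite mulrCA ler_wpM2l ?(ltW t0)//.
by rewrite mulrAC ler_pdivrMr// ler_wpM2l ?(ltW eta0)// lerDl.
Qed.

Lemma real_gradientP q : gradient_at Gq q (real_gradient q).
Proof.
move=> eta eta0; have [r r0 H] := increment_small q eta0; exists r => // h /H h1.
have dE : 'd g (complexify q) (complexify h) = \sum_(i < d) rc (h 0 i) * complex_gradient (complexify q) 0 i.
  rewrite {1}[complexify h]row_sum_delta linear_sum; apply: eq_bigr => i _.
  by rewrite linearZ complexifyE [complex_gradient _ 0 i]mxE.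
have cE : cre ('d g (complexify q) (complexify h)) = dot (real_gradient q) h.
  rewrite dE (big_morph _ (@creD R) (@cre0 R)); apply: eq_bigr => i _.
  by rewrite complex_gradient_real complexifyE !creimE mul0r subr0 mulrC.
have := le_trans (cre_le _) h1; move: cE; move: ('d g _ _) => DD cE.
by rewrite !creimE cE.
Qed.

Lemma gradient_unique (f : V -> R) q c c' : gradient_at f q c -> gradient_at f q c' -> c = c'.
Proof.
move=> H H'; apply/eqP; rewrite -subr_eq0; apply/eqP/dot_nonneg_small => eta eta0.
have e2 : 0 < eta / 2 by rewrite divr_gt0.
have [r1 r10 H1] := H _ e2; have [r2 r20 H2] := H' _ e2.
exists (Num.min r1 r2); first by rewrite lt_min r10.
move=> h; rewrite lt_min => /andP[/H1 + /H2]; rewrite !ler_norml dotBl => /andP[h1 h2] /andP[h3 h4].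
by move: h1 h2 h3 h4; clear; lra.
Qed.

Lemma pi_per k (q : V) : \pi_(torus R d) (q + intv R k) = \pi_(torus R d) q.
Proof. by apply/pi_torusP; exists k. Qed.

Lemma real_gradient_per k q : real_gradient (q + intv R k) = real_gradient q.
Proof.
apply: (@gradient_unique Gq q); last exact: real_gradientP.
move=> eta eta0; have [r r0 H] := @real_gradientP (q + intv R k) eta eta0; exists r => // h /H.
by rewrite (addrAC q) !pi_per.
Qed.

Lemma derive_gradient (f : V -> R) (c : V -> V) q i : (forall z, gradient_at f z (c z)) ->
  'D_(delta_mx 0 i) (f : V -> R^o) q = c q 0 i.
Proof.
move=> H; have D := @gradient_line R d f c q (delta_mx 0 i) 0 H.
have [_] := D; rewrite scale0r addr0 dot_delta => <-.
have E : (fun h : R => h^-1 *: ((f \o shift q) (h *: delta_mx 0 i) - f q)) =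
  (fun h : R => h^-1 *: (((fun t : R => f (q + t *: delta_mx 0 i)) \o shift 0) (h *: 1) -
     f (q + 0 *: delta_mx 0 i))).
  apply/funext => h; rewrite /= scale0r addr0 -[h%:A]/(h * 1) mulr1 addr0.
  by congr (_ *: (f _ - _)); rewrite addrC.
by rewrite /derive E.
Qed.

(** The representative chosen by [repr] differs from [q] by an integer vector, and the gradient is
    periodic. *)
Lemma torus_gradE q : torus_grad G (\pi_(torus R d) q) = real_gradient q.
Proof.
apply/rowP => i; rewrite mxE (@derive_gradient Gq real_gradient _ i real_gradientP).
have [k kE] : exists k, repr (\pi_(torus R d) q) = q + intv R k.
  by apply/pi_torusP; rewrite reprK.
by rewrite kE real_gradient_per.
Qed.

End Potential.

(** * Construction of the twist system *)

Section Assembly.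
Local Open Scope quotient_scope.
Context {R : realType} {d : nat}.
Local Notation C := (Cfield R).
Local Notation VC := 'rV[C]_d.
Local Notation V := 'rV[R]_d.
Implicit Types (f : annulus R d -> annulus R d) (G : torus R d -> R).

Lemma differentiable_norm (U W : normedModType R) (h : U -> W) x : differentiable h x ->
  forall e : R, 0 < e -> exists2 r : R, 0 < r &
    forall u, `|u| < r -> `|h (x + u) - h x - 'd h x u| <= e * `|u|.
Proof.
move=> /diff_locallyP[_ dh] e e0.
have /eqaddoP /(_ _ e0) /nbhs_ballP[r /= r0 Hr] := dh; exists r => // u ur.
have := Hr u; rewrite -ball_normE /= sub0r normrN => /(_ ur).
congr (`|_| <= _).
by rewrite -[LHS]/(h (u + x) - (h x + 'd h x u)) opprD addrA (addrC u).
Qed.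

Lemma partial_Q (S : phase R d -> R) (p P : V -> V -> V) :
  (forall x, differentiable (S : phase R d -> R^o) x) ->
  (forall (x : phase R d) u v,
      'd (S : phase R d -> R^o) x (u, v) = dot (P x.1 x.2) v - dot (p x.1 x.2) u) ->
  forall x j, 'D_(dir_Q (delta_mx 0 j)) (S : phase R d -> R^o) x = P x.1 x.2 0 j.
Proof. by move=> Sd dS x j; rewrite deriveE// dS dot0r subr0 dot_delta. Qed.

Lemma partial_q (S : phase R d -> R) (p P : V -> V -> V) :
  (forall x, differentiable (S : phase R d -> R^o) x) ->
  (forall (x : phase R d) u v,
      'd (S : phase R d -> R^o) x (u, v) = dot (P x.1 x.2) v - dot (p x.1 x.2) u) ->
  forall x j, 'D_(dir_q (delta_mx 0 j)) (S : phase R d -> R^o) x = (- p x.1 x.2) 0 j.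
Proof. by move=> Sd dS x j; rewrite deriveE// dS dot0r sub0r dot_delta [RHS]mxE. Qed.

(** The lift that comes with strong positivity is taken as the reference lift. *)
Lemma momenta_positive f : strongly_positive f -> annulus_C1 f -> exists F S (p P : V -> V -> V) al, [/\
  twist_lift f F S,
  [/\ forall q y Q Y, F (q, y) = (Q, Y) <-> y = p q Q /\ Y = P q Q,
    forall x : phase R d, differentiable (fun x : phase R d => p x.1 x.2) x,
    forall x : phase R d, differentiable (fun x : phase R d => P x.1 x.2) x &
    forall (x : phase R d) u v,
      'd (S : phase R d -> R^o) x (u, v) = dot (P x.1 x.2) v - dot (p x.1 x.2) u],
  0 < al & forall q q' Q, dot (P q Q - P q' Q) (q - q') <= - al * dot (q - q') (q - q')].
Proof.
move=> [F [S [lift [al [be [al0 _ H]]]]]] fC1.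
have [p [P [FP dp dP dS]]] := twist_lift_momenta fC1 lift.
have [_ _ _ [Sd _ _]] := lift.
exists F, S, p, P, al; split => // q q' Q.
apply: (@second_diff_monotone R d S (@dir_Q R d) (fun x => P x.1 x.2)) => //.
- by move=> y j; exact: partial_Q dS y j.
- by move=> [q1 Q1] v; have /andP[] := H q1 Q1 v.
Qed.

(** The lift of the bounded rate hypothesis differs from [F] by an integer translation [k] in
    position, so the momenta of [F] are its momenta with [Q] translated by [k], and Lipschitz
    constants agree. *)
Lemma momenta_rate f : bounded_rate f -> annulus_C1 f -> forall F (p P : V -> V -> V), is_lift f F ->
  (forall q y Q Y, F (q, y) = (Q, Y) <-> y = p q Q /\ Y = P q Q) ->
  exists B : R, [/\ 0 <= B, forall q Q Q', `|P q Q - P q Q'| <= B * `|Q - Q'|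
    & forall q q' Q, `|p q Q - p q' Q| <= B * `|q - q'|].
Proof.
move=> [F3 [S3 [lift3 bnd]]] fC1 F p P lift FP.
have [p3 [P3 [FP3 dp3 dP3 dS3]]] := twist_lift_momenta fC1 lift3.
have [l3 _ _ [Sd3 _ _]] := lift3.
have [k Hk] := is_lift_eq lift l3.
have E q Q : p q Q = p3 q (Q + intv R k) /\ P q Q = P3 q (Q + intv R k).
  by apply/FP3; rewrite Hk (_ : F _ = (Q, P q Q))//; apply/FP.
have [K HK] := sup_norm_bound bnd.
have K0 : 0 <= K by have [h _] := HK 0; apply: le_trans h.
have PQ := partial_Q Sd3 dS3; have pq := partial_q Sd3 dS3.
have dN (y : phase R d) : differentiable (fun x : phase R d => - p3 x.1 x.2) y by exact: differentiableN.
exists (d%:R * K); split; first by rewrite mulr_ge0.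
- move=> q Q Q'; have [_ ->] := E q Q; have [_ ->] := E q Q'.
  have := @second_diff_lipschitz R d S3 (@dir_Q R d) (@dir_Q R d) (fun x => P3 x.1 x.2) K
    (q, Q' + intv R k) (Q - Q') linear_dir_Q dP3 PQ (fun y => (HK y).2).
  by rewrite /= addr0 (addrAC Q') subrKC.
- move=> q q' Q; have [-> _] := E q Q; have [-> _] := E q' Q.
  have := @second_diff_lipschitz R d S3 (@dir_q R d) (@dir_q R d) (fun x => - p3 x.1 x.2) K
    (q', Q + intv R k) (q - q') linear_dir_q dN pq (fun y => (HK y).1).
  by rewrite /= addr0 subrKC -opprD normrN.
Qed.

(** The complex map is followed by the complexified translation between the two lifts, and its
    inverse is corrected accordingly. *)
Lemma analytic_lift f F : analyticity_property f -> is_lift f F -> exists cF cFi : phase C d -> phase C d, [/\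
  forall z, differentiable cF z, forall z, differentiable cFi z, cancel cF cFi &
  forall z, cF (complexify2 z) = complexify2 (F z)].
Proof.
move=> [cF [[dF [cFi [FK KF dFi]]] [F4 [lift4 FE]] _ _]] lift.
have [k Hk] := is_lift_eq lift4 lift.
pose s : phase C d := (complexify (intv R k), 0).
exists (fun z => cF z + s), (fun z => cFi (z - s)); split.
- by move=> z; apply: differentiable_addv; [exact: dF|exact: differentiable_cstf].
- move=> z; apply: (@differentiable_compf _ _ _ _ (fun z => z - s) cFi z _ (dFi _)).
  by apply: differentiable_subf; [exact: differentiable_idf|exact: differentiable_cstf].
- by move=> z; rewrite addrK FK.
- move=> z; rewrite FE Hk -[LHS]/((complexify (F4 z).1 + complexify (intv R k), complexify (F4 z).2 + 0)).
  by rewrite addr0 -complexifyD.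
Qed.

Lemma exists_twist_system f G : symplectic_twist_map f -> strongly_positive f -> bounded_rate f ->
  analyticity_property f -> has_holomorphic_extension G ->
  exists T : twist_system R d, [/\ is_lift f (ts_F T), forall q, ts_G T q = G (\pi_(torus R d) q) &
    forall q, ts_dG T q = torus_grad G (\pi_(torus R d) q)].
Proof.
move=> [[fC1 _] _] fpos frate fan [g [ghol gE]].
have [F [S [p [P [al [lift [FP dp dP dS] al0 pos]]]]]] := momenta_positive fpos fC1.
have [liftF Fper _ [Sd Sper _]] := lift.
have rate := momenta_rate frate fC1 liftF FP.
have [cF [cFi [dF dFi FK FE]]] := analytic_lift fan liftF.
have P_per k q Q : P (q + intv R k) (Q + intv R k) = P q Q.
  have E : F (q, p q Q) = (Q, P q Q) by apply/FP.
  have := Fper k q (p q Q); rewrite E /= => /FP[_ <-].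
  by [].
have cdiag : continuous (fun q : V => (q, q)).
  have idc : continuous (fun q : V => q) by move=> q; exact: cvg_id.
  exact: (continuous_pairr idc idc).
have cP : continuous (fun q : V => P q q).
  move=> q; apply: (@continuous_comp _ _ _ (fun q : V => (q, q)) (fun x : V * V => P x.1 x.2)).
    exact: cdiag.
  exact: differentiable_continuous (dP (q, q)).
have cS : continuous (fun q : V => S (q, q)).
  move=> q; apply: (@continuous_comp _ _ _ (fun q : V => (q, q)) S).
    exact: cdiag.
  exact: differentiable_continuous (Sd (q, q)).
(* On the diagonal [P] and [S] are continuous and invariant under integer translations, hence
   bounded. *)
have diag : exists M : R, forall q, `|P q q| <= M /\ `|S (q, q)| <= M.
  have [M1 H1] := @periodic_bounded R d V (fun q => P q q) cP (fun k q => P_per k q q).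
  have [M2 H2] := @periodic_bounded R d R^o (fun q => S (q, q)) cS (fun k q => Sper k q q).
  by exists (Num.max M1 M2) => q; rewrite !le_max H1 H2 orbT.
have S_diff q Q (e : R) : 0 < e -> exists2 r : R, 0 < r & forall u v, `|u| < r -> `|v| < r ->
    `|S (q + u, Q + v) - S (q, Q) - (dot (P q Q) v - dot (p q Q) u)| <= e * (`|u| + `|v|).
  move=> e0; have [r r0 H] := differentiable_norm (Sd (q, Q)) e0; exists r => // u v ur vr.
  have uv : `|(u, v) : phase R d| < r by rewrite num_gt_max /= ur vr.
  have := H (u, v) uv; rewrite dS => h; apply: le_trans h _.
  by rewrite ler_wpM2l ?(ltW e0)//; apply: pair_norm_le; rewrite ?lerDl ?lerDr.
have cp : continuous (fun z : V * V => p z.1 z.2).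
  by move=> z; exact: differentiable_continuous (dp z).
have Gper k (q : V) : G (\pi_(torus R d) (q + intv R k)) = G (\pi q) by rewrite pi_per.
have gradP := @real_gradientP R d G g ghol gE.
have gradC : continuous (fun q : V => G (\pi_(torus R d) q)).
  by move=> q; exact: gradient_continuous (gradP q).
have Gbound : exists M : R, forall q : V, `|G (\pi_(torus R d) q)| <= M.
  exact: (@periodic_bounded R d R^o (fun q => G (\pi_(torus R d) q)) gradC Gper).
exists (TwistSystem FP Fper S_diff Sper (ex_intro2 _ _ al al0 pos) rate diag cp gradP Gper
  (@real_gradient_per R d G g ghol gE) Gbound dF dFi FK FE (differentiable_complex_gradient ghol)
  (complex_gradient_real ghol gE)).
by split => // q; rewrite (torus_gradE ghol gE).
Qed.

End Assembly.

(** * Lagrangian graphs are graphs of gradients *)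

Section Triangle.
Context {R : realType} {d : nat}.
Local Notation V := 'rV[R]_d.

(** The squared positive part is of class C^1 with zero derivative at 0, so loops built from it are
    C^1 even at the corners. *)
Definition pos_sqr (u : R) : R := Num.max 0 u ^+ 2.

Lemma pos_sqr_ge u : 0 <= u -> pos_sqr u = u ^+ 2.
Proof. by move=> u0; rewrite /pos_sqr (max_idPr u0). Qed.

Lemma pos_sqr_le u : u <= 0 -> pos_sqr u = 0.
Proof. by move=> u0; rewrite /pos_sqr (max_idPl u0) expr0n. Qed.

Lemma is_derive_pos_sqr (u : R) : is_derive u 1 pos_sqr (2 * Num.max 0 u).
Proof.
apply: is_derive_small => e e0; exists e => // h he.
suff H : `|pos_sqr (u + h) - pos_sqr u - h * (2 * Num.max 0 u)| <= `|h| ^+ 2.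
  by apply: le_trans H _; rewrite expr2 ler_wpM2r// ltW.
rewrite real_normK ?num_real//.
have [u0|/ltW u0] := leP 0 u; have [v0|/ltW v0] := leP 0 (u + h);
  rewrite ?(pos_sqr_ge u0) ?(pos_sqr_le u0) ?(pos_sqr_ge v0) ?(pos_sqr_le v0)
    ?(max_idPr u0) ?(max_idPl u0).
- have -> : (u + h) ^+ 2 - u ^+ 2 - h * (2 * u) = h ^+ 2 by ring.
  by rewrite ger0_norm ?sqr_ge0 ?lexx.
- have -> : 0 - u ^+ 2 - h * (2 * u) = u * (- h) + u * (- (u + h)) by ring.
  rewrite ger0_norm; last by apply: addr_ge0; apply: mulr_ge0 => //; move: u0 v0; clear; lra.
  have -> : u * - h + u * - (u + h) = h ^+ 2 - (u + h) ^+ 2 by ring.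
  by rewrite lerBlDr lerDl sqr_ge0.
- rewrite subr0 !mulr0 subr0 ger0_norm ?sqr_ge0// ler_pXn2r ?nnegrE//; move: u0 v0; clear; lra.
- by rewrite subr0 !mulr0 subr0 normr0 sqr_ge0.
Qed.

Definition cosc (t : R) : R := cos (2 * pi * t).
Definition sinc (t : R) : R := sin (2 * pi * t).

Lemma is_derive_cosc (t : R) : is_derive t 1 cosc (- (2 * pi) * sinc t).
Proof.
have H : is_derive t 1 (fun t : R => 2 * pi * t) (2 * pi).
  by apply: is_derive_eq; rewrite /GRing.scale /= mulr1.
have := @is_derive1_comp R (@cos R) (fun t => 2 * pi * t) t _ _ (is_derive_cos _) H.
by move=> h; apply: (is_derive_eq h); rewrite /sinc; ring.
Qed.

Lemma is_derive_sinc (t : R) : is_derive t 1 sinc ((2 * pi) * cosc t).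
Proof.
have H : is_derive t 1 (fun t : R => 2 * pi * t) (2 * pi).
  by apply: is_derive_eq; rewrite /GRing.scale /= mulr1.
have := @is_derive1_comp R (@sin R) (fun t => 2 * pi * t) t _ _ (is_derive_sin _) H.
by move=> h; apply: (is_derive_eq h); rewrite /cosc; ring.
Qed.

Lemma cosc_per t : cosc (t + 1) = cosc t.
Proof.
by rewrite /cosc -(cosD2pi (2 * pi * t)); congr cos; rewrite -mulr_natl; ring.
Qed.

Lemma sinc_per t : sinc (t + 1) = sinc t.
Proof.
by rewrite /sinc -(sinD2pi (2 * pi * t)); congr sin; rewrite -mulr_natl; ring.
Qed.

Lemma cosc_ge0 t : 0 <= t <= 4^-1 -> 0 <= cosc t.
Proof.
move=> /andP[t0 t1]; apply: cos_ge0_pihalf; have p := pi_ge0 R.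
have h1 : 0 <= pi * t by rewrite mulr_ge0.
have h2 : pi * t <= pi * 4^-1 by rewrite ler_wpM2l.
by move: p h1 h2; move: (pi : R) => q; clear; lra.
Qed.

Lemma sinc_ge0 t : 0 <= t <= 2^-1 -> 0 <= sinc t.
Proof.
move=> /andP[t0 t1]; apply: sin_ge0_pi; have p := pi_ge0 R.
have h1 : 0 <= pi * t by rewrite mulr_ge0.
have h2 : pi * t <= pi * 2^-1 by rewrite ler_wpM2l.
by move: p h1 h2; move: (pi : R) => q; clear; lra.
Qed.

Lemma cosc_quarter t : cosc (t + 4^-1) = - sinc t.
Proof. by rewrite /cosc /sinc -cosDpihalf; congr cos; field. Qed.

Lemma cosc_half t : cosc (t + 2^-1) = - cosc t.
Proof. by rewrite /cosc -cosDpi; congr cos; field. Qed.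

Lemma sinc_half t : sinc (t + 2^-1) = - sinc t.
Proof. by rewrite /sinc -sinDpi; congr sin; field. Qed.

Lemma cosc_le0 t : 4^-1 <= t <= 3 * 4^-1 -> cosc t <= 0.
Proof.
move=> ht; rewrite -[t](subrK 4^-1) cosc_quarter oppr_le0; apply: sinc_ge0.
by move: ht; clear; lra.
Qed.

Lemma sinc_le0 t : 2^-1 <= t <= 1 -> sinc t <= 0.
Proof.
move=> ht; rewrite -[t](subrK 2^-1) sinc_half oppr_le0; apply: sinc_ge0.
by move: ht; clear; lra.
Qed.

Lemma cosc_ge0' t : 3 * 4^-1 <= t <= 1 -> 0 <= cosc t.
Proof.
move=> ht; rewrite -[t](subrK 2^-1) cosc_half oppr_ge0; apply: cosc_le0.
by move: ht; clear; lra.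
Qed.

Lemma trig_values : [/\ cosc 0 = 1, sinc 0 = 0, sinc 4^-1 = 1, sinc 2^-1 = 0 & cosc (3 * 4^-1) = 0].
Proof.
have c0 : cosc 0 = 1 by rewrite /cosc mulr0 cos0.
have s0 : sinc 0 = 0 by rewrite /sinc mulr0 sin0.
split => //.
- by rewrite /sinc (_ : 2 * pi * 4^-1 = pi / 2) ?sin_pihalf//; field.
- by rewrite -[2^-1]add0r sinc_half s0 oppr0.
- have -> : 3 * 4^-1 = 4^-1 + 2^-1 :> R by field.
  by rewrite cosc_half -[4^-1]add0r cosc_quarter s0 !oppr0.
Qed.

Lemma cosc_sinc t : cosc t ^+ 2 = 1 - sinc t ^+ 2.
Proof. by rewrite -(cos2Dsin2 (2 * pi * t)) addrK. Qed.

Definition alpha1 t := 2 * Num.max 0 (cosc t) * (- (2 * pi) * sinc t).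
Definition beta1 t := 2 * Num.max 0 (sinc t) * ((2 * pi) * cosc t).

Lemma is_derive_alpha (t : R) : is_derive t 1 (fun t => pos_sqr (cosc t)) (alpha1 t).
Proof. exact: (@is_derive1_comp R pos_sqr cosc t _ _ (is_derive_pos_sqr _) (is_derive_cosc t)). Qed.

Lemma is_derive_beta (t : R) : is_derive t 1 (fun t => pos_sqr (sinc t)) (beta1 t).
Proof. exact: (@is_derive1_comp R pos_sqr sinc t _ _ (is_derive_pos_sqr _) (is_derive_sinc t)). Qed.

Lemma continuous_max0 (f : R -> R) : continuous f -> continuous (fun t => Num.max 0 (f t)).
Proof.
move=> cf t; apply/cvgrPdist_lt => e e0; have /cvgrPdist_lt/(_ e e0) := cf t.
by apply: filterS => s; apply: le_lt_trans; exact: max_lip.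
Qed.

Lemma continuousMr (f g : R -> R) : continuous f -> continuous g -> continuous (fun t => f t * g t).
Proof. by move=> cf cg t; exact: (cvgM (cf t) (cg t)). Qed.

Lemma continuous_alpha1 : continuous alpha1.
Proof.
have cc : continuous cosc by move=> t; exact: is_derive_continuous (is_derive_cosc t).
have cs : continuous sinc by move=> t; exact: is_derive_continuous (is_derive_sinc t).
by apply: continuousMr; [apply: continuous_mulc; exact: continuous_max0|exact: continuous_mulc].
Qed.

Lemma continuous_beta1 : continuous beta1.
Proof.
have cc : continuous cosc by move=> t; exact: is_derive_continuous (is_derive_cosc t).
have cs : continuous sinc by move=> t; exact: is_derive_continuous (is_derive_sinc t).
by apply: continuousMr; [apply: continuous_mulc; exact: continuous_max0|exact: continuous_mulc].
Qed.

(* As [t] runs over a period, the triangle [x], [y], [0] is traversed with zero velocity at the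
   vertices. *)
Definition loop (x y : V) (t : R) : V := pos_sqr (cosc t) *: x + pos_sqr (sinc t) *: y.

Definition velocity (x y : V) (t : R) : V := alpha1 t *: x + beta1 t *: y.

Lemma differentiable_loop x y (t : R^o) : differentiable (loop x y : R^o -> V) t.
Proof.
apply: (@differentiableD _ _ _ (fun t : R^o => pos_sqr (cosc t) *: x) (fun t : R^o => pos_sqr (sinc t) *: y));
  apply: differentiableZl; apply/derivable1_diffP.
  by have [] := is_derive_alpha t.
by have [] := is_derive_beta t.
Qed.

Lemma diff_loop x y (t v : R^o) : 'd (loop x y : R^o -> V) t v = v *: velocity x y t.
Proof.
have da : differentiable (fun t : R^o => pos_sqr (cosc t) : R^o) t.
  by apply/derivable1_diffP; have [] := is_derive_alpha t.
have db : differentiable (fun t : R^o => pos_sqr (sinc t) : R^o) t.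
  by apply/derivable1_diffP; have [] := is_derive_beta t.
have e1 := diffD (differentiableZl x da) (differentiableZl y db).
have -> : 'd (loop x y : R^o -> V) t v = 'd (fun t : R^o => pos_sqr (cosc t) : R^o) t v *: x +
    'd (fun t : R^o => pos_sqr (sinc t) : R^o) t v *: y.
  have ha := congr1 (fun D : R^o -> V => D v) (diffZl x da).
  have hb := congr1 (fun D : R^o -> V => D v) (diffZl y db).
  exact: etrans (congr1 (fun D : R^o -> V => D v) e1) (f_equal2 (fun a b : V => a + b) ha hb).
have ea : 'd (fun t : R^o => pos_sqr (cosc t) : R^o) t v = v * alpha1 t.
  rewrite (congr1 (fun D : R^o -> R^o => D v) (diff1E da)) /= derive1E.
  by have [_ ->] := is_derive_alpha t.
have eb : 'd (fun t : R^o => pos_sqr (sinc t) : R^o) t v = v * beta1 t.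
  rewrite (congr1 (fun D : R^o -> R^o => D v) (diff1E db)) /= derive1E.
  by have [_ ->] := is_derive_beta t.
by rewrite ea eb /velocity scalerDr !scalerA.
Qed.

Lemma continuous_scalel (a : R -> R) (x : V) : continuous a -> continuous (fun t => a t *: x).
Proof. by move=> ca t; exact: (continuous_comp (ca t) (@scalel_continuous _ _ x _)). Qed.

Lemma continuous_addV (A B : R -> V) : continuous A -> continuous B -> continuous (fun t => A t + B t).
Proof. by move=> cA cB t; exact: (cvgD (cA t) (cB t)). Qed.

Lemma continuous_velocity x y : continuous (velocity x y).
Proof.
by apply: continuous_addV; apply: continuous_scalel; [exact: continuous_alpha1|exact: continuous_beta1].
Qed.

Lemma loop_C1 x y : C1 (loop x y : R^o -> V).
Proof.
split=> [t|v]; first exact: differentiable_loop.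
rewrite (_ : (fun t => _) = fun t => v *: velocity x y t); last by apply/funext => t; exact: diff_loop.
by move=> t; exact: (continuous_comp (@continuous_velocity x y t) (@scaler_continuous _ _ v _)).
Qed.

Lemma loop_per x y t : loop x y (t + 1) = loop x y t.
Proof. by rewrite /loop cosc_per sinc_per. Qed.

Lemma continuous_dot (A B : R -> V) : continuous A -> continuous B -> continuous (fun t => dot (A t) (B t)).
Proof.
have cc (D : R -> V) i : continuous D -> continuous (fun t => D t 0 i : R).
  by move=> cD z; apply: (@continuous_comp _ _ _ D (fun v : V => v 0 i)); [exact: cD|exact: coord_continuous].
move=> cA cB; rewrite (_ : (fun t => _) = \sum_(i < d) (fun t => A t 0 i * B t 0 i)); last first.
  by apply/funext => t; rewrite fct_sumE.
elim/big_ind : _ => [||i _]; first exact: cst_continuous.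
  by move=> f g; exact: continuousDr.
by apply: continuousMr; exact: cc.
Qed.

Lemma Rintegral_primitive (h H : R -> R) : continuous h -> primitive h H ->
  (\int[lebesgue_measure]_(t in `[0, 1]) h t)%R = H 1 - H 0.
Proof.
move=> ch pH; rewrite /Rintegral (@continuous_FTC2 R h H 0 1)//.
- exact: continuous_subspaceT.
- split; first by move=> t _; have [] := pH t.
    by apply: cvg_at_right_filter; exact: primitive_continuous pH 0.
  by apply: cvg_at_left_filter; exact: primitive_continuous pH 1.
- by move=> t _; rewrite derive1E; have [] := pH t.
Qed.

(** The derivative of [H - A \o s] is 0 between [a] and [b]: the integral over a segment does not
    depend on its parametrization [s]. *)
Lemma substitution (gamma : V -> V) (h H A s s1 : R -> R) (x v : V) (a b : R) : a <= b ->
  primitive h H -> primitive (fun t => dot (gamma (x + t *: v)) v) A ->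
  (forall t : R, is_derive t 1 s (s1 t)) ->
  (forall t, a <= t <= b -> h t = dot (gamma (x + s t *: v)) (s1 t *: v)) ->
  H b - H a = A (s b) - A (s a).
Proof.
move=> ab pH pA ds hE.
have dD (t : R) : is_derive t 1 (fun t => H t - A (s t)) (h t - dot (gamma (x + s t *: v)) v * s1 t).
  have h1 := pH t; have h2 := @is_derive1_comp R A s t _ _ (pA (s t)) (ds t).
  exact: (@is_deriveB _ _ _ H (A \o s) t 1 _ _ h1 h2).
have := mean_value a b dD; rewrite (min_idPl ab) (max_idPr ab) => -[c cab].
by rewrite (hE c cab) dotZr [s1 c * _]mulrC subrr mul0r; lra.
Qed.

(** The potential is the integral of [gamma] along the segment from 0. The Lagrangian condition on
    the triangle with vertices 0, [x] and [y] turns its increments into integrals over the segment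
    from [x] to [y], and continuity of [gamma] gives the gradient. *)
Lemma lagrangian_potential (gamma : V -> V) : continuous gamma -> lagrangian gamma ->
  exists U, forall q, gradient_at U q (gamma q).
Proof.
move=> cg lag.
have /choice[Ap HAp] : forall xv : V * V, exists A, primitive (fun t => dot (gamma (xv.1 + t *: xv.2)) xv.2) A.
  move=> [x v] /=; apply: primitive_exists; apply: continuous_dot; last exact: cst_continuous.
  move=> t; apply: (@continuous_comp _ _ _ (fun t : R => x + t *: v) gamma); last exact: cg.
  by apply: continuous_addV; [exact: cst_continuous|exact: scalel_continuous].
pose I x v := Ap (x, v) 1 - Ap (x, v) 0.
have triangle x y : I 0 y - I 0 x = I x (y - x).
  pose h t := dot (gamma (loop x y t)) (velocity x y t).
  have ch : continuous h.
    apply: continuous_dot; last exact: continuous_velocity.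
    move=> t; apply: (@continuous_comp _ _ _ (loop x y) gamma); last exact: cg.
    exact: differentiable_continuous (differentiable_loop x y t).
  have [H pH] := primitive_exists ch.
  have H01 : H 1 - H 0 = 0.
    rewrite -(Rintegral_primitive ch pH) -[RHS](lag _ (loop_C1 x y) (loop_per x y)).
    apply: eq_Rintegral => t _; rewrite deriveE; last exact: differentiable_loop.
    by rewrite diff_loop scale1r.
  have [c0 s0 s1 s2 c3] := trig_values.
  have ds2 (t : R) : is_derive t 1 (fun t => sinc t ^+ 2) (2 * sinc t * (2 * pi * cosc t)).
    have h1 := is_derive_sinc t; apply: is_derive_eq; rewrite /GRing.scale /=; ring.
  have dc2 (t : R) : is_derive t 1 (fun t => cosc t ^+ 2) (2 * cosc t * (- (2 * pi) * sinc t)).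
    have h1 := is_derive_cosc t; apply: is_derive_eq; rewrite /GRing.scale /=; ring.
  (* The quarters of the period: from [x] to [y], from [y] to 0, a rest at 0, and from 0 to [x]. *)
  have q1 : H 4^-1 - H 0 = Ap (x, y - x) 1 - Ap (x, y - x) 0.
    have := substitution (a := 0) (b := 4^-1) _ pH (HAp (x, y - x)) ds2.
    rewrite s0 s1 expr1n expr0n /=; apply; first by clear; lra.
    move=> t ht; have ct := cosc_ge0 ht; have st : 0 <= sinc t by apply: sinc_ge0; move: ht; clear; lra.
    rewrite /h /loop /velocity /alpha1 /beta1 !pos_sqr_ge// (max_idPr ct) (max_idPr st) cosc_sinc.
    congr (dot (gamma _) _).
      by rewrite scalerBr scalerBl scale1r addrAC addrA.
    by rewrite scalerBr addrC -scaleNr; congr (_ *: _ + _ *: _); ring.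
  have q2 : H 2^-1 - H 4^-1 = Ap (0, y) 0 - Ap (0, y) 1.
    have := substitution (a := 4^-1) (b := 2^-1) _ pH (HAp (0, y)) ds2.
    rewrite s1 s2 expr1n expr0n /=; apply; first by clear; lra.
    move=> t ht; have ct : cosc t <= 0 by apply: cosc_le0; move: ht; clear; lra.
    have st : 0 <= sinc t by apply: sinc_ge0; move: ht; clear; lra.
    rewrite /h /loop /velocity /alpha1 /beta1 (pos_sqr_le ct) (pos_sqr_ge st) (max_idPl ct) (max_idPr st).
    by rewrite mulr0 mul0r !scale0r !add0r.
  have q3 : H (3 * 4^-1) - H 2^-1 = 0.
    have p0 : primitive (fun t => dot (gamma (0 + t *: 0)) (0 : V)) (fun=> 0).
      by move=> t; rewrite dot0r; exact: is_derive_cst.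
    have := substitution (a := 2^-1) (b := 3 * 4^-1) _ pH p0 ds2.
    rewrite subrr; apply; first by clear; lra.
    move=> t ht; have ct : cosc t <= 0 by apply: cosc_le0; move: ht; clear; lra.
    have st : sinc t <= 0 by apply: sinc_le0; move: ht; clear; lra.
    rewrite /h /velocity /alpha1 /beta1 (max_idPl ct) (max_idPl st).
    by rewrite !mulr0 !mul0r !scale0r addr0 !scaler0 !dot0r.
  have q4 : H 1 - H (3 * 4^-1) = Ap (0, x) 1 - Ap (0, x) 0.
    have := substitution (a := 3 * 4^-1) (b := 1) _ pH (HAp (0, x)) dc2.
    have c1 : cosc 1 = 1 by have := cosc_per 0; rewrite add0r c0.
    rewrite c3 c1 expr1n expr0n /=; apply; first by clear; lra.
    move=> t ht; have ct := cosc_ge0' ht.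
    have st : sinc t <= 0 by apply: sinc_le0; move: ht; clear; lra.
    rewrite /h /loop /velocity /alpha1 /beta1 (pos_sqr_le st) (pos_sqr_ge ct) (max_idPr ct) (max_idPl st).
    by rewrite mulr0 mul0r !scale0r !add0r !addr0.
  by rewrite /I; move: H01 q1 q2 q3 q4; clear; lra.
exists (fun q => I 0 q) => q eta eta0.
have d1 : 0 < d%:R + 1 :> R by rewrite ltr_wpDl.
have /cvgrPdist_lt/(_ _ (divr_gt0 eta0 d1))/nbhs_ballP[r /= r0 Hr] := cg q.
exists r => // h hr; rewrite triangle.
have -> : q + h - q = h by rewrite addrC addKr.
rewrite /I.
have [c] := mean_value 0 1 (HAp (q, h)).
rewrite (min_idPl ler01) (max_idPr ler01) subr0 mulr1 /= => /andP[c0 c1] ->.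
rewrite -dotBl; apply: le_trans (dot_bound _ _) _; rewrite ler_wpM2r//.
have := Hr (q + c *: h); rewrite -ball_normE /= opprD addrA subrr sub0r normrN distrC.
have -> : `|c *: h| < r.
  by apply: le_lt_trans hr; rewrite normrZ ger0_norm// ler_piMl.
move=> /(_ isT)/ltW h1; apply: le_trans (ler_wpM2l (ler0n R d) h1) _.
by rewrite mulrA ler_pdivrMr// mulrC ler_wpM2l ?(ltW eta0)// lerDl.
Qed.

End Triangle.

(** * The given family of lifts and the twist system *)

Section PerturbedLifts.
Local Open Scope quotient_scope.
Context {R : realType} {d : nat}.
Local Notation V := 'rV[R]_d.
Implicit Types (f : annulus R d -> annulus R d) (G : torus R d -> R).

Lemma lipschitz_lip_at (gamma : V -> V) q : lipschitz gamma -> lip_at gamma q.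
Proof.
move=> [M0 [_ HM]]; have M1 : M0 < `|M0| + 1 by apply: le_lt_trans (ler_norm _) _; rewrite ltrDl.
exists (`|M0| + 1), 1; split => //.
by move=> w _; exact: (HM _ M1 (w, q)).
Qed.

(** One [k] serves for all [e]: the family is continuous, and the comparison of lifts is made on
    pairs of a parameter and a point. *)
Lemma perturbed_lifts f G (T : twist_system R d) (F : R -> phase R d -> phase R d) :
  is_lift f (ts_F T) -> (forall q, ts_dG T q = torus_grad G (\pi_(torus R d) q)) ->
  continuous_family_of_lifts (perturbed f G) F ->
  exists k : 'rV[int]_d, forall e z, F e z = ((Feps T e z).1 + intv R k, (Feps T e z).2).
Proof.
move=> [cF HF] HdG [lifts cFam].
have piE e z : annulus_pi (F e z) = annulus_pi (Feps T e z).
  by rewrite (lifts e).2 /Feps HF /perturbed /annulus_pi /= HdG.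
have cdG : continuous (ts_dG T) by move=> q; exact/lip_at_continuous/ts_dG_lip.
have cFeps : continuous (fun z : R * phase R d => Feps T z.1 z.2).
  have c1 : continuous (fun z : (R * phase R d)%type => z.2.1).
    by move=> z; apply: (@continuous_comp _ _ _ (fun z : (R * phase R d)%type => z.2) (fun w : phase R d => w.1)); [exact: cvg_snd|exact: cvg_fst].
  have c2 : continuous (fun z : (R * phase R d)%type => z.2.2).
    by move=> z; apply: (@continuous_comp _ _ _ (fun z : (R * phase R d)%type => z.2) (fun w : phase R d => w.2)); [exact: cvg_snd|exact: cvg_snd].
  have c3 : continuous (fun z : (R * phase R d)%type => z.2.2 + z.1 *: ts_dG T z.2.1).
    move=> z; apply: cvgD; first exact: c2.
    by apply: cvgZ; [exact: cvg_fst|exact: (continuous_comp (c1 z) (cdG _))].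
  have c4 : continuous (fun z : (R * phase R d)%type => (z.2.1, z.2.2 + z.1 *: ts_dG T z.2.1) : phase R d).
    by move=> z; exact: (cvg_pair (c1 z) (c3 z)).
  by move=> z; exact: (@continuous_comp _ _ _ (fun z : (R * phase R d)%type => (z.2.1, z.2.2 + z.1 *: ts_dG T z.2.1) : phase R d) (ts_F T) z (c4 z) (cF _)).
have [|||k Hk] := @lifts_differ R d (R * phase R d)%type (fun z => (F z.1 z.2).1) (fun z => (Feps T z.1 z.2).1).
- by move=> z; apply: (continuous_comp (cFam z)); exact: cvg_fst.
- by move=> z; apply: (continuous_comp (cFeps z)); exact: cvg_fst.
- by move=> z; have [] := piE z.1 z.2.
exists k => e z; rewrite -(Hk (e, z)) /=; have [_ <-] := piE e z.
exact: surjective_pairing.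
Qed.

Lemma iter_shift (T : twist_system R d) (F : phase R d -> phase R d) e k N z :
  (forall z, F z = ((Feps T e z).1 + intv R k, (Feps T e z).2)) ->
  iter N F z = ((iter N (Feps T e) z).1 + intv R k *+ N, (iter N (Feps T e) z).2).
Proof.
move=> FE; elim: N => [|N IH]; first by rewrite mulr0n addr0 -surjective_pairing.
rewrite !iterS IH FE.
have kN : intv R k *+ N = intv R (k *+ N) by apply/rowP => i; rewrite mulmxnE !mxE mulmxnE rmorphMn.
by rewrite kN Feps_per -surjective_pairing /= -addrA -kN -mulrSr.
Qed.

(** Each step of [F] adds [k] to the position given by [Feps], so [n] steps add [k *+ n], and the
    translation [m] becomes [m - k *+ n]. *)
Lemma good_of_graph (T : twist_system R d) (F : phase R d -> phase R d) e k m n gamma :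
  (forall z, F z = ((Feps T e z).1 + intv R k, (Feps T e z).2)) ->
  lipschitz_lagrangian_periodic_graph F m n gamma -> good T (m - k *+ n) n e.
Proof.
move=> FE [[cg gper gn] glip glag].
have [U HU] := lagrangian_potential cg glag.
exists gamma, U; split => //.
- exact: periodic_bounded.
- by move=> q; exact: lipschitz_lip_at.
move=> q; have := gn q; rewrite (@iter_shift T F e k n _ FE) => -[h1 h2].
rewrite [LHS]surjective_pairing h2; congr pair.
apply: (addIr (intv R k *+ n)); rewrite h1 -addrA; congr (_ + _).
by apply/rowP => i; rewrite [RHS]mxE mulmxnE !mxE mulmxnE rmorphB rmorphMn subrK.
Qed.

End PerturbedLifts.

Theorem corollary1p15 (R : realType) (d : nat) (d_ge1 : (1 <= d)%N)
  (f : annulus R d -> annulus R d)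
  (f_twist : symplectic_twist_map f)
  (f_pos : strongly_positive f)
  (f_rate : bounded_rate f)
  (f_analytic : analyticity_property f)
  (G : torus R d -> R)
  (G_ext : has_holomorphic_extension G)
  (F : R -> phase R d -> phase R d)
  (F_lifts : continuous_family_of_lifts (perturbed f G) F)
  (m : 'rV[int]_d) (n : nat) (n_gt0 : (0 < n)%N)
  (mn_coprime : coprime_vec m n)
  (infinitely_many : infinite_set
    [set eps : R | exists gamma : 'rV[R]_d -> 'rV[R]_d,
       lipschitz_lagrangian_periodic_graph (F eps) m n gamma]) :
  exists c : R, forall x : torus R d, G x = c.
Proof.
have [T [liftT GT dGT]] := exists_twist_system f_twist f_pos f_rate f_analytic G_ext.
have [k Hk] := perturbed_lifts liftT dGT F_lifts.
have rig : forall q q', ts_G T q = ts_G T q'.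
  apply: (@rigidity R d T (m - k *+ n) n n_gt0); apply: sub_infinite_set infinitely_many.
  by move=> e [gamma /(good_of_graph (Hk e))].
exists (G (\pi 0)%qT) => x; rewrite -[x]reprK.
by rewrite -!GT (rig (repr x) 0).
Qed.
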